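(* Let $\alpha_1,\dots,\alpha_N\in\mathbb{Z}^n$ be non-zero integral vectors with nonnegative coordinates of maximal rank (i.e. spanning $\mathbb{Q}^n$). (a) For a fixed closed pointed polyhedral cone $C_i$ coming from the cone-subdivision algorithm (see context) applied to $\alpha_1,\dots,\alpha_N$, the partial-fraction algorithm (see context), applied with $C_i$ as the chamber of interest, will produce algebraic expressions for $P_{\alpha_1,\dots,\alpha_N}$ which are valid over the entire chamber $C_i$. (b) Let $D_1,\dots,D_K$ be the cones spanned over $\mathbb{Q}_{\ge0}$ by the $(n-1)$-element subsets of $\{\alpha_1,\dots,\alpha_N\}$ of rank $n-1$. Let $C_i$ be the closed polyhedral cones into which the boundaries of $D_1,\dots,D_K$ split $\Lambda_{\mathbb{Q}_{\geq 0}}(\{\alpha_1,\dots,\alpha_N\})$. Then $P_{\alpha_1,\dots,\alpha_N}$ is a quasipolynomial over each $C_i$. (c) Statement (b) holds if we replace the cones $D_i$ by the cones in the cone support of any partial fraction decomposition of $\prod_{i=1}^N\frac{1}{1-x^{\alpha_i}}$.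
   Context: Vector partition function: $P_{\alpha_1,\dots,\alpha_m}(\gamma)$ is the number of tuples $(t_1,\dots,t_m)$ of nonnegative integers with $\sum_i t_i\alpha_i=\gamma$ ($\gamma\in\mathbb{C}^n$). For $R\subset\mathbb{C}$, $\Lambda_R(\{\phi_i\})=\{\sum_i a_i\phi_i\mid a_i\in R\}$. $\langle\mu,\nu\rangle=\sum_k\mu^k\nu^k$ and $x^\alpha=x_1^{\alpha^1}\cdots x_n^{\alpha^n}$. A closed pointed polyhedral cone is a subset $C\subset\mathbb{Q}^n$ of non-zero $n$-volume given by finitely many homogeneous non-strict rational linear inequalities. The hyperplanes of the defining inequalities meeting $C$ in a set of non-zero $(n-1)$-volume are its supporting hyperplanes; their intersections with $C$ are its walls. Quasipolynomials: for positive integers $m,d$, an $m\times n$ integer matrix $M$ and an $m\times1$ integer column $c$, the basic quasinumber $\tau_{M,c,d}$ is the function on $\mathbb{C}^n$ equal to $1$ at $\gamma$ if $\gamma\in\mathbb{Z}^n$ and $M\gamma\equiv c\pmod d$, and $0$ otherwise. Quasipolynomials are the elements of the ring of functions on $\mathbb{C}^n$ generated over $\mathbb{Q}$ by the basic quasinumbers and the coordinate functions $\gamma\mapsto\gamma^i$. A function is a quasipolynomial over a cone if it agrees there with a quasipolynomial. Partial fraction decomposition of an element $q$ of the ring $\mathbb{Q}[x_1^{\pm1},\dots,x_n^{\pm1}][\frac1{1-x^\alpha}]_{0\neq\alpha\in\mathbb{Z}^n}$: a finite set $I$ of tuples $(\phi_1,\dots,\phi_s;l_1,\dots,l_s;m_1,\dots,m_s)$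 with $s\geq1$, $\phi_1,\dots,\phi_s\in\mathbb{Z}^n$ linearly independent, $l_i,m_i$ positive integers, and for each tuple a Laurent polynomial $p_{(\phi,l,m)}\in\mathbb{Q}[x_1^{\pm1},\dots,x_n^{\pm1}]$, such that $$q=\sum_{(\phi,l,m)\in I}p_{(\phi,l,m)}(x)\prod_{i=1}^s\frac{1}{(1-x^{l_i\phi_i})^{m_i}}.$$ Its cone support is the set of cones $\Lambda_{\mathbb{Q}_{\geq0}}(\{\phi_1,\dots,\phi_s\})$ for the tuples in $I$. In (b) and (c), ''boundary'' of a cone means its topological boundary (so a cone of dimension less than $n$ is its own boundary), and the cones into which the boundaries split $\Lambda_{\mathbb{Q}_{\ge0}}(\{\alpha_i\})$ are the (rational points of the) closures of the connected components of the complement of the union of the boundaries in the interior of the real cone spanned by the $\alpha_i$. The cone-subdivision algorithm (with $\alpha_1,\dots,\alpha_n$ linearly independent). Given a list of cones on each of which $P_{\alpha_1,\dots,\alpha_{m-1}}$ is a quasipolynomial, and $\gamma$ in general position (on no supporting hyperplane of a cone on the list), a wall $H$ of a cone $C$ on the list met by the ray $\{\gamma-t\alpha_m\mid t\geq0\}$ is an exit (respectively entering) wall for $\gamma$ with respect to $\alpha_m$ if the ray leaves (respectively enters) $C$ through $H$. Step 0: start with the list of one cone, determined by $\alpha_1,\dots,\alpha_n$; set $m=n+1$. Step 1: find the first cone $C_i$ on the list over which $P_{\alpha_1,\dots,\alpha_m}$ has not been computed and such that it has been computed over every cone adjacent to an entering wall for any point $\gamma\in C_i$ with respect to $\alpha_m$.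 If there is none, increase $m$ by 1; if then $m>N$, terminate, else repeat Step 1. Step 2: subdivide $C_i$ into closed pointed polyhedral sub-cones for each of which the sequence of exit walls with respect to $\alpha_m$ is the same for all its points in general position; replace $C_i$ by these sub-cones. Step 3: over each new sub-cone compute $P_{\alpha_1,\dots,\alpha_m}$ in closed form as a quasipolynomial from $P_{\alpha_1,\dots,\alpha_m}(\gamma)=\sum_{t\geq0}P_{\alpha_1,\dots,\alpha_{m-1}}(\gamma-t\alpha_m)$, by splitting the sum at the points where the ray passes from one cone of the list to the next and using on each cone the quasipolynomial for $P_{\alpha_1,\dots,\alpha_{m-1}}$. Step 4: go to Step 1. The partial-fraction algorithm. First stage (a partial fraction decomposition of $\prod_{i=1}^N\frac1{1-x^{\alpha_i}}$): the expression is stored as a sum of fractions $p(x)\prod_j\frac{1}{(1-x^{\phi_j})^{m_j}}$, with $p$ a Laurent polynomial and each $\phi_j$ a positive integer multiple of one of the $\alpha_i$; the set of those $\alpha_i$ is the support of the fraction. Initially no fraction is labeled reduced or has a preferred linear dependence. Repeat the following. Select a fraction having a preferred linear dependence; if there is none, select a fraction not labeled reduced and, if possible, choose arbitrarily and store as its preferred linear dependence a relation $a_0\phi_0=a_1\phi_1+\dots+a_k\phi_k$ among its vectors with integers $a_0>0$, $a_j\neq0$. If the support is linearly independent, label the fraction reduced and select again; if all fractions are reduced, terminate. Otherwise, apply to one factor $\frac1{1-x^{\phi_j}}$ for each $j=1,\dots,k$ the identity $$\prod_{j=1}^k\frac1{1-x^{\phi_j}}=\frac{1}{1-x^{a_1\phi_1+\dots+a_k\phi_k}}\sum_{j=1}^k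 x^{a_1\phi_1+\dots+a_{j-1}\phi_{j-1}}\,p_{a_j}(x^{\phi_j})\prod_{i\neq j}\frac1{1-x^{\phi_i}},$$ where $p_a(y)=1+y+\dots+y^{a-1}$ for $a>0$ and $p_a(y)=-y^{-1}-\dots-y^{a}$ for $a<0$, and to all factors $\frac{1}{1-x^{\phi_0}}$ the identity $\frac{1}{1-x^{\phi_0}}=\frac{p_{a_0}(x^{\phi_0})}{1-x^{a_0\phi_0}}$. The selected fraction is replaced by the resulting fractions; those with the same support inherit the preferred linear dependence, those with strictly smaller support have none. Second stage: fix the combinatorial chamber of interest by an indicator vector $\omega$ in general position inside it. The expression produced is the quasipolynomial in $\gamma$ given by the sum, over all tuples $(\phi,l,m)$ of the decomposition from the first stage with $\omega\in\Lambda_{\mathbb{Q}_{\geq0}}(\{\phi_1,\dots,\phi_s\})$ (so that $s=n$) and over all monomials $c_\delta x^\delta$ of $p_{(\phi,l,m)}$, of $$c_\delta\,\bar\tau(\gamma-\delta)\prod_{i=1}^n\binom{\langle\beta_i,\gamma-\delta\rangle+m_i-1}{m_i-1},$$ where $\langle\beta_i,l_k\phi_k\rangle=\delta_{ik}$, $\binom{y+m-1}{m-1}=\prod_{l=1}^{m-1}\left(\frac yl+1\right)$, and $\bar\tau$ is the indicator function of the lattice $\Lambda_{\mathbb{Z}}(\{l_1\phi_1,\dots,l_n\phi_n\})$.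
   Formalization: In (c) the decomposition is also required to have some linear functional positive on all α_i and all its vectors φ_i; without this (c) fails, e.g. for (1,0),(0,1),(1,1) with (1,1) replaced by −(1,1) in the decomposition. *)

(* Defs.v *)
From HB Require Import structures.
From Stdlib Require List.
From mathcomp Require Import all_boot all_order all_algebra.
From mathcomp Require Import fraction finmap complex.
From mathcomp Require mpoly.
From mathcomp Require Import all_classical all_reals all_analysis.
Import (canonicals) mpoly.

Set Implicit Arguments.
Unset Strict Implicit.
Unset Printing Implicit Defensive.

Import Order.TTheory GRing.Theory Num.Theory numFieldNormedType.Exports.

Local Open Scope classical_set_scope.
Local Open Scope ring_scope.

(* Vectors are rows. The same integral vector is read in Q^n, R^n or C^n. *)
Definition intv (K : pzRingType) (n : nat) (v : 'rV[int]_n) : 'rV[K]_n :=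
  map_mx intr v.

Definition ratv (K : unitRingType) (n : nat) (v : 'rV[rat]_n) : 'rV[K]_n :=
  map_mx ratr v.

Definition dot (K : pzRingType) (n : nat) (u v : 'rV[K]_n) : K :=
  \sum_(k < n) u 0 k * v 0 k.

Definition Lambda (K : pzRingType) (n : nat) (A : set K)
    (s : seq 'rV[int]_n) : set 'rV[K]_n :=
  [set v | exists c : 'I_(size s) -> K,
     (forall i, A (c i)) /\ v = \sum_(i < size s) c i *: intv K s`_i].

Definition nonneg (K : numDomainType) : set K := [set a | 0 <= a].

Definition integers (K : pzRingType) : set K := range (fun z : int => z%:~R).

(* The set of tuples counted is finite as soon as the vectors of a are non-zero
   with nonnegative coordinates; fset_set of an infinite set is empty. *)
Definition partition_function (K : pzRingType) (n : nat) (a : seq 'rV[int]_n)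
    (g : 'rV[K]_n) : K :=
  (#|` fset_set [set t : (size a).-tuple nat |
        \sum_(i < size a) intv K (a`_i *+ tnth t i) = g]|)%:R.

Definition quasinumber (K : pzRingType) (m n : nat) (M : 'M[int]_(m, n))
    (c : 'cV[int]_m) (d : nat) (g : 'rV[K]_n) : K :=
  (`[< exists z : 'rV[int]_n, g = intv K z /\
       forall i, ((M *m z^T)%R i ord0 = c i ord0 %[mod d])%Z >])%:R.

(* The ring of functions on K^n generated over Q by the basic quasinumbers and
   the coordinate functions. *)
Inductive quasipolynomial (K : numFieldType) (n : nat) :
    ('rV[K]_n -> K) -> Prop :=
| qp_const (a : rat) : quasipolynomial (fun _ => ratr a)
| qp_coord (i : 'I_n) : quasipolynomial (fun g => g 0 i)
| qp_quasinumber (m d : nat) (M : 'M[int]_(m, n)) (c : 'cV[int]_m) :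
    (0 < m)%N -> (0 < d)%N -> quasipolynomial (quasinumber M c d)
| qp_add f1 f2 : quasipolynomial f1 -> quasipolynomial f2 ->
    quasipolynomial (fun g => f1 g + f2 g)
| qp_mul f1 f2 : quasipolynomial f1 -> quasipolynomial f2 ->
    quasipolynomial (fun g => f1 g * f2 g).

Definition agree_on (K : numFieldType) (n : nat) (C : set 'rV[rat]_n)
    (f q : 'rV[K]_n -> K) : Prop :=
  forall g, C g -> f (ratv K g) = q (ratv K g).

Definition quasipolynomial_over (K : numFieldType) (n : nat)
    (C : set 'rV[rat]_n) (f : 'rV[K]_n -> K) : Prop :=
  exists2 q, quasipolynomial q & agree_on C f q.

(* A convex cone contains 0, so it has non-zero k-volume in a k-dimensional
   subspace containing it iff it contains k linearly independent vectors. *)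
Definition nonzero_volume (n k : nat) (S : set 'rV[rat]_n) : Prop :=
  exists2 s : k.-tuple 'rV[rat]_n, free s & forall v, v \in tval s -> S v.

(* A cone is given by the normals h of its defining inequalities <h, g> >= 0. *)
Definition cone_of (n : nat) (hs : seq 'rV[rat]_n) : set 'rV[rat]_n :=
  [set g | forall h, h \in hs -> 0 <= dot h g].

Definition polyhedral_cone (n : nat) (hs : seq 'rV[rat]_n) : Prop :=
  nonzero_volume n (cone_of hs).

Definition hyperplane (n : nat) (h : 'rV[rat]_n) : set 'rV[rat]_n :=
  [set g | dot h g = 0].

Definition supporting (n : nat) (hs : seq 'rV[rat]_n) (h : 'rV[rat]_n) : Prop :=
  [/\ h \in hs, h != 0 & nonzero_volume n.-1 (cone_of hs `&` hyperplane h)].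

Definition wall (n : nat) (hs : seq 'rV[rat]_n) (W : set 'rV[rat]_n) : Prop :=
  exists2 h, supporting hs h & W = cone_of hs `&` hyperplane h.

Definition general_position (n : nat) (cones : seq (seq 'rV[rat]_n))
    (g : 'rV[rat]_n) : Prop :=
  forall hs h, hs \in cones -> supporting hs h -> ~ hyperplane h g.

Definition ray (n : nat) (g v : 'rV[rat]_n) (t : rat) : 'rV[rat]_n := g - t *: v.

Definition leaves (n : nat) (hs : seq 'rV[rat]_n) (W : set 'rV[rat]_n)
    (g v : 'rV[rat]_n) (t : rat) : Prop :=
  [/\ 0 <= t, wall hs W, W (ray g v t) &
      exists2 e, 0 < e & forall u, 0 < u < e ->
        cone_of hs (ray g v (t - u)) /\ ~ cone_of hs (ray g v (t + u))].

Definition enters (n : nat) (hs : seq 'rV[rat]_n) (W : set 'rV[rat]_n)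
    (g v : 'rV[rat]_n) (t : rat) : Prop :=
  [/\ 0 <= t, wall hs W, W (ray g v t) &
      exists2 e, 0 < e & forall u, 0 < u < e ->
        ~ cone_of hs (ray g v (t - u)) /\ cone_of hs (ray g v (t + u))].

Definition exit_sequence (n : nat) (cones : seq (seq 'rV[rat]_n))
    (v g : 'rV[rat]_n) (Ws : seq (set 'rV[rat]_n)) : Prop :=
  exists ts : seq rat,
    [/\ size ts = size Ws, sorted <%R ts &
        forall W t, (exists2 hs, hs \in cones & leaves hs W g v t) <->
          (exists2 i, (i < size Ws)%N & W = nth set0 Ws i /\ t = ts`_i)].

(* A cone of the list while alpha_m is processed, with the quasipolynomial for
   P_{alpha_1..alpha_(m-1)} and, once computed, the one for
   P_{alpha_1..alpha_m}. *)
Record list_cone (K : numFieldType) (n : nat) := ListCone {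
  ineqs : seq 'rV[rat]_n;
  old_qp : 'rV[K]_n -> K;
  new_qp : option ('rV[K]_n -> K)
}.

Section ConeSubdivision.
Variables (K : numFieldType) (n : nat) (alpha : seq 'rV[int]_n).

Definition cones_of (L : seq (list_cone K n)) : seq (seq 'rV[rat]_n) :=
  [seq ineqs e | e <- L].

(* The cones adjacent to an entering wall of g are the cones that the ray from g
   enters through that wall. *)
Definition eligible (L : seq (list_cone K n)) (v : 'rV[rat]_n)
    (e : list_cone K n) : Prop :=
  ~~ isSome (new_qp e) /\
  forall g, cone_of (ineqs e) g -> general_position (cones_of L) g ->
  forall e' W t, List.In e' L -> enters (ineqs e') W g v t ->
  isSome (new_qp e').

(* The exit walls are those of the cones of the list before the
   subdivision; points in general position avoid the supporting hyperplanes of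
   the new cones as well. *)
Definition subdivides (L : seq (list_cone K n)) (v : 'rV[rat]_n)
    (e : list_cone K n) (news : seq (seq 'rV[rat]_n)) : Prop :=
  [/\ forall hs, hs \in news -> polyhedral_cone hs,
      forall g, cone_of (ineqs e) g <-> (exists2 hs, hs \in news & cone_of hs g),
      forall i j, (i < j < size news)%N ->
        ~ nonzero_volume n (cone_of (nth [::] news i) `&`
                            cone_of (nth [::] news j)) &
      forall hs, hs \in news -> exists Ws, forall g, cone_of hs g ->
        general_position (cones_of L ++ news) g ->
        exit_sequence (cones_of L) v g Ws].

(* alpha_(k+1) is being processed. In
   P_{alpha_1..alpha_(k+1)}(g) = sum_t P_{alpha_1..alpha_k}(g - t alpha_(k+1))
   the terms lying in a cone of the list are evaluated with the quasipolynomial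
   stored with that cone. The initial cone need not contain alpha_(n+1), ...,
   so the list need not cover the support of P_{alpha_1..alpha_k}; the terms
   lying in no cone of the list are kept as they are. *)
Definition computed (L : seq (list_cone K n)) (k : nat)
    (hs : seq 'rV[rat]_n) (q : 'rV[K]_n -> K) : Prop :=
  quasipolynomial q /\
  exists F : 'rV[rat]_n -> K,
    [/\ forall e g, List.In e L -> cone_of (ineqs e) g ->
          F g = old_qp e (ratv K g),
        forall g, (forall e, List.In e L -> ~ cone_of (ineqs e) g) ->
          F g = partition_function (take k alpha) (ratv K g) &
        forall g, cone_of hs g ->
          q (ratv K g) =
          \sum_(t \in [set: nat]) F (ray g (intv rat alpha`_k) t%:R)].

Definition next_vector (L : seq (list_cone K n)) : seq (list_cone K n) :=
  [seq ListCone (ineqs e) (odflt (old_qp e) (new_qp e)) None | e <- L].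

(* subdivision_state k L: the algorithm can reach the list L with the vectors
   alpha_1, ..., alpha_k completely processed and alpha_(k+1), if it exists,
   being processed (so m = k + 1). It terminates when k = size alpha. *)
Inductive subdivision_state : nat -> seq (list_cone K n) -> Prop :=
| sub_start hs q :
    size (take n alpha) = n -> free [seq intv rat v | v <- take n alpha] ->
    cone_of hs = Lambda (@nonneg rat) (take n alpha) ->
    quasipolynomial q ->
    agree_on (cone_of hs) (partition_function (take n alpha)) q ->
    subdivision_state n [:: ListCone hs q None]
| sub_cone k L1 e L2 (news : seq (seq 'rV[rat]_n * ('rV[K]_n -> K))) :
    let L := L1 ++ e :: L2 in
    let v := intv rat alpha`_k in
    subdivision_state k L ->
    (k < size alpha)%N ->
    eligible L v e ->
    (forall e', List.In e' L1 -> ~ eligible L v e') ->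
    subdivides L v e [seq c.1 | c <- news] ->
    (forall c, List.In c news -> computed L k c.1 c.2) ->
    subdivision_state k
      (L1 ++ [seq ListCone c.1 (old_qp e) (Some c.2) | c <- news] ++ L2)
| sub_next k L :
    subdivision_state k L ->
    (k < size alpha)%N ->
    (forall e, List.In e L -> isSome (new_qp e)) ->
    subdivision_state k.+1 (next_vector L).

Definition subdivision_cone (hs : seq 'rV[rat]_n) : Prop :=
  exists2 L, subdivision_state (size alpha) L & hs \in cones_of L.

End ConeSubdivision.

(* A Laurent polynomial over Q as a finite sum of monomials c x^d; the terms
   need not be collected. *)
Definition laurent (n : nat) : Type := seq (rat * 'rV[int]_n).

Definition lmul (n : nat) (p q : laurent n) : laurent n :=
  [seq (a.1 * b.1, a.2 + b.2) | a <- p, b <- q].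

Definition lexp (n : nat) (p : laurent n) (m : nat) : laurent n :=
  iter m (lmul p) [:: (1, 0)].

(* p_a(x^phi): 1 + y + ... + y^(a-1) for a >= 0 and - y^-1 - ... - y^a for
   a < 0, with y = x^phi; Negz b is -(b + 1). *)
Definition geometric (n : nat) (a : int) (phi : 'rV[int]_n) : laurent n :=
  match a with
  | Posz b => [seq (1, phi *+ i) | i <- iota 0 b]
  | Negz b => [seq (-1, phi *- i) | i <- iota 1 b.+1]
  end.

(* An entry (phi_i, l_i, m_i) of a tuple (phi; l; m), which stands for the
   factor 1 / (1 - x^(l_i phi_i))^m_i. *)
Definition pf_factor (n : nat) : Type := ('rV[int]_n * nat * nat)%type.

Definition fphi (n : nat) (t : pf_factor n) : 'rV[int]_n := t.1.1.
Definition fscale (n : nat) (t : pf_factor n) : nat := t.1.2.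
Definition fmult (n : nat) (t : pf_factor n) : nat := t.2.
Definition fvec (n : nat) (t : pf_factor n) : 'rV[int]_n := fphi t *+ fscale t.

(* Q(x_1, ..., x_n), which contains Q[x^{+-1}][1/(1 - x^a)] as a subring. *)
Definition ratfun (n : nat) : fieldType := {fraction (mpoly.mpoly n rat)}.

Definition xpow (n : nat) (a : 'rV[int]_n) : ratfun n :=
  \prod_(k < n) (tofrac (mpoly.mpolyX rat (mpoly.mnm1 k))) ^ (a 0 k).

Definition laurent_val (n : nat) (p : laurent n) : ratfun n :=
  \sum_(c <- p) ratr c.1 * xpow c.2.

Definition factors_val (n : nat) (T : seq (pf_factor n)) : ratfun n :=
  \prod_(t <- T) ((1 - xpow (fvec t)) ^+ fmult t)^-1.

Definition partial_fraction_decomposition (n : nat) (q : ratfun n)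
    (I : seq (seq (pf_factor n))) (p : seq (pf_factor n) -> laurent n) : Prop :=
  [/\ uniq I,
      forall T, T \in I ->
        [/\ (0 < size T)%N, free [seq intv rat (fphi t) | t <- T] &
            all (fun t => (0 < fscale t)%N && (0 < fmult t)%N) T] &
      q = \sum_(T <- I) laurent_val (p T) * factors_val T].

Definition generating_function (n : nat) (alpha : seq 'rV[int]_n) : ratfun n :=
  \prod_(a <- alpha) (1 - xpow a)^-1.

(* All the alpha_i and all the vectors phi of the decomposition lie in one open
   half-space. Since 1/(1 - x^phi) = - x^(-phi) / (1 - x^(-phi)), the vectors of
   a decomposition may otherwise be replaced by their opposites, and the cone
   support then says nothing about the chambers: for alpha = (1,0), (0,1), (1,1),
     prod 1/(1 - x^alpha_i)
       = (xy)^-2 / ((1 - x) (1 - (xy)^-1)^2)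
         + x^-2 y^-1 / ((1 - y) (1 - (xy)^-1)^2)
   has a cone support whose boundaries do not meet the open quadrant, where
   P(a, b) = min(a, b) + 1 is not a quasipolynomial. *)
Definition common_half_space (n : nat) (alpha : seq 'rV[int]_n)
    (I : seq (seq (pf_factor n))) : Prop :=
  exists h : 'rV[int]_n,
    (forall a, a \in alpha -> 0 < dot h a) /\
    (forall T t, T \in I -> t \in T -> 0 < dot h (fphi t)).

(* The relation a_0 phi_0 = a_1 phi_1 + ... + a_k phi_k; the vectors phi_j are
   given by their positions in the list of factors of the fraction. *)
Record dependence := Dependence {
  dep_pos : nat;
  dep_coef : nat;
  dep_terms : seq (nat * int)
}.

(* The fraction num * prod_j 1/(1 - x^phi_j)^m_j; the factor (v, l, m) stands
   for phi_j = l v, v being one of the alpha_i. The vectors v are distinct and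
   constitute the support. *)
Record pfraction (n : nat) := PFraction {
  num : laurent n;
  den : seq (pf_factor n);
  reduced : bool;
  preferred : option dependence
}.

Section PartialFractionAlgorithm.
Variable n : nat.
Implicit Types (f : pfraction n) (L : seq (pfraction n)).

Definition fac0 : pf_factor n := (0, 0%N, 0%N).

Definition den_vec (T : seq (pf_factor n)) (i : nat) : 'rV[int]_n :=
  fvec (nth fac0 T i).

Definition support_free (T : seq (pf_factor n)) : bool :=
  free [seq intv rat (fphi t) | t <- T].

Definition is_dependence (T : seq (pf_factor n)) (d : dependence) : Prop :=
  [/\ uniq (dep_pos d :: [seq j.1 | j <- dep_terms d]),
      all (fun i => (i < size T)%N) (dep_pos d :: [seq j.1 | j <- dep_terms d]),
      (0 < dep_coef d)%N, all (fun j => j.2 != 0) (dep_terms d) &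
      den_vec T (dep_pos d) *+ dep_coef d =
      \sum_(j <- dep_terms d) den_vec T j.1 *~ j.2].

(* With d the relation a_0 phi_0 = a_1 phi_1 + ... + a_k phi_k, one factor
   1/(1 - x^phi_j) for each j = 1..k is rewritten by
     prod_j 1/(1 - x^phi_j) = 1/(1 - x^(a_1 phi_1 + ... + a_k phi_k)) *
       sum_j x^(a_1 phi_1 + ... + a_(j-1) phi_(j-1)) p_(a_j)(x^phi_j)
             prod_(i != j) 1/(1 - x^phi_i)
   and every factor 1/(1 - x^phi_0) by p_(a_0)(x^phi_0) / (1 - x^(a_0 phi_0)).
   This is the summand j = r + 1 of the result. *)
Definition expand_at f (d : dependence) (r : nat) : pfraction n :=
  let T := den f in
  let i0 := dep_pos d in
  let a0 := dep_coef d in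
  let j := nth (0%N, 0) (dep_terms d) r in
  let shift := \sum_(j' <- take r (dep_terms d)) den_vec T j'.1 *~ j'.2 in
  let num' :=
    lmul (num f) (lmul [:: (1, shift)]
      (lmul (geometric j.2 (den_vec T j.1))
            (lexp (geometric a0%:Z (den_vec T i0)) (fmult (nth fac0 T i0))))) in
  let den' := [seq t <-
    mkseq (fun i => let t := nth fac0 T i in
      if i == i0 then (fphi t, (a0 * fscale t)%N, (fmult t).+1)
      else if i == j.1 then (fphi t, fscale t, (fmult t).-1)
      else t) (size T)
    | (0 < fmult t)%N] in
  (* phi_0 has become a_0 phi_0, so its coefficient in the inherited relation
     is 1 *)
  PFraction num' den' false
    (if size den' == size T then Some (Dependence i0 1 (dep_terms d)) else None).

Definition expand f (d : dependence) : seq (pfraction n) :=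
  [seq expand_at f d r | r <- iota 0 (size (dep_terms d))].

Definition no_preferred L : bool := all (fun f => ~~ isSome (preferred f)) L.

Inductive pf_step : seq (pfraction n) -> seq (pfraction n) -> Prop :=
| pf_expand L1 f L2 d :
    preferred f = Some d ->
    pf_step (L1 ++ f :: L2) (L1 ++ expand f d ++ L2)
| pf_choose L1 f L2 d :
    no_preferred (L1 ++ f :: L2) -> ~~ reduced f -> is_dependence (den f) d ->
    pf_step (L1 ++ f :: L2)
            (L1 ++ PFraction (num f) (den f) (reduced f) (Some d) :: L2)
| pf_label L1 f L2 :
    no_preferred (L1 ++ f :: L2) -> ~~ reduced f -> support_free (den f) ->
    pf_step (L1 ++ f :: L2)
            (L1 ++ PFraction (num f) (den f) true None :: L2).

Definition pf_terminal L : bool := all (@reduced n) L.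

Definition pf_start (alpha : seq 'rV[int]_n) : seq (pfraction n) :=
  [:: PFraction [:: (1, 0)]
        [seq (v, 1%N, count_mem v alpha) | v <- undup alpha] false None].

(* Whatever choices are made from the state L on, the procedure stops after
   finitely many steps, in a terminal state that satisfies Q. *)
Inductive pf_produces (Q : seq (pfraction n) -> Prop) :
    seq (pfraction n) -> Prop :=
| pf_stop L : pf_terminal L -> Q L -> pf_produces Q L
| pf_continue L :
    ~~ pf_terminal L -> (exists L', pf_step L L') ->
    (forall L', pf_step L L' -> pf_produces Q L') -> pf_produces Q L.

(* General position of w means that it avoids the supporting hyperplanes of the
   chamber hs and the proper subspaces spanned by vectors of alpha. *)
Definition indicator_vector (alpha : seq 'rV[int]_n) (hs : seq 'rV[rat]_n)
    (w : 'rV[rat]_n) : Prop :=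
  [/\ cone_of hs w, general_position [:: hs] w &
      forall s : seq 'rV[int]_n, {subset s <= alpha} ->
        let V := <<[seq intv rat v | v <- s]>>%VS in
        (\dim V < n)%N -> w \notin V].

Variable K : numFieldType.

(* binom(y + m - 1, m - 1) as a polynomial in y *)
Definition poly_binomial (y : K) (m : nat) : K :=
  \prod_(1 <= l < m) (y / l%:R + 1).

(* The rows are l_k phi_k, for a tuple of n factors. *)
Definition tuple_mx (T : seq (pf_factor n)) : 'M[K]_n :=
  \matrix_(k < n) intv K (den_vec T k).

(* The columns of the inverse matrix form the basis dual to (l_k phi_k). *)
Definition dual_vec (T : seq (pf_factor n)) (i : 'I_n) : 'rV[K]_n :=
  (col i (invmx (tuple_mx T)))^T.

Definition lattice_indicator (T : seq (pf_factor n)) (g : 'rV[K]_n) : K :=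
  (`[< Lambda (@integers K) [seq fvec t | t <- T] g >])%:R.

(* The sum runs over the tuples whose cone contains w; such a tuple has n
   entries because of the general position of w. *)
Definition produced_expression (w : 'rV[rat]_n) L (g : 'rV[K]_n) : K :=
  \sum_(f <- L |
        `[< Lambda (@nonneg rat) [seq fphi t | t <- den f] w >])
   \sum_(c <- num f)
     let g' := g - intv K c.2 in
     ratr c.1 * lattice_indicator (den f) g' *
     \prod_(i < n) poly_binomial (dot (dual_vec (den f) i) g')
                                 (fmult (nth fac0 (den f) i)).

End PartialFractionAlgorithm.

Definition boundary (T : topologicalType) (A : set T) : set T :=
  closure A `\` interior A.

(* The boundaries are those of the real cones spanned by the members of Ds; C
   consists of the rational points of the closure of a component. *)
Definition split_cone (R : realType) (n : nat) (alpha : seq 'rV[int]_n)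
    (Ds : set (seq 'rV[int]_n)) (C : set 'rV[rat]_n) : Prop :=
  let U : set 'rV[R]_n :=
    interior (Lambda (@nonneg R) alpha) `\`
    \bigcup_(D in Ds) boundary (Lambda (@nonneg R) D) in
  exists2 x, U x &
    C = [set g | closure (connected_component U x) (ratv R g)].

Definition corank1_subsets (n N : nat) (alpha : N.-tuple 'rV[int]_n) :
    set (seq 'rV[int]_n) :=
  [set s | exists I : {set 'I_N},
     [/\ #|I| = n.-1, s = [seq tnth alpha i | i <- enum I] &
         \dim <<[seq intv rat v | v <- s]>>%VS = n.-1]].

Definition cone_support (n : nat) (I : seq (seq (pf_factor n))) :
    set (seq 'rV[int]_n) :=
  [set s | exists2 T, T \in I & s = [seq fphi t | t <- T]].

(* Main.v *)
Require Import Defs.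
From mathcomp Require Import all_boot all_order all_algebra.
From mathcomp Require Import fraction finmap complex.
From mathcomp Require mpoly.
From mathcomp Require Import all_classical all_reals all_analysis.
From mathcomp Require Import zify ring lra.
Import (canonicals) mpoly.

Set Implicit Arguments.
Unset Strict Implicit.
Unset Printing Implicit Defensive.

Import Order.TTheory GRing.Theory Num.Theory numFieldNormedType.Exports.

(** Write P for the partition function of alpha, and let h be an integral functional
that is positive on all the vectors in play: the sum of the coordinates for (a) and (b),
the functional of the common half-space for (c).

From rational functions to counting. On functions on Z^n that vanish where h is very
negative, multiplication by 1 - x^v with h(v) > 0 is injective. Therefore an identity
between sums of fractions p(x) / prod (1 - x^v) is also an identity between the
coefficients of their expansions ([series_val0]). A partial fraction decomposition thus
writes P as a combination of translates g |-> P_T(g - delta), where the vectors of T are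
linearly independent, with multiplicities. On the cone of T the function P_T is an
explicit lattice indicator times binomials ([cnt_simplicial]), and it is zero elsewhere.

The shifts delta are the difficulty. If only those T whose cone contains a given
direction u are kept, the resulting quasipolynomial E agrees with P at z + k u for large
k only ([produced_eventually]), whereas the theorem claims agreement up to the walls. To
come back to k = 0, say that a sequence is killed if one of its iterated differences
vanishes. A quasipolynomial gives a killed sequence along every progression z + k d u,
for a suitable step d ([quasipolynomial_ray]), and two killed sequences that agree
eventually agree everywhere ([killed_eventually_eq]). So P(z) = E(z) as soon as k |->
P(z + k d u) is killed for k >= 0.

In (a) this comes from the subdivision algorithm: by induction on its steps, P agrees
with a quasipolynomial on the chamber ([subdivision_cone_agree]), and the chamber is
stable under adding multiples of w ([chamber_agree]). The partial fraction algorithm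
preserves the value of the sum of fractions ([expand_val]); it stops because every step
replaces one fraction by a bounded number of fractions of smaller potential
([pf_step_inv]).

In (b) and (c) no such quasipolynomial is given, and P is treated directly
([ray_killed]). Let u be in the cone of alpha, and suppose that the half-line from z in
direction u, its origin excepted, lies outside the cone of each subfamily of alpha whose
cone does not contain u. Applying a power of 1 - x^(d u) to the generating function, and
using d u = sum c_i alpha_i to cancel denominators as long as u is in the cone of the
remaining vectors, leaves only terms whose cones the half-line does not meet. The
exponents appearing in the numerators are controlled by perturbing the target z to z +
eta u; this is what makes the argument work from k = 0 on.

For z in the closure of a component of the complement of the boundaries, a rational u of
the component that is close enough to z satisfies this hypothesis, because finitely
generated cones have finitely many facets ([cone_facets], [good_direction]). Being
connected, the component lies in the interior of each simplicial cone of the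
decomposition or misses it ([connected_boundary]), so that E is the same for all z
([closure_quasipolynomial]). Part (c) is the case of the given decomposition. For (b),
take a decomposition produced by the algorithm of (a): the boundaries of its cones are
covered by cones spanned by n - 1 independent vectors of alpha ([simplicial_boundary]).
*)

Local Open Scope ring_scope.

(** * Scalar products and changes of scalars *)

Section Dot.
Variables (K : pzRingType) (n : nat).
Implicit Types u v w : 'rV[K]_n.

Lemma dotDr u v w : dot u (v + w) = dot u v + dot u w.
Proof. by rewrite -big_split; apply: eq_bigr => k _; rewrite mxE mulrDr. Qed.

Lemma dotNr u v : dot u (- v) = - dot u v.
Proof. by rewrite -sumrN; apply: eq_bigr => k _; rewrite mxE mulrN. Qed.

Lemma dotBr u v w : dot u (v - w) = dot u v - dot u w.
Proof. by rewrite dotDr dotNr. Qed.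

Lemma dot0r u : dot u 0 = 0.
Proof. by rewrite /dot big1 // => k _; rewrite mxE mulr0. Qed.

Lemma dotMnr u v k : dot u (v *+ k) = dot u v *+ k.
Proof. by elim: k => [|k IH]; rewrite ?mulr0n ?dot0r // !mulrS dotDr IH. Qed.

Lemma dot_sumr (I : Type) (r : seq I) (P : pred I) u (F : I -> 'rV[K]_n) :
  dot u (\sum_(i <- r | P i) F i) = \sum_(i <- r | P i) dot u (F i).
Proof. exact: (big_morph _ (dotDr u) (dot0r u)). Qed.

End Dot.

Lemma dotZr (K : comPzRingType) n a (u v : 'rV[K]_n) :
  dot u (a *: v) = a * dot u v.
Proof.
by rewrite /dot mulr_sumr; apply: eq_bigr => k _; rewrite mxE mulrCA.
Qed.

Lemma dotC (K : comPzRingType) n (u v : 'rV[K]_n) : dot u v = dot v u.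
Proof. by apply: eq_bigr => k _; rewrite mulrC. Qed.

Section Casts.
Variables (K : numFieldType) (n : nat).
Implicit Types u v : 'rV[int]_n.

Lemma intvD u v : intv K (u + v) = intv K u + intv K v.
Proof. exact: raddfD. Qed.

Lemma intvN u : intv K (- u) = - intv K u.
Proof. exact: raddfN. Qed.

Lemma intvB u v : intv K (u - v) = intv K u - intv K v.
Proof. exact: raddfB. Qed.

Lemma intv0 : intv K (0 : 'rV[int]_n) = 0.
Proof. exact: raddf0. Qed.

Lemma intvMn u k : intv K (u *+ k) = k%:R *: intv K u.
Proof. by rewrite /intv raddfMn scaler_nat. Qed.

Lemma intv_sum (I : Type) (r : seq I) (P : pred I) (F : I -> 'rV[int]_n) :
  intv K (\sum_(i <- r | P i) F i) = \sum_(i <- r | P i) intv K (F i).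
Proof. exact: raddf_sum. Qed.

Lemma intv_inj : injective (@intv K n).
Proof.
move=> u v /matrixP e; apply/matrixP => i j; have := e i j.
by rewrite !mxE => /intr_inj.
Qed.

Lemma ratv_intv u : ratv K (intv rat u) = intv K u.
Proof. by apply/matrixP => i j; rewrite !mxE ratr_int. Qed.

Lemma ratv_inj : injective (@ratv K n).
Proof.
move=> u v /matrixP e; apply/matrixP => i j; have := e i j.
by rewrite !mxE => /fmorph_inj.
Qed.

Lemma dot_ratv (u v : 'rV[rat]_n) :
  dot (ratv K u) (ratv K v) = ratr (dot u v).
Proof.
by rewrite /dot rmorph_sum; apply: eq_bigr => k _; rewrite !mxE rmorphM.
Qed.

Lemma ratv_int_exists (g : 'rV[rat]_n) z :
  ratv K g = intv K z -> g = intv rat z.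
Proof. by rewrite -ratv_intv => /ratv_inj. Qed.

End Casts.

(** * Counting solutions *)

Lemma ler_mulz_nat (a : int) (t : nat) : 0 < a -> t%:Z <= a *+ t.
Proof. by move=> a0; rewrite -mulr_natl natz; nia. Qed.

Section Counting.
Variables (n : nat) (h : 'rV[int]_n).
Implicit Types (T W : seq 'rV[int]_n) (g v : 'rV[int]_n).

(** The bound on the multiplicity t of v is safe when T is positive: h takes integral
values, so each use of v contributes at least 1 to [dot h g]. *)
Fixpoint sols T g : seq (seq nat) :=
  if T is v :: T' then
    [seq t :: s | t <- iota 0 `|dot h g|.+1, s <- sols T' (g - v *+ t)]
  else if g == 0 then [:: [::]] else [::].

Definition cnt T g : nat := size (sols T g).

Definition positive T := forall v, v \in T -> 0 < dot h v.

Lemma positive_cons v T : positive (v :: T) <-> 0 < dot h v /\ positive T.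
Proof.
split=> [p|[pv pT] w]; last by rewrite inE => /predU1P[->|/pT].
by split=> [|w wT]; apply: p; rewrite inE ?eqxx // wT orbT.
Qed.

Lemma sols_uniq T g : uniq (sols T g).
Proof.
elim: T g => [|v T IH] g; first by rewrite /=; case: ifP.
apply: (@allpairs_uniq_dep _ _ _ cons); first exact: iota_uniq.
  by move=> t _; exact: IH.
by move=> [t s] [t' s'] _ _ /= [-> ->].
Qed.

Lemma dot_sol_ge0 T (s : seq nat) : positive T ->
  0 <= dot h (\sum_(i < size T) T`_i *+ nth 0%N s i).
Proof.
move=> pT; rewrite dot_sumr sumr_ge0 // => i _; rewrite dotMnr mulrn_wge0 //.
by rewrite ltW // pT // mem_nth.
Qed.

(** Whatever positive h is used as a bound, the enumeration is complete; the number of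
solutions does not depend on h. *)
Lemma mem_sols T g s : positive T ->
  (s \in sols T g) =
  (size s == size T) && (\sum_(i < size T) T`_i *+ nth 0%N s i == g).
Proof.
elim: T g s => [|v T IH] g s pT.
  rewrite /= big_ord0 eq_sym; case: (eqVneq g 0) => _.
    by rewrite inE andbT; case: s.
  by rewrite inE andbF.
move/positive_cons: (pT) => [pv pT'].
apply/allpairsPdep/andP => [[t [s' [_]]]|].
  rewrite IH // => /andP[/eqP ss /eqP e] ->; rewrite /= ss eqxx; split=> //.
  by rewrite big_ord_recl /= e addrC subrK.
case: s => [|t s] [] //; rewrite big_ord_recl eqSS => ss /eqP e; rewrite /= in e.
exists t, s; rewrite IH // ss mem_iota /=; split=> //; last first.
  by rewrite -e addrC addKr.
have -> : dot h g = dot h v *+ t + dot h (\sum_(i < size T) T`_i *+ nth 0%N s i).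
  by rewrite -e dotDr dotMnr.
have := dot_sol_ge0 s pT'; move: pv.
move: (dot h v) (dot h _) => a b a0 b0.
by have := ler_mulz_nat t a0; lia.
Qed.

Lemma cnt_lt0 T g : positive T -> dot h g < 0 -> cnt T g = 0%N.
Proof.
move=> pT hg; case: (posnP (cnt T g)) => // c0.
case E : (sols T g) c0 => [|s l]; rewrite /cnt E // => _.
have : s \in sols T g by rewrite E inE eqxx.
rewrite mem_sols // => /andP[_ /eqP e].
by have := dot_sol_ge0 s pT; rewrite e leNgt hg.
Qed.

Lemma cnt_nil g : cnt [::] g = (g == 0).
Proof. by rewrite /cnt /=; case: eqP. Qed.

Lemma cnt_cons v T g :
  cnt (v :: T) g = (\sum_(t < `|dot h g|.+1) cnt T (g - v *+ t))%N.
Proof.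
transitivity (sumn [seq cnt T (g - v *+ t) | t <- iota 0 `|dot h g|.+1]).
  exact: size_allpairs_dep.
by rewrite sumnE big_map -[X in iota 0 X]subn0 -/(index_iota _ _) big_mkord.
Qed.

Lemma cnt_sum B v T g : positive (v :: T) -> dot h g < B%:Z ->
  cnt (v :: T) g = (\sum_(t < B) cnt T (g - v *+ t))%N.
Proof.
move=> /positive_cons[pv pT] gB.
have z (t : nat) : dot h g < t%:Z -> cnt T (g - v *+ t) = 0%N.
  move=> gt; apply: cnt_lt0 => //; rewrite dotBr dotMnr.
  by have := ler_mulz_nat t pv; lia.
rewrite cnt_cons -!(big_mkord xpredT (fun t => cnt T (g - v *+ t))).
set A := `|_|.+1; have gA : dot h g < A%:Z by rewrite /A; lia.
wlog AB : A B gA gB / (A <= B)%N.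
  move=> W; case/orP: (leq_total A B) => [/W->//|/W->//].
rewrite [RHS](big_cat_nat (leq0n A) AB) //=.
rewrite [X in (_ + X)%N]big_nat_cond.
rewrite [X in (_ + X)%N]big1 ?addn0 // => t.
by rewrite andbT => /andP[At _]; apply: z; apply: lt_le_trans gA _.
Qed.

(** Solutions that do not use v, and solutions that do. On generating functions, this
says that 1 - x^v cancels one factor 1 / (1 - x^v). *)
Lemma cnt_rec v T g : positive (v :: T) ->
  cnt (v :: T) g = (cnt T g + cnt (v :: T) (g - v))%N.
Proof.
move=> p; have [pv pT] := (positive_cons v T).1 p.
set B := `|dot h g|.+1; have gB : dot h g < B%:Z by rewrite /B; lia.
rewrite (@cnt_sum B.+1) //; last by apply: lt_trans gB _; lia.
rewrite (@cnt_sum B _ _ (g - v)) //; last first.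
  by rewrite dotBr; apply: lt_trans gB; lia.
rewrite big_ord_recl mulr0n subr0; congr addn.
by apply: eq_bigr => t _; rewrite /= mulrS opprD addrA.
Qed.

Lemma eq_cnt_cons v T W : cnt T =1 cnt W -> cnt (v :: T) =1 cnt (v :: W).
Proof. by move=> e g; rewrite !cnt_cons; apply: eq_bigr => t _; rewrite e. Qed.

Lemma cnt_swap v w T : positive [:: v, w & T] ->
  cnt [:: v, w & T] =1 cnt [:: w, v & T].
Proof.
move=> p g; have [pv /[dup] pwT /positive_cons [pw pT]] := (positive_cons v _).1 p.
have pvT : positive (v :: T) by apply/positive_cons.
have p' : positive [:: w, v & T] by apply/positive_cons.
set B := `|dot h g|.+1; have gB : dot h g < B%:Z by rewrite /B; lia.
have gB' u (t : nat) : 0 < dot h u -> dot h (g - u *+ t) < B%:Z.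
  move=> pu; rewrite dotBr dotMnr; apply: le_lt_trans gB.
  by rewrite lerBlDr lerDl mulrn_wge0 // ltW.
rewrite !(@cnt_sum B) //.
under eq_bigr => t _ do rewrite (@cnt_sum B) ?gB' //.
rewrite exchange_big; apply: eq_bigr => t _ /=.
rewrite (@cnt_sum B) ?gB' //; apply: eq_bigr => s _.
by rewrite -!addrA [- _ - _]addrC.
Qed.

Lemma positive_perm T W : perm_eq T W -> positive T -> positive W.
Proof. by move=> TW pT v; rewrite -(perm_mem TW); apply: pT. Qed.

Lemma cnt_mid v T W : positive (T ++ v :: W) ->
  cnt (T ++ v :: W) =1 cnt (v :: T ++ W).
Proof.
elim: T => [|w T IH] //= p g; have [_ pT] := (positive_cons w _).1 p.
rewrite (eq_cnt_cons w (IH pT)) cnt_swap //.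
by apply: positive_perm p; rewrite perm_cons -cat1s perm_catCA.
Qed.

Lemma cnt_perm T W : positive T -> perm_eq T W -> cnt T =1 cnt W.
Proof.
elim: T W => [|v T IH] W p TW; first by move: TW; rewrite perm_sym => /perm_nilP->.
have pW := positive_perm TW p; have [_ pT] := (positive_cons v T).1 p.
have vW : v \in W by rewrite -(perm_mem TW) inE eqxx.
case/splitPr: vW TW pW => W1 W2 TW pW g; rewrite cnt_mid //.
apply: eq_cnt_cons; apply: IH => //.
by move: TW; rewrite perm_sym -cat1s perm_catCA /= perm_cons perm_sym.
Qed.

End Counting.

Lemma partition_functionE n (h : 'rV[int]_n) (K : numFieldType) T z :
  positive h T -> partition_function T (intv K z) = (cnt h T z)%:R.
Proof.
move=> pT; rewrite /partition_function; congr _%:R.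
pose l : seq ((size T).-tuple nat) := pmap insub (sols h T z).
have -> : [set t : (size T).-tuple nat |
    \sum_(i < size T) intv K (T`_i *+ tnth t i) = intv K z]%classic =
    [set` [fset t in l]%fset]%classic.
  apply/seteqP; split=> t /=; rewrite in_fset mem_pmap_sub mem_sols //.
    rewrite -intv_sum => /intv_inj e; rewrite size_tuple eqxx /=; apply/eqP.
    by rewrite -e; apply: eq_bigr => i _; rewrite (tnth_nth 0%N).
  case/andP=> _ /eqP <-; rewrite -intv_sum; congr intv.
  by apply: eq_bigr => i _; rewrite (tnth_nth 0%N).
rewrite set_fsetK card_fseq undup_id ?pmap_sub_uniq ?sols_uniq //.
rewrite size_pmap_sub /cnt; apply/eqP; rewrite -all_count.
by apply/allP => s; rewrite mem_sols // => /andP[].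
Qed.

Lemma partition_function_nonint n (K : numFieldType) T (g : 'rV[K]_n) :
  (forall z, g <> intv K z) -> partition_function T g = 0.
Proof.
move=> gz; rewrite /partition_function.
suff -> : [set t : (size T).-tuple nat |
    \sum_(i < size T) intv K (T`_i *+ tnth t i) = g]%classic = set0.
  by rewrite fset_set0 cardfs0.
apply/seteqP; split=> t //=; rewrite -intv_sum => e.
by apply: (gz (\sum_(i < size T) T`_i *+ tnth t i)).
Qed.

Lemma cnt_sol n (h : 'rV[int]_n) T z : positive h T -> cnt h T z != 0%N ->
  exists s : nat -> nat, z = \sum_(i < size T) T`_i *+ s i.
Proof.
move=> pT; rewrite -lt0n /cnt; case E : (sols h T z) => [|s l] // _.
have : s \in sols h T z by rewrite E inE eqxx.
by rewrite mem_sols // => /andP[_ /eqP <-]; exists (nth 0%N s).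
Qed.

Lemma cnt_rcons n (h : 'rV[int]_n) B v T z : positive h (rcons T v) ->
  dot h z < B%:Z ->
  cnt h (rcons T v) z = (\sum_(t < B) cnt h T (z - v *+ t))%N.
Proof.
move=> p zB; rewrite (@cnt_perm _ _ _ (v :: T)) ?perm_rcons // (@cnt_sum _ _ B) //.
by apply: positive_perm p; rewrite perm_rcons.
Qed.

(** * Laurent polynomials acting on functions on the lattice *)

Section LaurentAction.
Variable n : nat.
Implicit Types (p q : laurent n) (f : 'rV[int]_n -> rat) (g v d : 'rV[int]_n).

(** The product of a Laurent polynomial and a formal Laurent series, the latter given by
its coefficients. *)
Definition act p f g : rat := \sum_(c <- p) c.1 * f (g - c.2).

Local Notation var k := (tofrac (mpoly.mpolyX rat (mpoly.mnm1 (k : 'I_n)))).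

Lemma tofrac_var_neq0 k : var k != 0 :> ratfun n.
Proof.
rewrite tofrac_eq0; apply/eqP => /(congr1 (mpoly.mcoeff (mpoly.mnm1 k))).
by rewrite mpoly.mcoeffX mpoly.mcoeff0 eqxx => /eqP; rewrite oner_eq0.
Qed.

Lemma xpow0 : xpow (0 : 'rV[int]_n) = 1.
Proof. by rewrite /xpow big1 // => k _; rewrite mxE expr0z. Qed.

Lemma xpowD v d : xpow (v + d) = xpow v * xpow d.
Proof.
rewrite /xpow -big_split; apply: eq_bigr => k _ /=.
by rewrite mxE expfzDr ?tofrac_var_neq0.
Qed.

Lemma xpow_neq0 v : xpow v != 0.
Proof. by apply/prodf_neq0 => k _; rewrite expfz_neq0 // tofrac_var_neq0. Qed.

Lemma xpowN v : xpow (- v) = (xpow v)^-1.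
Proof.
apply: (mulfI (xpow_neq0 v)).
by rewrite -xpowD subrr xpow0 divff // xpow_neq0.
Qed.

Lemma xpowMn v k : xpow (v *+ k) = xpow v ^+ k.
Proof. by elim: k => [|k IH]; rewrite ?xpow0 // mulrS exprS xpowD IH. Qed.

Lemma xpowMz v (a : int) : xpow (v *~ a) = xpow v ^ a.
Proof.
case: a => k; first by rewrite -pmulrn xpowMn.
by rewrite NegzE mulrNz xpowN -pmulrn xpowMn -exprnN.
Qed.

Lemma xpow_mon (m : 'I_n -> nat) :
  xpow (\row_k (m k)%:Z) =
  tofrac (mpoly.mpolyX rat (mpoly.Multinom [tuple m k | k < n])) :> ratfun n.
Proof.
rewrite mpoly.mpolyXE_id rmorph_prod /xpow; apply: eq_bigr => k _.
by rewrite mxE rmorphXn /= mpoly.mnmE.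
Qed.

Lemma ratr_tofrac (c : rat) : ratr c = tofrac (mpoly.mpolyC n c) :> ratfun n.
Proof.
pose f : {rmorphism rat -> ratfun n} := @tofrac _ \o @mpoly.mpolyC n rat.
by rewrite -[tofrac _]/(f c) -{2}[c]divq_num_den fmorph_div !rmorph_int.
Qed.

Lemma laurent_val_cat p q : laurent_val (p ++ q) = laurent_val p + laurent_val q.
Proof. exact: big_cat. Qed.

Lemma laurent_val_mul p q : laurent_val (lmul p q) = laurent_val p * laurent_val q.
Proof.
rewrite /laurent_val /lmul big_allpairs_dep mulr_suml; apply: eq_bigr => a _.
rewrite mulr_sumr; apply: eq_bigr => b _ /=.
by rewrite xpowD !ratr_tofrac !rmorphM /=; ring.
Qed.

Lemma laurent_val_exp p k : laurent_val (lexp p k) = laurent_val p ^+ k.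
Proof.
elim: k => [|k IH] /=; first by rewrite /laurent_val big_seq1 /= ratr_tofrac !rmorph1 mul1r xpow0.
by rewrite laurent_val_mul IH exprS.
Qed.

(** After multiplication by a monomial all the exponents are nonnegative, and the
statement becomes the linear independence of monomials in the polynomial ring. *)
Lemma laurent_coef0 p d :
  laurent_val p = 0 -> \sum_(c <- p | c.2 == d) c.1 = 0.
Proof.
move=> p0.
pose B := (\sum_(c <- p) \sum_k `|c.2 0%R k| + \sum_k `|d 0%R k|)%N.
pose m v : mpoly.multinom n := mpoly.Multinom [tuple `|(v 0%R k + B%:Z)%R|%N | k < n].
pose ok v := forall k, 0 <= v 0 k + B%:Z.
have okd : ok d.
  move=> k; suff : (`|d 0%R k| <= B)%N by move: (d _ k) (B) => a b; lia.
  by rewrite /B (bigD1 k (F := fun k => `|d 0%R k|%N)) //= addnCA leq_addr.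
have okp c : c \in p -> ok c.2.
  move=> cp k; suff : (`|c.2 0%R k| <= B)%N by move: (c.2 _ k) (B) => a b; lia.
  rewrite /B (big_rem c) //= (bigD1 k (F := fun k => `|c.2 0%R k|%N)) //=.
  by rewrite -!addnA leq_addr.
have xm v : ok v -> xpow v * xpow (const_mx B%:Z) = tofrac (mpoly.mpolyX rat (m v)).
  move=> vok; rewrite -xpowD -xpow_mon; congr xpow; apply/rowP => k.
  by rewrite !mxE gez0_abs.
have m_inj v : ok v -> (m v == m d) = (v == d).
  move=> vok; apply/eqP/eqP => [e|-> //]; apply/rowP => k.
  have := congr1 (fun x : mpoly.multinom n => mpoly.fun_of_multinom x k) e; rewrite !mpoly.mnmE.
  by have := vok k; have := okd k; move: (d _ k) (v _ k) (B) => x y b; lia.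
have : tofrac (\sum_(c <- p) mpoly.mpolyC n c.1 * mpoly.mpolyX rat (m c.2)) = 0.
  transitivity (laurent_val p * xpow (const_mx B%:Z)); last by rewrite p0 mul0r.
  rewrite rmorph_sum mulr_suml [LHS]big_seq [RHS]big_seq. apply: eq_bigr => c cp /=.
  by rewrite ratr_tofrac -mulrA xm ?rmorphM //; apply: okp.
move/eqP; rewrite tofrac_eq0 => /eqP /(congr1 (mpoly.mcoeff (m d))).
rewrite mpoly.mcoeff0 raddf_sum /= => e.
rewrite -[RHS]e big_mkcond [LHS]big_seq [RHS]big_seq; apply: eq_bigr => c cp.
rewrite mpoly.mcoeffCM mpoly.mcoeffX m_inj; last exact: okp.
by case: eqP; rewrite ?mulr1 ?mulr0.
Qed.

Lemma act_val0 p f g : laurent_val p = 0 -> act p f g = 0.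
Proof.
move=> p0; pose ds := undup [seq c.2 | c <- p].
transitivity (\sum_(d <- ds) (\sum_(c <- p | c.2 == d) c.1) * f (g - d)).
  under [RHS]eq_bigr do rewrite mulr_suml big_mkcond.
  rewrite exchange_big /= /act [LHS]big_seq [RHS]big_seq.
  apply: eq_bigr => c cp; have cd : c.2 \in ds by rewrite mem_undup map_f.
  rewrite (big_rem c.2) //= eqxx big1_seq ?addr0 // => d /andP[_].
  by rewrite mem_rem_uniq ?undup_uniq // inE eq_sym => /andP[/negbTE ->].
by rewrite big1 // => d _; rewrite laurent_coef0 // mul0r.
Qed.

Lemma xpow_neq1 v : v != 0 -> 1 - xpow v != 0.
Proof.
move=> v0; apply/eqP => e.
have /(@laurent_coef0 _ 0) : laurent_val [:: (1, 0); (-1, v)] = 0.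
  rewrite /laurent_val big_cons big_seq1 /= xpow0 !ratr_tofrac !rmorphN !rmorph1.
  by rewrite mul1r mulN1r.
rewrite big_cons big_mkcond big_seq1 /= eqxx (negbTE v0) addr0.
by move/eqP; rewrite oner_eq0.
Qed.

End LaurentAction.

(** * Expansion of fractions in a half-space *)

Section Expansion.
Variables (n : nat) (h : 'rV[int]_n).
Implicit Types (p q : laurent n) (g v d : 'rV[int]_n) (T : seq 'rV[int]_n).
Implicit Types (L : seq (laurent n * seq 'rV[int]_n)).

Definition series L g : rat :=
  \sum_(t <- L) act t.1 (fun g => (cnt h t.2 g)%:R) g.

Definition value L : ratfun n :=
  \sum_(t <- L) laurent_val t.1 * \prod_(v <- t.2) (1 - xpow v)^-1.

Definition mul_binomial v p : laurent n := p ++ [seq (- c.1, c.2 + v) | c <- p].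

Lemma laurent_val_binomial v p :
  laurent_val (mul_binomial v p) = (1 - xpow v) * laurent_val p.
Proof.
rewrite laurent_val_cat mulrBl mul1r; congr (_ + _).
rewrite /laurent_val big_map mulr_sumr -sumrN; apply: eq_bigr => c _ /=.
by rewrite xpowD !ratr_tofrac !rmorphN /=; ring.
Qed.

Lemma act_binomial v p f g :
  act (mul_binomial v p) f g = act p f g - act p f (g - v).
Proof.
rewrite /act big_cat big_map -sumrN; congr (_ + _); apply: eq_bigr => c _ /=.
by rewrite mulNr opprD [- c.2 - v]addrC addrA.
Qed.

Lemma act_bounded p T : positive h T ->
  exists b : int, forall g, dot h g < b -> act p (fun g => (cnt h T g)%:R) g = 0.
Proof.
move=> pT; elim: p => [|c p [b IH]]; first by exists 0 => g _; rewrite /act big_nil.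
exists (Num.min b (dot h c.2)) => g; rewrite lt_min => /andP[gb gc].
rewrite /act big_cons -/(act p (fun g => (cnt h T g)%:R) g) IH // addr0 cnt_lt0 ?mulr0 //.
by rewrite dotBr subr_lt0.
Qed.

Lemma series_bounded L : (forall t, t \in L -> positive h t.2) ->
  exists b : int, forall g, dot h g < b -> series L g = 0.
Proof.
elim: L => [|t L IH] pL; first by exists 0 => g _; rewrite /series big_nil.
have [s sL|b b0] := IH; first by apply: pL; rewrite inE sL orbT.
have [|c c0] := @act_bounded t.1 t.2; first by apply: pL; rewrite inE eqxx.
exists (Num.min b c) => g; rewrite lt_min => /andP[gb gc].
by rewrite /series big_cons -/(series L g) b0 // c0 // addr0.
Qed.

(** A function bounded below for h and invariant under v takes at g the value that it
takes at g - k v, where h is as negative as desired. *)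
Lemma periodic_bounded0 v (F : 'rV[int]_n -> rat) : 0 < dot h v ->
  (exists b : int, forall g, dot h g < b -> F g = 0) ->
  (forall g, F g = F (g - v)) -> forall g, F g = 0.
Proof.
move=> v0 [b b0] per g.
have shift k : F g = F (g - v *+ k).
  by elim: k => [|k ->]; rewrite ?subr0 // per mulrSr opprD addrA.
rewrite (shift `|dot h g - b|.+1) b0 // dotBr dotMnr.
by have := ler_mulz_nat `|dot h g - b|.+1 v0; lia.
Qed.

(** The denominators are cleared one factor at a time. Multiplying the identity by 1 -
x^v removes a factor from one of the fractions, and nothing is lost on the coefficients,
by [periodic_bounded0]. Once all denominators are gone, monomials are independent. *)
Lemma series_val0 L : (forall t, t \in L -> positive h t.2) ->
  value L = 0 -> forall g, series L g = 0.
Proof.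
move E : (\sum_(t <- L) size t.2)%N => m; elim: m L E => [|m IH] L E pL L0 g.
  have nil t : t \in L -> t.2 = [::].
    move=> tL; apply/nilP; rewrite /nilp; move/eqP: E.
    by rewrite sum_nat_seq_eq0 => /allP/(_ t tL).
  have <- : act (flatten [seq t.1 | t <- L]) (fun g => (g == 0)%:R) g = series L g.
    rewrite /act big_flatten big_map /series [LHS]big_seq [RHS]big_seq.
    apply: eq_bigr => t tL; apply: eq_bigr => c _.
    by rewrite nil // cnt_nil.
  apply: act_val0; rewrite -[RHS]L0 /laurent_val big_flatten big_map /value.
  rewrite [LHS]big_seq [RHS]big_seq; apply: eq_bigr => t tL.
  by rewrite nil // big_nil mulr1.
have [t tL t0] : exists2 t, t \in L & size t.2 != 0%N.
  apply/hasP; rewrite -[has _ _]negbK -all_predC; apply/negP => /allP a.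
  by move: E; rewrite big_seq big1 // => t /a /= /negPn/eqP.
case: t t0 tL => p [|v T] //= _ tL.
have [v0 pT] := (positive_cons h v T).1 (pL _ tL).
case/splitPr: tL E pL L0 => L1 L2 E pL L0.
pose mulv (t : laurent n * seq 'rV[int]_n) := (mul_binomial v t.1, t.2).
pose L' := map mulv L1 ++ (p, T) :: map mulv L2.
have pL1 t : t \in L1 -> positive h t.2.
  by move=> tL; apply: pL; rewrite mem_cat tL.
have pL2 t : t \in L2 -> positive h t.2.
  by move=> tL; apply: pL; rewrite mem_cat inE tL !orbT.
apply: (periodic_bounded0 v0 (series_bounded pL)) => {}g; apply/eqP.
rewrite -subr_eq0; apply/eqP.
have sub3 (a b c x y z : rat) :
    a + (b + c) - (x + (y + z)) = a - x + (b - y + (c - z)) by ring.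
rewrite -[RHS](IH L' _ _ _ g).
- rewrite /series /L' !big_cat !big_cons !big_map /= sub3; congr (_ + (_ + _)).
  + by rewrite -sumrB; apply: eq_bigr => t _; rewrite act_binomial.
  + rewrite /act -sumrB; apply: eq_bigr => c _; rewrite -mulrBr; congr (_ * _).
    have pvT := pL (p, v :: T); rewrite cnt_rec; last first.
      by apply: pvT; rewrite mem_cat inE eqxx orbT.
    by rewrite natrD [g - v - _]addrAC addrK.
  + by rewrite -sumrB; apply: eq_bigr => t _; rewrite act_binomial.
- move: E; rewrite /L' !big_cat !big_cons !big_map /= => /eqP.
  by rewrite addSn addnS eqSS => /eqP.
- move=> t; rewrite mem_cat inE => /or3P[/mapP[s /pL1 ps ->]|/eqP->|/mapP[s /pL2 ps ->]] //.
- rewrite -[RHS](mulr0 (1 - xpow v)) -L0 /value /L' !big_cat !big_cons !big_map /=.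
  rewrite !mulrDr !mulr_sumr; congr (_ + (_ + _)).
  + by apply: eq_bigr => t _; rewrite laurent_val_binomial mulrA.
  + rewrite [RHS]mulrCA; congr (_ * _); rewrite mulVKf // xpow_neq1 //.
    by apply: contraTneq v0 => ->; rewrite dot0r.
  + by apply: eq_bigr => t _; rewrite laurent_val_binomial mulrA.
Qed.

End Expansion.

(** * Facets of finitely generated cones *)

Section Cones.
Variable n : nat.
Implicit Types (s : seq 'rV[int]_n).

Lemma Lambda_cons (K : pzRingType) (A : set K) v s (g : 'rV[K]_n) :
  Lambda A (v :: s) g <-> exists2 t, A t & Lambda A s (g - t *: intv K v).
Proof.
split=> [[c [Ac ->]]|[t At [c [Ac e]]]].
  exists (c ord0) => //; exists (fun i => c (lift ord0 i)); split=> //.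
  by rewrite big_ord_recl addrAC subrr add0r.
exists (fun i => if unlift ord0 i is Some j then c j else t); split.
  by move=> i; case: unliftP => [j|] _.
rewrite -[LHS](subrK (t *: intv K v)) e addrC big_ord_recl unlift_none.
by congr (_ + _); apply: eq_bigr => i _; rewrite liftK.
Qed.

Lemma Lambda_nil (K : pzRingType) (A : set K) (g : 'rV[K]_n) :
  Lambda A [::] g <-> g = 0.
Proof.
split=> [[c [_ ->]]|->]; first by rewrite big_ord0.
by exists (fun=> 0); split=> [[]|]; rewrite ?big_ord0.
Qed.

Lemma dotBl (K : comPzRingType) (u v w : 'rV[K]_n) :
  dot (u - v) w = dot u w - dot v w.
Proof. by rewrite ![dot _ w]dotC dotBr. Qed.

Lemma dotZl (K : comPzRingType) a (u v : 'rV[K]_n) : dot (a *: u) v = a * dot u v.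
Proof. by rewrite ![dot _ v]dotC dotZr. Qed.

Lemma ratvB (K : numFieldType) (u v : 'rV[rat]_n) :
  ratv K (u - v) = ratv K u - ratv K v.
Proof. exact: raddfB. Qed.

Lemma ratvZ (K : numFieldType) a (v : 'rV[rat]_n) :
  ratv K (a *: v) = ratr a *: ratv K v.
Proof. by apply/rowP => k; rewrite !mxE rmorphM. Qed.

(** The witness is the largest of the lower bounds a_i / b_i (b_i < 0) and 0. *)
Lemma interval_elimination (F : realFieldType) (I : eqType) (l : seq I)
    (a b : I -> F) :
  (forall i, i \in l -> 0 <= b i -> 0 <= a i) ->
  (forall i j, i \in l -> j \in l -> 0 < b i -> b j < 0 -> b j * a i <= b i * a j) ->
  exists2 t : F, 0 <= t & forall i, i \in l -> t * b i <= a i.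
Proof.
move=> a0 ab.
have [t [t0 tmax tat]] : exists t : F, [/\ 0 <= t,
    forall i, i \in l -> b i < 0 -> a i / b i <= t &
    t = 0 \/ exists i, [/\ i \in l, b i < 0 & t = a i / b i]].
  elim: l {a0 ab} => [|i l [t [t0 tmax tat]]]; first by exists 0; split=> //; left.
  have [bi|bi] := ltP (b i) 0; last first.
    exists t; split=> //.
      by move=> j; rewrite inE => /predU1P[->|/tmax//]; rewrite ltNge bi.
    by case: tat => [->|[j [jl bj ->]]]; [left|right; exists j; rewrite inE jl orbT].
  have [le|lt] := leP (a i / b i) t.
    exists t; split=> //.
      by move=> j; rewrite inE => /predU1P[->|/tmax//].
    by case: tat => [->|[j [jl bj ->]]]; [left|right; exists j; rewrite inE jl orbT].
  exists (a i / b i); split; first exact: le_trans t0 (ltW lt).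
    move=> j; rewrite inE => /predU1P[->//|jl bj].
    exact: le_trans (tmax j jl bj) (ltW lt).
  by right; exists i; rewrite inE eqxx.
exists t => // i il; have [bi|bi|bi] := ltrgtP (b i) 0.
- by have := tmax i il bi; rewrite ler_ndivrMr.
- case: tat => [->|[j [jl bj ->]]]; first by rewrite mul0r a0 // ltW.
  rewrite mulrAC ler_ndivrMr // [_ * b j]mulrC [a j * _]mulrC.
  by have := ab i j il jl bi bj.
- by rewrite bi mulr0; apply: a0 => //; rewrite bi.
Qed.

(** Fourier-Motzkin elimination of the coefficients of the combination, one generator at
a time. The same rational inequalities serve over all fields; this is how rational and
real cones are compared. *)
Lemma cone_facets s : exists hs : seq 'rV[rat]_n,
  forall (F : realFieldType) (g : 'rV[F]_n),
    Lambda (@nonneg F) s g <-> forall h, h \in hs -> 0 <= dot (ratv F h) g.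
Proof.
elim: s => [|v s [hs IH]].
  exists ([seq delta_mx 0 k | k : 'I_n] ++ [seq - delta_mx 0 k | k : 'I_n]) => F g.
  have dotk k : dot (ratv F (delta_mx 0 k)) g = g 0 k.
    rewrite /dot (bigD1 k) //= !mxE !eqxx rmorph1 mul1r big1 ?addr0 // => j jk.
    by rewrite !mxE (negbTE jk) andbF rmorph0 mul0r.
  have dotNk k : dot (ratv F (- delta_mx 0 k)) g = - g 0 k.
    by rewrite -sub0r ratvB dotBl dotk /ratv raddf0 dotC dot0r sub0r.
  rewrite Lambda_nil; split=> [-> h _|H]; first by rewrite dot0r.
  apply/rowP => k; apply/eqP; rewrite mxE eq_le -dotk H ?andbT; last first.
    by rewrite mem_cat map_f ?mem_enum.
  rewrite dotk -oppr_ge0 -dotNk H // mem_cat.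
  by rewrite (map_f (fun k => - delta_mx 0 k)) ?mem_enum ?orbT.
pose r h := dot h (intv rat v).
exists ([seq h <- hs | 0 <= r h] ++
  [seq r p *: m - r m *: p | p <- [seq h <- hs | 0 < r h],
                             m <- [seq h <- hs | r h < 0]]) => F g.
have rF h : dot (ratv F h) (intv F v) = ratr (r h).
  by rewrite -ratv_intv dot_ratv.
rewrite Lambda_cons; split.
  case=> t t0 /IH H h.
  have {}H p : p \in hs -> t * ratr (r p) <= dot (ratv F p) g.
    by move=> /H; rewrite dotBr dotZr rF subr_ge0.
  rewrite mem_cat mem_filter => /orP[/andP[rh /H]|].
    by apply: le_trans; rewrite mulr_ge0 ?ler0q.
  case/allpairsP => -[p m] /= []; rewrite !mem_filter => /andP[rp /H Hp].
  case/andP => rm /H Hm ->; rewrite ratvB dotBl !ratvZ !dotZl subr_ge0.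
  have rpF : 0 < ratr (r p) :> F by rewrite ltr0q.
  have rmF : ratr (r m) < 0 :> F by rewrite ltrq0.
  by nra.
move=> H.
have [] := @interval_elimination F _ hs (fun h => dot (ratv F h) g)
   (fun h => ratr (r h)).
- move=> h hh; rewrite ler0q => rh; apply: H.
  by rewrite mem_cat mem_filter rh hh.
- move=> p m ph mh; rewrite ltr0q ltrq0 => rp rm; rewrite -subr_ge0.
  rewrite -!dotZl -!ratvZ -dotBl -ratvB; apply: H; rewrite mem_cat; apply/orP; right.
  by apply/allpairsP; exists (p, m); rewrite !mem_filter rp rm.
move=> t t0 Ht; exists t => //; apply/IH => h /Ht.
by rewrite dotBr dotZr rF subr_ge0.
Qed.

Lemma ratv_id (g : 'rV[rat]_n) : ratv rat g = g.
Proof.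
by apply/rowP => k; rewrite mxE -(fmorph_eq_rat idfun).
Qed.

Lemma cone_ratv (F : realFieldType) s (g : 'rV[rat]_n) :
  Lambda (@nonneg F) s (ratv F g) <-> Lambda (@nonneg rat) s g.
Proof.
have [hs H] := cone_facets s; rewrite !H.
by split=> Hg h /Hg; rewrite dot_ratv ler0q ratv_id.
Qed.

Lemma coneD (F : numFieldType) s (g g' : 'rV[F]_n) :
  Lambda (@nonneg F) s g -> Lambda (@nonneg F) s g' -> Lambda (@nonneg F) s (g + g').
Proof.
move=> [c [c0 ->]] [c' [c'0 ->]]; exists (fun i => c i + c' i); split.
  by move=> i; apply: addr_ge0; [exact: c0 | exact: c'0].
by rewrite -big_split; apply: eq_bigr => i _; rewrite scalerDl.
Qed.

Lemma coneZ (F : numFieldType) s a (g : 'rV[F]_n) : 0 <= a ->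
  Lambda (@nonneg F) s g -> Lambda (@nonneg F) s (a *: g).
Proof.
move=> a0 [c [c0 ->]]; exists (fun i => a * c i); split.
  by move=> i; apply: mulr_ge0 => //; exact: c0.
by rewrite scaler_sumr; apply: eq_bigr => i _; rewrite scalerA.
Qed.

Lemma cone0 (F : numFieldType) s : Lambda (@nonneg F) s 0.
Proof.
exists (fun=> 0); split=> [i|]; first exact: lexx.
by rewrite big1 // => i _; rewrite scale0r.
Qed.

Lemma cone_mem (F : numFieldType) s v : v \in s -> Lambda (@nonneg F) s (intv F v).
Proof.
elim: s => [|x s IH] //; rewrite inE => /predU1P[->|/IH H]; apply/Lambda_cons.
  by exists 1; [exact: ler01 | rewrite scale1r subrr; apply: cone0].
by exists 0; [exact: lexx | rewrite scale0r subr0].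
Qed.

Lemma cone_sub (F : numFieldType) s s' (g : 'rV[F]_n) :
  (forall v, v \in s -> Lambda (@nonneg F) s' (intv F v)) ->
  Lambda (@nonneg F) s g -> Lambda (@nonneg F) s' g.
Proof.
move=> ss' [c [c0 ->]]; apply: (big_ind (Lambda (@nonneg F) s')).
- exact: cone0.
- by move=> x y; apply: coneD.
- by move=> i _; apply: coneZ; [exact: c0 | apply/ss'/mem_nth].
Qed.

Lemma cnt_cone (h : 'rV[int]_n) s z : positive h s -> cnt h s z != 0%N ->
  Lambda (@nonneg rat) s (intv rat z).
Proof.
move=> ps /(cnt_sol ps)[t ->]; exists (fun i => (t i)%:R); split=> [i|].
  exact: ler0n.
by rewrite intv_sum; apply: eq_bigr => i _; rewrite intvMn.
Qed.

End Cones.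

(** * Iterated differences *)

Section Differences.
Variable K : comPzRingType.
Implicit Types (f g : nat -> K).

Definition delta f k := f k.+1 - f k.

(** The discrete form of being a polynomial of degree less than m. Unlike a formulation
by polynomials, it needs no interpolation when the sequence is only known through
recurrences. *)
Fixpoint killed m f : Prop :=
  if m is m'.+1 then killed m' (delta f) else forall k, f k = 0.

Lemma eq_killed m f g : f =1 g -> killed m f -> killed m g.
Proof.
elim: m f g => [|m IH] f g fg /=; first by move=> f0 k; rewrite -fg.
by apply: IH => k; rewrite /delta !fg.
Qed.

Lemma killed0 m f : (forall k, f k = 0) -> killed m f.
Proof.
elim: m f => [|m IH] f f0 //=; apply: IH => k; rewrite /delta !f0 subrr //.
Qed.

Lemma killedS m f : killed m f -> killed m.+1 f.
Proof.
elim: m f => [|m IH] f kf; first exact: killed0.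
exact: IH.
Qed.

Lemma killed_le m p f : (m <= p)%N -> killed m f -> killed p f.
Proof.
by move=> /subnK <- kf; elim: (p - m)%N => [|j IH] //; apply: killedS.
Qed.

Lemma killedD m f g : killed m f -> killed m g -> killed m (fun k => f k + g k).
Proof.
elim: m f g => [|m IH] f g /=; first by move=> f0 g0 k; rewrite f0 g0 addr0.
move=> kf kg; apply: (@eq_killed _ (fun k => delta f k + delta g k)).
  by move=> k; rewrite /delta opprD addrACA.
exact: IH.
Qed.

Lemma killed_shift m f : killed m f -> killed m (fun k => f k.+1).
Proof. by elim: m f => [|m IH] f /= kf; [move=> k; apply: kf | exact: (IH (delta f) kf)]. Qed.

(** The product rule: delta (f g) = delta f * g(. + 1) + f * delta g. *)
Lemma killedM m p f g : killed m f -> killed p g ->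
  killed (m + p) (fun k => f k * g k).
Proof.
move E : (m + p)%N => s; elim: s m p E f g => [|s IH] [|m] [|p] //= E f g.
- by move=> f0 _ k; rewrite f0 mul0r.
- by move=> f0 _; apply: (@killed0 s.+1) => k; rewrite f0 mul0r.
- by move=> _ g0; apply: (@killed0 s.+1) => k; rewrite g0 mulr0.
move=> kf kg; apply: (@eq_killed _ (fun k => delta f k * g k.+1 + f k * delta g k)).
  by move=> k; rewrite /delta; ring.
apply: killedD; first by apply: (IH m p.+1); [lia| |exact: (@killed_shift p.+1 g)].
by apply: (IH m.+1 p) => //; lia.
Qed.

Lemma killed_cst a : killed 1 (fun=> a).
Proof. by move=> k; rewrite /delta subrr. Qed.

Lemma killed_linear a b : killed 2 (fun k => a + b *+ k).
Proof. by move=> k; rewrite /delta !mulrS; ring. Qed.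

(** By induction the difference of f vanishes; so f is constant, and it vanishes
eventually. *)
Lemma killed_eventually0 m f k0 : killed m f ->
  (forall k, (k0 <= k)%N -> f k = 0) -> forall k, f k = 0.
Proof.
elim: m f => [|m IH] f //= kf f0.
have d0 : forall k, delta f k = 0.
  by apply: IH => // k k0k; rewrite /delta !f0 ?subrr // leqW.
have cst k j : f k = f (k + j)%N.
  elim: j => [|j ->]; rewrite ?addn0 // addnS.
  by have /eqP := d0 (k + j)%N; rewrite subr_eq0 => /eqP.
by move=> k; rewrite (cst k k0) f0 // leq_addl.
Qed.

Lemma killed_eventually_eq m p f g k0 : killed m f -> killed p g ->
  (forall k, (k0 <= k)%N -> f k = g k) -> forall k, f k = g k.
Proof.
move=> kf kg fg k; apply/eqP; rewrite -subr_eq0; apply/eqP; move: k.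
have kN : killed (1 + p) (fun k => -1 * g k) by apply: killedM; first exact: killed_cst.
apply: (@killed_eventually0 (maxn m (1 + p)) (fun k => f k - g k) k0).
  apply: (@eq_killed _ (fun k => f k + -1 * g k)) => [k|]; first by rewrite mulN1r.
  by apply: killedD; [apply: killed_le kf|apply: killed_le kN];
    rewrite ?leq_maxl ?leq_maxr.
by move=> k /fg ->; rewrite subrr.
Qed.

End Differences.

(** * Quasipolynomials along progressions *)

Section QuasipolynomialRays.
Variables (K : numFieldType) (n : nat).

Lemma quasinumberE m (M : 'M[int]_(m, n)) c d z :
  quasinumber M c d (intv K z) =
  (`[< forall i, ((M *m z^T)%R i ord0 = c i ord0 %[mod d])%Z >])%:R.
Proof.
congr _%:R; congr nat_of_bool; apply: asbool_equiv_eq; split=> [[y [/intv_inj <-]]|] //.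
by exists z.
Qed.

(** If the step is a multiple of all the moduli, then the quasinumbers are constant
along the progression and the coordinates are affine. *)
Lemma quasipolynomial_ray (q : 'rV[K]_n -> K) : quasipolynomial q ->
  exists2 d, (0 < d)%N & forall z u : 'rV[int]_n,
    exists m, killed m (fun k => q (intv K (z + u *+ (k * d)))).
Proof.
elim=> [a|i|m d M c m0 d0|f1 f2 _ [d1 d10 k1] _ [d2 d20 k2]
       |f1 f2 _ [d1 d10 k1] _ [d2 d20 k2]].
- by exists 1%N => // z u; exists 1%N; apply: killed_cst.
- exists 1%N => // z u; exists 2%N.
  apply: (eq_killed _ (@killed_linear K (intv K z 0 i) (intv K u 0 i))) => k.
  by rewrite muln1 intvD intvMn !mxE mulr_natl.
- exists d => // z u; exists 1%N => k; rewrite /delta !quasinumberE.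
  have e j : ((M *m (z + u *+ (j * d))^T)%R)
       = M *m z^T + (M *m u^T) *+ j *+ d.
    by rewrite linearD linearMn mulmxDr mulrnA !raddfMn.
  rewrite !e; apply/eqP; rewrite subr_eq0; apply/eqP; congr _%:R; congr nat_of_bool.
  apply: asbool_equiv_eq.
  have em j i : ((M *m z^T + (M *m u^T) *+ j *+ d)%R i ord0
       = (M *m z^T)%R i ord0 %[mod d])%Z.
    rewrite mxE; have -> : ((M *m u^T *+ j *+ d)%R i ord0) = ((M *m u^T *+ j)%R i ord0) * d%:Z.
      by rewrite mulmxnE -mulr_natr natz.
    by rewrite addrC modzMDl.
  by split=> H i; have := H i; rewrite !em.
- exists (d1 * d2)%N => [|z u]; first by rewrite muln_gt0 d10.
  have [m1 h1] := k1 z (u *+ d2); have [m2 h2] := k2 z (u *+ d1).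
  exists (maxn m1 m2); apply: killedD.
    apply: killed_le (leq_maxl _ _) _; apply: eq_killed h1 => k.
    by rewrite -mulrnA; congr (f1 (intv K (z + u *+ _))); lia.
  apply: killed_le (leq_maxr _ _) _; apply: eq_killed h2 => k.
  by rewrite -mulrnA; congr (f2 (intv K (z + u *+ _))); lia.
- exists (d1 * d2)%N => [|z u]; first by rewrite muln_gt0 d10.
  have [m1 h1] := k1 z (u *+ d2); have [m2 h2] := k2 z (u *+ d1).
  exists (m1 + m2)%N; apply: killedM.
    apply: eq_killed h1 => k; rewrite -mulrnA; congr (f1 (intv K (z + u *+ _))); lia.
  apply: eq_killed h2 => k; rewrite -mulrnA; congr (f2 (intv K (z + u *+ _))); lia.
Qed.

End QuasipolynomialRays.

(** * The partition function along a ray *)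

Lemma common_denominator_int (I : finType) (c : I -> rat) :
  exists2 d, (0 < d)%N & exists m : I -> int, forall i, c i * d%:R = (m i)%:~R.
Proof.
exists (\prod_i `|denq (c i)|)%N.
  by apply: prodn_gt0 => i; rewrite absz_gt0 denq_neq0.
exists (fun i => numq (c i) * (\prod_(j | j != i) `|denq (c j)|)%N%:Z) => i.
rewrite (bigD1 i) //= natrM mulrA intrM; congr (_ * _).
have -> : (`|denq (c i)|)%:R = (denq (c i))%:~R :> rat.
  by rewrite -[X in X%:~R]gez0_abs // denq_ge0.
by rewrite -[X in X * _]divq_num_den divfK // intr_eq0 denq_neq0.
Qed.

Lemma Lambda_map (K : pzRingType) (n : nat) (I : eqType) (A : set K)
    (f : I -> 'rV[int]_n) (r : seq I) (g : 'rV[K]_n) : A 0 -> uniq r ->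
  Lambda A [seq f i | i <- r] g <->
  exists c : I -> K, (forall i, A (c i)) /\ g = \sum_(i <- r) c i *: intv K (f i).
Proof.
move=> A0; elim: r g => [|i r IH] g /=.
  move=> _; rewrite Lambda_nil; split=> [->|[c [_ ->]]]; last by rewrite big_nil.
  by exists (fun=> 0); rewrite big_nil.
case/andP=> ir ur; rewrite Lambda_cons; split.
  case=> t At /(IH _ ur)[c [Ac e]]; exists (fun j => if j == i then t else c j).
  split=> [j|]; first by case: eqP.
  rewrite big_cons eqxx -[LHS](subrK (t *: intv K (f i))) e addrC; congr (_ + _).
  rewrite [LHS]big_seq [RHS]big_seq; apply: eq_bigr => j jr.
  by case: eqP ir => // <-; rewrite jr.
case=> c [Ac ->]; exists (c i) => //; apply/(IH _ ur); exists c; split=> //.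
by rewrite big_cons addrAC subrr add0r.
Qed.

Section Translations.
Variables (K : comPzRingType) (n : nat).
Implicit Types (F G : 'rV[int]_n -> K) (u z g : 'rV[int]_n).

(** Multiplication by 1 - x^u. *)
Definition diff u F g := F g - F (g - u).

Lemma eq_iter_diff r u F G : F =1 G -> iter r (diff u) F =1 iter r (diff u) G.
Proof.
by move=> FG; elim: r => [|r IH] //= g; rewrite /diff !IH.
Qed.

Lemma iter_diffD r u F G g :
  iter r (diff u) (fun g => F g + G g) g =
  iter r (diff u) F g + iter r (diff u) G g.
Proof.
by elim: r g => [|r IH] //= g; rewrite /diff !IH opprD addrACA.
Qed.

Lemma iter_diff0 r u F g : (forall i, (i <= r)%N -> F (g - u *+ i) = 0) ->
  iter r (diff u) F g = 0.
Proof.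
elim: r g => [|r IH] g F0 /=; first by have := F0 0%N isT; rewrite subr0.
rewrite /diff !IH ?subrr // => i ir; last by apply: F0; apply: leqW.
by rewrite -addrA -opprD -mulrS; apply: F0.
Qed.

(** The number r of differences and the offset k + r are tied: the leftmost point
involved by the r-th difference at k + r is the point k of the progression. *)
Lemma killed_diff r F z u d :
  (forall k, iter r (diff (u *+ d)) F (z + u *+ ((k + r) * d)) = 0) ->
  killed r (fun k => F (z + u *+ (k * d))).
Proof.
elim: r F z => [|r IH] F z H /=; first by move=> k; have := H k; rewrite addn0.
have := IH (diff (u *+ d) F) (z + u *+ d); move=> /(_ _)/eq_killed; apply=> k.
  by rewrite /diff /delta; congr (F _ - F _);
    [rewrite -addrA -mulrnDr -mulSn | rewrite addrAC addrK].
by rewrite -addrA -mulrnDr -mulSn -addnS -iterSr; apply: H.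
Qed.

End Translations.

Section Rays.
Variables (K : comPzRingType) (n N : nat) (h : 'rV[int]_n).
Variable alpha : 'I_N -> 'rV[int]_n.
Hypothesis pos : forall i, 0 < dot h (alpha i).
Implicit Types (A : {set 'I_N}) (z u g : 'rV[int]_n).

Definition subfamily A := [seq alpha i | i <- enum A].

Lemma positive_subfamily A : positive h (subfamily A).
Proof. by move=> v /mapP[i _ ->]. Qed.

Lemma cnt_subfamily A j g : j \in A ->
  cnt h (subfamily A) g =
  (cnt h (subfamily (A :\ j)) g + cnt h (subfamily A) (g - alpha j))%N.
Proof.
move=> jA; have p : perm_eq (subfamily A) (alpha j :: subfamily (A :\ j)).
  rewrite -[_ :: _]/(map alpha (j :: enum (A :\ j))); apply: perm_map.
  apply: uniq_perm; rewrite ?enum_uniq //= ?mem_enum ?setD11 ?enum_uniq //.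
  move=> i; rewrite inE !mem_enum !inE; case: eqP => // -> //.
rewrite !(cnt_perm (@positive_subfamily A) p) cnt_rec //.
exact: positive_perm p (@positive_subfamily A).
Qed.

Lemma cone_subfamily A (g : 'rV[rat]_n) :
  Lambda (@nonneg rat) (subfamily A) g <->
  exists c : 'I_N -> rat,
    (forall i, 0 <= c i) /\ g = \sum_(i in A) c i *: intv rat (alpha i).
Proof.
rewrite Lambda_map ?enum_uniq //.
by split=> -[c [c0 ->]]; exists c; rewrite big_enum.
Qed.

Section Sweep.
Variables (z u : 'rV[int]_n) (d : nat) (eta : rat).
Hypothesis eta0 : 0 < eta.
Hypothesis dich : forall A,
  (exists c : 'I_N -> nat, u *+ d = \sum_(i in A) alpha i *+ c i) \/
  (forall s : rat, 0 < s ->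
     ~ Lambda (@nonneg rat) (subfamily A) (intv rat z + s *: intv rat u)).

(** The points involved are z + (kap - i) d u - del for i <= r. If one of them were a
sum of vectors of A, adding the theta_i alpha_i would place z + s u in the cone of A,
with s = (kap - i - rho) d + eta >= eta. *)
Lemma sweep_outside A r del (theta : 'I_N -> rat) rho (kap : nat) :
  (forall s : rat, 0 < s ->
     ~ Lambda (@nonneg rat) (subfamily A) (intv rat z + s *: intv rat u)) ->
  (forall i, i \in A -> 0 <= theta i) -> r%:R + rho <= kap%:R ->
  intv rat del + eta *: intv rat u =
    (rho * d%:R) *: intv rat u + \sum_(i in A) theta i *: intv rat (alpha i) ->
  iter r (diff (u *+ d)) (fun g => (cnt h (subfamily A) (g - del))%:R : K)
    (z + u *+ (kap * d)) = 0.
Proof.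
move=> nc th0 rk e; apply: iter_diff0 => i ir.
set g := _ - del; case: (eqVneq (cnt h (subfamily A) g) 0%N) => [->//|].
move=> /(cnt_cone (@positive_subfamily A)) /cone_subfamily[a [a0 ea]].
case: (nc ((kap%:R - i%:R - rho) * d%:R + eta)).
  rewrite ltr_wpDl // mulr_ge0 ?ler0n //.
  have : (i%:R : rat) <= r%:R by rewrite ler_nat.
  by lra.
apply/cone_subfamily; exists (fun i => if i \in A then a i + theta i else 0); split.
  by move=> j; case: ifP => // /th0 t0; apply: addr_ge0.
under eq_bigr => j jA do rewrite jA scalerDl.
rewrite big_split /= -ea (_ : \sum_(i in A) theta i *: _ =
  - ((rho * d%:R) *: intv rat u) + (intv rat del + eta *: intv rat u)); last first.
  by rewrite e addKr.
by rewrite !intvB intvD !intvMn; apply/rowP => j; rewrite !mxE natrM; ring.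
Qed.

(** After multiplication by x^(eta u), the numerator x^del has as exponent rho d u plus
a point of the zonotope of A; rho measures how far it has moved along u.

If u is outside the cone of A, [sweep_outside] applies. Otherwise d u = sum c_i alpha_i
with c_i natural, and 1 - x^(d u) is telescoped along a lattice path b from 0 to c. The
step that increments b_j has the factor 1 - x^(alpha_j), which cancels a denominator,
and leaves a term of the same kind for A minus j. The path follows the segment from 0 to
c so closely that, at time s in [0, 1], 0 <= b_i + theta_i - s c_i <= 1. These numbers
are the new theta_i, and s is added to rho. As s <= 1, each difference used up increases
rho by at most 1, whence the invariant r + rho <= kap; each of them also removes a
vector, so that r > #|A| of them suffice. *)
Lemma sweep A r del (theta : 'I_N -> rat) rho (kap : nat) :
  (#|A| < r)%N -> (forall i, i \in A -> 0 <= theta i <= 1) -> r%:R + rho <= kap%:R ->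
  intv rat del + eta *: intv rat u =
    (rho * d%:R) *: intv rat u + \sum_(i in A) theta i *: intv rat (alpha i) ->
  iter r (diff (u *+ d)) (fun g => (cnt h (subfamily A) (g - del))%:R : K)
    (z + u *+ (kap * d)) = 0.
Proof.
elim: r A del theta rho => [|r IH] A del theta rho // Ar th01 rk e.
have [[c uc]|nc] := dich A; last first.
  by apply: (sweep_outside nc _ rk e) => i /th01/andP[].
pose pos_of (b : 'I_N -> nat) := \sum_(i in A) alpha i *+ b i.
pose F b g : K := (cnt h (subfamily A) (g - (del + pos_of b)))%:R.
suff walk p (b : 'I_N -> nat) s0 : (\sum_(i in A) (c i - b i) = p)%N ->
    (forall i, i \in A -> (b i <= c i)%N) -> 0 <= s0 ->
    (forall i, i \in A ->
       s0 * (c i)%:R <= (b i)%:R + theta i <= s0 * (c i)%:R + 1) ->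
    iter r (diff (u *+ d)) (fun g => F b g - F c g) (z + u *+ (kap * d)) = 0.
  rewrite iterSr; rewrite -[RHS](walk _ (fun=> 0%N) 0 erefl) //.
    apply: eq_iter_diff => g; rewrite /diff /F; congr (_%:R - _%:R).
      by rewrite /pos_of big1 ?addr0.
    by rewrite /pos_of -uc opprD [- del - _]addrC addrA.
  by move=> i /th01; rewrite mul0r !add0r.
elim: p b s0 => [|p IHp] b s0 sp bc s00 inv.
  rewrite iter_diff0 // => i _; rewrite /F; suff -> : pos_of b = pos_of c by rewrite subrr.
  apply: eq_bigr => j jA; congr (_ *+ _); apply/eqP; rewrite eqn_leq bc //=.
  by move/eqP: sp; rewrite sum_nat_eq0 => /forall_inP/(_ j jA); rewrite subn_eq0.
pose P i := (i \in A) && (b i < c i)%N.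
have [i0 Pi0] : exists i, P i.
  case: (pickP P) => [i Pi|nP]; first by exists i.
  move: sp; rewrite big1 // => i iA; apply/eqP; rewrite subn_eq0.
  by have := nP i; rewrite /P iA /= ltnNge => /negbFE.
pose t i : rat := ((b i)%:R + theta i) / (c i)%:R.
(* the coordinate j whose next increment comes first, at time s *)
case: (@Order.TotalTheory.arg_minP _ _ _ i0 P t Pi0) => j /andP[jA bcj] tmin.
set s := t j in tmin.
have cj0 : 0 < (c j)%:R :> rat by rewrite ltr0n (leq_trans _ bcj).
have sj : s * (c j)%:R = (b j)%:R + theta j by rewrite divfK // gt_eqF.
have s0s : s0 <= s by rewrite -(ler_pM2r cj0) sj; case/andP: (inv j jA).
have bcR i : (b i < c i)%N -> (b i)%:R + 1 <= (c i)%:R :> rat.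
  by rewrite natr1 ler_nat.
have s1 : s <= 1.
  by rewrite -(ler_pM2r cj0) sj mul1r; have := bcR _ bcj; have /andP[_] := th01 j jA; lra.
have inv' i : i \in A -> s * (c i)%:R <= (b i)%:R + theta i <= s * (c i)%:R + 1.
  move=> iA; have /andP[_ hi] := inv i iA; have /andP[t0 _] := th01 i iA.
  have ci0 : 0 <= (c i)%:R :> rat by rewrite ler0n.
  apply/andP; split; last first.
    by apply: le_trans hi _; rewrite lerD2r ler_wpM2r.
  have [bci|] := ltnP (b i) (c i).
    have ci : 0 < (c i)%:R :> rat by rewrite ltr0n (leq_trans _ bci).
    by rewrite -ler_pdivlMr //; apply: tmin; rewrite /P iA bci.
  move=> cb; have : (c i)%:R <= (b i)%:R :> rat by rewrite ler_nat.
  by have := ler_wpM2r ci0 s1; lra.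
pose b' i := (b i + (i == j))%N.
have pb' : pos_of b' = pos_of b + alpha j.
  rewrite /pos_of /b'; under eq_bigr do rewrite mulrnDr; rewrite big_split; congr (_ + _).
  rewrite (bigD1 j) //= eqxx big1 ?addr0 // => i /andP[_ /negbTE ->]; exact: mulr0n.
have split_F g : F b g - F c g =
    (cnt h (subfamily (A :\ j)) (g - (del + pos_of b)))%:R + (F b' g - F c g).
  rewrite /F (cnt_subfamily _ jA) pb' natrD; set x := _%:R.
  by rewrite -addrA; congr (x + (_%:R - _)); congr cnt; rewrite !opprD !addrA.
rewrite (eq_iter_diff _ _ split_F) iter_diffD.
rewrite (IHp b' s) ?addr0.
- apply: (IH _ _ (fun i => (b i)%:R + theta i - s * (c i)%:R) (rho + s)).
  + by move: Ar; rewrite (cardsD1 j) jA.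
  + move=> i /setD1P[_ /inv']; lra.
  + by move: rk; rewrite -[r.+1]addn1 natrD; lra.
  + rewrite intvD addrAC e.
    have -> : \sum_(i in A :\ j) ((b i)%:R + theta i - s * (c i)%:R) *: intv rat (alpha i) =
        \sum_(i in A) ((b i)%:R + theta i - s * (c i)%:R) *: intv rat (alpha i).
      rewrite [RHS](big_setD1 j) //= sj subrr scale0r add0r //.
    have -> : (rho + s) * d%:R *: intv rat u =
        rho * d%:R *: intv rat u + \sum_(i in A) (s * (c i)%:R) *: intv rat (alpha i).
      rewrite mulrDl scalerDl; congr (_ + _); rewrite -scalerA -intvMn uc.
      rewrite intv_sum scaler_sumr; apply: eq_bigr => i _.
      by rewrite intvMn scalerA.
    rewrite -!addrA; congr (_ + _); rewrite /pos_of intv_sum -!big_split.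
    apply: eq_bigr => i _ /=; rewrite intvMn -!scalerDl; congr (_ *: _); ring.
- rewrite (big_setD1 j jA) in sp; rewrite (big_setD1 j jA) /b' /= eqxx.
  rewrite (eq_bigr (fun i => (c i - b i)%N)); last first.
    by move=> i /setD1P[/negbTE -> _]; rewrite addn0.
  by move: sp bcj => /=; lia.
- by move=> i iA; rewrite /b'; case: eqP => [->|_]; rewrite ?addn1 // addn0 bc.
- exact: le_trans s0s.
- move=> i iA; rewrite /b'; case: eqP => [->|_]; last by rewrite addn0 inv'.
  by rewrite addn1 -natr1 sj; lra.
Qed.

End Sweep.

Lemma common_denominator (c : 'I_N -> rat) : (forall i, 0 <= c i) ->
  exists2 d, (0 < d)%N & exists m : 'I_N -> nat, forall i, c i * d%:R = (m i)%:R.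
Proof.
move=> c0; have [d d0 [m mE]] := common_denominator_int c.
exists d => //; exists (fun i => `|m i|%N) => i.
rewrite natr_absz ger0_norm ?mE // -(ler0z rat) -mE mulr_ge0 ?ler0n //.
Qed.

Lemma cone_multiple A u : Lambda (@nonneg rat) (subfamily A) (intv rat u) ->
  exists2 d, (0 < d)%N &
    exists c : 'I_N -> nat, u *+ d = \sum_(i in A) alpha i *+ c i.
Proof.
case/cone_subfamily => c [/common_denominator[d d0 [m cm]] e].
exists d => //; exists m; apply: (@intv_inj rat).
rewrite intvMn e intv_sum scaler_sumr; apply: eq_bigr => i _.
by rewrite intvMn scalerA mulrC cm.
Qed.

(** Since u is in the cone of the whole family, eta u is a point of its zonotope for eta
small enough, and the sweep can start from del = 0 and rho = 0. The step d has to be a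
common multiple of the denominators in expressions of u by the subfamilies whose cone
contains it. *)
Lemma ray_killed z u :
  (forall A, Lambda (@nonneg rat) (subfamily A) (intv rat u) \/
     (forall s : rat, 0 < s ->
       ~ Lambda (@nonneg rat) (subfamily A) (intv rat z + s *: intv rat u))) ->
  Lambda (@nonneg rat) (subfamily [set: 'I_N]) (intv rat u) ->
  exists2 d, (0 < d)%N & killed N.+1
    (fun k => (cnt h (subfamily [set: 'I_N]) (z + u *+ (k * d)))%:R : K).
Proof.
move=> dich uT.
have [dA dA0 Hd] : exists2 dA : {set 'I_N} -> nat, (forall A, 0 < dA A)%N &
    forall A, Lambda (@nonneg rat) (subfamily A) (intv rat u) ->
      exists c : 'I_N -> nat, u *+ dA A = \sum_(i in A) alpha i *+ c i.
  have /choice[dA H] : forall A, exists d, (0 < d)%N /\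
      (Lambda (@nonneg rat) (subfamily A) (intv rat u) ->
       exists c : 'I_N -> nat, u *+ d = \sum_(i in A) alpha i *+ c i).
    move=> A; have [/cone_multiple[d d0 H]|n_in] :=
        pselect (Lambda (@nonneg rat) (subfamily A) (intv rat u)).
      by exists d.
    by exists 1%N.
  by exists dA => A; case: (H A).
pose d := (\prod_(A : {set 'I_N}) dA A)%N.
have d0 : (0 < d)%N by apply: prodn_gt0.
exists d => //.
have [c [c0 uc]] := (cone_subfamily _ _).1 uT.
pose eta : rat := (1 + \sum_i c i)^-1.
have sc0 : 0 <= \sum_i c i by apply: sumr_ge0.
have eta0 : 0 < eta by rewrite invr_gt0; lra.
apply: (@killed_diff _ _ N.+1 (fun g => (cnt h (subfamily [set: 'I_N]) g)%:R)) => k.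
have dich' A : (exists c : 'I_N -> nat, u *+ d = \sum_(i in A) alpha i *+ c i) \/
  (forall s : rat, 0 < s ->
     ~ Lambda (@nonneg rat) (subfamily A) (intv rat z + s *: intv rat u)).
  case: (dich A) => [/Hd[m um]|]; [left|by right].
  rewrite /d (bigD1 A) //= mulrnA um; set e := (\prod_(B | _) _)%N.
  exists (fun i => m i * e)%N; rewrite -sumrMnl; apply: eq_bigr => i _.
  by rewrite mulrnA.
have := @sweep z u d eta eta0 dich' [set: 'I_N] N.+1 0 (fun i => eta * c i) 0 (k + N.+1).
rewrite cardsT card_ord ltnSn => /(_ isT).
have -> : (fun g => (cnt h (subfamily [set: 'I_N]) (g - 0))%:R) =
    (fun g => (cnt h (subfamily [set: 'I_N]) g)%:R : K).
  by apply: funext => g; rewrite subr0.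
apply.
- move=> i _; apply/andP; split; first by rewrite mulr_ge0 // ltW.
  have ci : c i <= \sum_i c i.
    by rewrite (bigD1 i) //= lerDl sumr_ge0.
  rewrite mulrC ler_pdivrMr ?mul1r; lra.
- by rewrite addr0 ler_nat leq_addl.
- rewrite intv0 add0r mul0r scale0r add0r uc scaler_sumr.
  by apply: eq_bigr => i _; rewrite scalerA.
Qed.

End Rays.

(** * Partition functions of independent vectors *)

Lemma Lambda_nat (K : pzRingType) n (A : set K) (s : seq 'rV[int]_n) (g : 'rV[K]_n) :
  A 0 -> Lambda A s g <-> exists c : nat -> K,
    (forall i, A (c i)) /\ g = \sum_(i < size s) c i *: intv K s`_i.
Proof.
move=> A0; split=> [[c [Ac ->]]|[c [Ac ->]]]; last by exists (fun i => c i).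
exists (fun i => if insub i is Some j then c j else 0); split=> [i|].
  by case: insub.
by apply: eq_bigr => i _; rewrite valK.
Qed.

Lemma cnt_functional n (h : 'rV[int]_n) (lam : 'rV[rat]_n) T x : positive h T ->
  (forall v, v \in T -> 0 <= dot lam (intv rat v)) -> cnt h T x != 0%N ->
  0 <= dot lam (intv rat x).
Proof.
move=> pT lT /(cnt_sol pT)[s ->]; rewrite intv_sum dot_sumr sumr_ge0 // => i _.
by rewrite intvMn dotZr mulr_ge0 ?ler0n // lT // mem_nth.
Qed.

Section Multiplicity.
Variables (n : nat) (h : 'rV[int]_n) (lam : 'rV[rat]_n) (v : 'rV[int]_n).
Variable W : seq 'rV[int]_n.
Hypotheses (pv : 0 < dot h v) (pW : positive h W).
Hypotheses (lv : dot lam (intv rat v) = 1).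
Hypothesis lW : forall w, w \in W -> dot lam (intv rat w) = 0.

Lemma positive_nseq m : positive h (nseq m v ++ W).
Proof. by move=> w; rewrite mem_cat => /orP[/nseqP[->]|/pW]. Qed.

Lemma dot_lam_shift g (c : int) : dot lam (intv rat g) = 0 ->
  dot lam (intv rat (g + v *~ c)) = c%:~R.
Proof.
move=> g0; rewrite intvD dotDr g0 add0r.
case: c => k; first by rewrite -pmulrn intvMn dotZr lv mulr1 pmulrn.
by rewrite NegzE mulrNz intvN -pmulrn intvMn dotNr dotZr lv mulr1 mulrNz pmulrn.
Qed.

Lemma cnt_behind m g : dot lam (intv rat g) = 0 -> cnt h (nseq m v ++ W) (g - v) = 0%N.
Proof.
move=> g0; apply/eqP/negPn/negP => /(cnt_functional (@positive_nseq m)) H.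
have : 0 <= dot lam (intv rat (g - v)).
  by apply: H => w; rewrite mem_cat => /orP[/nseqP[->]|/lW ->] //; rewrite lv.
by rewrite intvB dotBr g0 lv sub0r.
Qed.

Lemma cnt_off m g : dot lam (intv rat g) = 0 -> cnt h W (g + v *+ m.+1) = 0%N.
Proof.
move=> g0; apply/eqP/negPn/negP => c0.
have : 0 <= dot (- lam) (intv rat (g + v *+ m.+1)).
  apply: cnt_functional c0 => // w wW.
  by rewrite -sub0r dotBl lW // dotC dot0r subrr.
by rewrite -sub0r dotBl dotC dot0r pmulrn dot_lam_shift // sub0r oppr_ge0 lern0.
Qed.

(** The recurrence of [cnt_rec] is Pascal's rule. The functional lam, which reads the
coefficient of v, shows that the terms on the boundary of the recurrence vanish. *)
Lemma cnt_nseq m c g : dot lam (intv rat g) = 0 ->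
  cnt h (nseq m.+1 v ++ W) (g + v *+ c) = ('C(c + m, m) * cnt h W g)%N.
Proof.
move=> g0; elim: m c => [|m IHm]; elim=> [|c IHc].
- by rewrite mulr0n addr0 cnt_rec ?(@cnt_behind 1) ?addn0 ?mul1n //; apply: (@positive_nseq 1).
- rewrite (@cnt_rec _ _ v W) ?cnt_off //; last exact: (@positive_nseq 1).
  by rewrite mulrSr addrA addrK [cnt _ _ _]IHc !bin0.
- rewrite (@cnt_rec _ _ v (nseq m.+1 v ++ W)); last exact: (@positive_nseq m.+2).
  by rewrite IHm mulr0n addr0 (@cnt_behind m.+2) // addn0 !add0n !binn.
- rewrite (@cnt_rec _ _ v (nseq m.+1 v ++ W)); last exact: (@positive_nseq m.+2).
  rewrite IHm mulrSr addrA addrK [cnt h (v :: _) _]IHc -mulnDl.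
  by rewrite addSn [in RHS]addSn [in RHS]addnS binS addnC addnS.
Qed.

End Multiplicity.

Definition vecs n (T : seq (pf_factor n)) : seq 'rV[int]_n :=
  flatten [seq nseq (fmult t) (fvec t) | t <- T].

(** Since the coordinates are determined by the target, the count is the product of the
numbers of ways to distribute each coordinate among equal vectors. *)
Lemma cnt_vecs n (h : 'rV[int]_n) (T : seq (pf_factor n)) (beta : nat -> 'rV[rat]_n)
    (c : nat -> nat) :
  positive h [seq fvec t | t <- T] -> all (fun t => 0 < fmult t)%N T ->
  (forall i j, (i < size T)%N -> (j < size T)%N ->
     dot (beta i) (intv rat (den_vec T j)) = (i == j)%:R) ->
  cnt h (vecs T) (\sum_(i < size T) den_vec T i *+ c i) =
  (\prod_(i < size T) 'C(c i + (fmult (nth (@fac0 n) T i)).-1,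
                         (fmult (nth (@fac0 n) T i)).-1))%N.
Proof.
elim: T beta c => [|t T IH] beta c; first by rewrite !big_ord0 cnt_nil eqxx.
move=> /positive_cons[pt pT] /= /andP[mt mT] bT; rewrite !big_ord_recl /=.
rewrite -[vecs _]/(nseq (fmult t) (fvec t) ++ vecs T) addrC.
rewrite -(prednK mt) (@cnt_nseq _ _ (beta 0%N)) //=.
- congr muln; rewrite -(IH (fun i => beta i.+1) (fun i => c i.+1)) //.
  by move=> i j iT jT; rewrite -[RHS](bT i.+1 j.+1).
- move=> v /flattenP[s /mapP[x xT ->]] /nseqP[-> _]; apply: pT.
  exact: map_f.
- exact: (bT 0%N 0%N).
- move=> v /flattenP[s /mapP[x xT ->]] /nseqP[-> _].
  have xi : ((index x T).+1 < (size T).+1)%N by rewrite ltnS index_mem.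
  have := bT 0%N (index x T).+1 isT xi.
  by rewrite /den_vec /= nth_index.
- rewrite intv_sum dot_sumr big1 // => i _; rewrite intvMn dotZr.
  have i1 : (i.+1 < (size T).+1)%N by rewrite ltnS.
  by rewrite [dot _ _](bT 0%N i.+1 isT i1) mulr0.
Qed.

Lemma poly_binomial_nat (K : numFieldType) (c m : nat) :
  poly_binomial (c%:R : K) m = ('C(c + m.-1, m.-1))%:R.
Proof.
elim: m => [|[|m] IH]; [by rewrite /poly_binomial big_geq // bin0 ..|].
rewrite /poly_binomial big_nat_recr //= -/(poly_binomial _ _) IH.
have m0 : m.+1%:R != 0 :> K by rewrite pnatr_eq0.
apply: (mulIf m0); rewrite -natrM [in RHS]mulnC.
have := mul_bin_diag (c + m.+1) m; rewrite addnS /= => <-.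
rewrite -mulrA mulrDl divfK // mul1r mulrC -natrD -natrM addnS //.
Qed.

Definition independent n (T : seq (pf_factor n)) : Prop :=
  free [seq intv rat (fphi t) | t <- T] /\
  all (fun t => (0 < fscale t)%N && (0 < fmult t)%N) T.

Lemma den_vecE n (T : seq (pf_factor n)) i : [seq fvec t | t <- T]`_i = den_vec T i.
Proof.
rewrite /den_vec; have [iT|iT] := ltnP i (size T); first by rewrite (nth_map (@fac0 n)).
by rewrite !nth_default ?size_map.
Qed.

Lemma ratv_dual (K : numFieldType) n (T : seq (pf_factor n)) i :
  dual_vec K T i = ratv K (dual_vec rat T i).
Proof.
have e : tuple_mx K T = map_mx ratr (tuple_mx rat T).
  by apply/matrixP => k l; rewrite !mxE ratr_int.
by apply/rowP => k; rewrite /dual_vec e -map_invmx !mxE.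
Qed.

Section Simplicial.
Variables (n : nat) (T : seq (pf_factor n)).
Hypotheses (indT : independent T) (sT : size T = n).

Let A : 'M[rat]_n := tuple_mx rat T.
Let mxZ : 'M[int]_n := \matrix_k den_vec T k.

Lemma scale_gt0 (i : 'I_n) : (0 < fscale (nth (@fac0 n) T i))%N.
Proof.
have iT : (i < size T)%N by rewrite sT.
by have /allP/(_ _ (mem_nth (@fac0 n) iT))/andP[] := indT.2.
Qed.

Lemma mult_gt0 : all (fun t => 0 < fmult t)%N T.
Proof. by apply: sub_all indT.2 => t /andP[]. Qed.

Lemma den_vec_phi (i : 'I_n) : intv rat (den_vec T i) =
  (fscale (nth (@fac0 n) T i))%:R *: intv rat (fphi (nth (@fac0 n) T i)).
Proof. exact: intvMn. Qed.

Lemma tuple_mx_unit : A \in unitmx.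
Proof.
rewrite -row_free_unit -kermx_eq0; apply/eqP/row_matrixP => r; rewrite row0.
set x := row r _; have xA : x *m A = 0.
  by rewrite -row_mul mulmx_ker row0.
have sz : size [seq intv rat (fphi t) | t <- T] == n by rewrite size_map sT.
have /freeP/(_ (fun i => x 0 i * (fscale (nth (@fac0 n) T i))%:R)) := 
  (indT.1 : free (Tuple sz)).
have -> : \sum_(i < n) (x 0 i * (fscale (nth (@fac0 n) T i))%:R) *: (Tuple sz)`_i = x *m A.
  rewrite mulmx_sum_row; apply: eq_bigr => i _; rewrite rowK den_vec_phi scalerA.
  by rewrite (nth_map (@fac0 n)) ?sT.
rewrite xA => /(_ erefl) x0; apply/rowP => i; rewrite [RHS]mxE.
apply/eqP; have /eqP := x0 i.
by rewrite mulf_eq0 pnatr_eq0 eqn0Ngt scale_gt0 orbF.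
Qed.

Lemma mxZ_rat : A = map_mx intr mxZ.
Proof. by apply/matrixP => i j; rewrite !mxE. Qed.

Lemma det_mxZ : \det mxZ != 0.
Proof.
have := tuple_mx_unit; rewrite unitmxE unitfE mxZ_rat det_map_mx /=.
by rewrite intr_eq0.
Qed.

Lemma dual_vec_den (i j : 'I_n) :
  dot (dual_vec rat T i) (intv rat (den_vec T j)) = (i == j)%:R.
Proof.
have := mulmxV tuple_mx_unit => /matrixP/(_ j i); rewrite !mxE eq_sym => <-.
by apply: eq_bigr => k _; rewrite !mxE mulrC.
Qed.

Lemma dual_expansion (g : 'rV[rat]_n) :
  g = \sum_(i < n) dot (dual_vec rat T i) g *: intv rat (den_vec T i).
Proof.
rewrite -[LHS](mulmxKV tuple_mx_unit) mulmx_sum_row; apply: eq_bigr => i _.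
rewrite rowK; congr (_ *: _); rewrite mxE; apply: eq_bigr => k _.
by rewrite !mxE mulrC.
Qed.

Lemma dual_sum (i : 'I_n) (c : 'I_n -> rat) :
  dot (dual_vec rat T i) (\sum_(j < n) c j *: intv rat (den_vec T j)) = c i.
Proof.
rewrite dot_sumr (bigD1 i) //= dotZr dual_vec_den eqxx mulr1 big1 ?addr0 // => j ji.
by rewrite dotZr dual_vec_den eq_sym (negbTE ji) mulr0.
Qed.

Lemma cone_dual (g : 'rV[rat]_n) : Lambda (@nonneg rat) [seq fphi t | t <- T] g <->
  forall i, 0 <= dot (dual_vec rat T i) g.
Proof.
have phiE (i : 'I_n) : intv rat [seq fphi t | t <- T]`_i =
    (fscale (nth (@fac0 n) T i))%:R^-1 *: intv rat (den_vec T i).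
  rewrite den_vec_phi scalerA mulVf ?scale1r ?pnatr_eq0 -?lt0n ?scale_gt0 //.
  by rewrite (nth_map (@fac0 n)) ?sT.
have s0 (i : 'I_n) : 0 < (fscale (nth (@fac0 n) T i))%:R :> rat.
  by rewrite ltr0n scale_gt0.
rewrite Lambda_nat // size_map sT; split=> [[c [c0 ->]] i|g0].
  under eq_bigr do rewrite phiE scalerA.
  rewrite (dual_sum i (fun j => c j / (fscale (nth (@fac0 n) T j))%:R)).
  by apply: mulr_ge0; [exact: c0 | rewrite invr_ge0 ltW].
exists (fun i => if insub i is Some j then
   dot (dual_vec rat T j) g * (fscale (nth (@fac0 n) T i))%:R else 0); split.
  by move=> i; case: insubP => // j _ _; apply: mulr_ge0; rewrite ?ler0n //; apply: g0.
rewrite {1}[g]dual_expansion; apply: eq_bigr => i _.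
by rewrite valK phiE scalerA mulfK ?gt_eqF.
Qed.

Definition in_lattice (z : 'rV[int]_n) : Prop :=
  exists c : 'I_n -> int, z = \sum_(i < n) den_vec T i *~ c i.

Lemma intvMz (K : numFieldType) (v : 'rV[int]_n) c : intv K (v *~ c) = c%:~R *: intv K v.
Proof. by rewrite /intv raddfMz scaler_int. Qed.

Lemma Lambda_integers (K : numFieldType) (g : 'rV[K]_n) :
  Lambda (@integers K) [seq fvec t | t <- T] g <->
  exists2 z, in_lattice z & g = intv K z.
Proof.
rewrite Lambda_nat; last by exists 0.
rewrite size_map sT; split=> [[c [ci ->]]|[z [c ->] ->]].
  have [m mc] : exists m : nat -> int, forall i, c i = (m i)%:~R.
    have /choice[m H] : forall i, exists z : int, c i = z%:~R.
      by move=> i; have [z _ <-] := ci i; exists z.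
    by exists m.
  exists (\sum_(i < n) den_vec T i *~ m i); first by exists (fun i => m i).
  by rewrite intv_sum; apply: eq_bigr => i _; rewrite mc intvMz den_vecE.
exists (fun i => if insub i is Some j then (c j)%:~R else 0); split.
  by move=> i; case: insub => [j|]; [exists (c j)|exists 0].
by rewrite intv_sum; apply: eq_bigr => i _; rewrite valK intvMz den_vecE.
Qed.

Lemma lattice_indicator_int (K : numFieldType) z :
  lattice_indicator T (intv K z) = (`[< in_lattice z >])%:R.
Proof.
congr _%:R; congr nat_of_bool; apply: asbool_equiv_eq; rewrite Lambda_integers.
by split=> [[y yT /intv_inj ->]|zT] //; exists z.
Qed.

Lemma positive_vecs (h : 'rV[int]_n) :
  positive h [seq fvec t | t <- T] -> positive h (vecs T).
Proof.
move=> pT v /flattenP[s /mapP[x xT ->]] /nseqP[-> _]; apply: pT.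
exact: map_f.
Qed.

Lemma vecs_den v : v \in vecs T -> exists i : 'I_n, v = den_vec T i.
Proof.
case/flattenP => s /mapP[x xT ->] /nseqP[-> _].
have iT : (index x T < n)%N by rewrite -[X in (_ < X)%N]sT index_mem.
by exists (Ordinal iT); rewrite /den_vec /= nth_index.
Qed.

Lemma cnt_in_lattice (h : 'rV[int]_n) z :
  positive h [seq fvec t | t <- T] -> cnt h (vecs T) z != 0%N ->
  in_lattice z /\ Lambda (@nonneg rat) [seq fphi t | t <- T] (intv rat z).
Proof.
move=> /positive_vecs pT /[dup] c0 /(cnt_sol pT)[s ->]; split; last first.
  apply/cone_dual => i; rewrite intv_sum dot_sumr sumr_ge0 // => j _.
  have [k ->] := vecs_den (mem_nth 0 (ltn_ord j)).
  by rewrite intvMn dotZr dual_vec_den mulr_ge0 ?ler0n.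
elim/big_rec: _ => [|j y _ [c ->]].
  by exists (fun=> 0); rewrite big1 // => i _; rewrite mulr0z.
have [k ->] := vecs_den (mem_nth 0 (ltn_ord j)).
exists (fun i => (s j)%:Z *+ (i == k) + c i).
under [RHS]eq_bigr do rewrite mulrzDr; rewrite big_split; congr (_ + _).
by rewrite (bigD1 k) //= eqxx big1 ?addr0 // => i /negbTE ->; rewrite mulr0z.
Qed.

(** Outside the lattice both sides vanish; a lattice point of the cone has natural
coordinates. The right-hand side usually does not vanish at lattice points outside the
cone. *)
Lemma cnt_simplicial (K : numFieldType) (h : 'rV[int]_n) z :
  positive h [seq fvec t | t <- T] ->
  Lambda (@nonneg rat) [seq fphi t | t <- T] (intv rat z) ->
  (cnt h (vecs T) z)%:R = lattice_indicator T (intv K z) *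
    \prod_(i < n) poly_binomial (dot (dual_vec K T i) (intv K z))
                     (fmult (nth (@fac0 n) T i)).
Proof.
move=> pT /cone_dual zT; rewrite lattice_indicator_int.
have [[c zc]|nz] := asboolP; last first.
  rewrite mul0r; case: (eqVneq (cnt h (vecs T) z) 0%N) => [->//|].
  by move=> /(cnt_in_lattice pT)[].
have dc i : dot (dual_vec rat T i) (intv rat z) = (c i)%:~R.
  rewrite zc intv_sum; under eq_bigr do rewrite intvMz.
  by rewrite (dual_sum _ (fun i => (c i)%:~R)).
have c0 i : 0 <= c i by have := zT i; rewrite dc ler0z.
rewrite mul1r; pose m i := if insub i is Some j then `|c j|%N else 0%N.
have -> : z = \sum_(i < size T) den_vec T i *+ m i.
  rewrite zc sT; apply: eq_bigr => i _; rewrite /m valK pmulrn; congr (_ *~ _).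
  by rewrite gez0_abs.
pose beta i := if insub i is Some j then dual_vec rat T j else 0.
rewrite (cnt_vecs (beta := beta)) //; last 2 first.
- exact: mult_gt0.
- move=> i j; rewrite sT => iT jT; rewrite /beta.
  by rewrite insubT [LHS](dual_vec_den _ (Ordinal jT)).
rewrite sT natr_prod; apply: eq_bigr => i _.
rewrite -poly_binomial_nat; congr poly_binomial.
rewrite ratv_dual -ratv_intv dot_ratv intv_sum.
under [in RHS]eq_bigr do rewrite intvMn.
rewrite (dual_sum i (fun i => (m i)%:R)) ratr_nat //.
Qed.

End Simplicial.

(** * Closure properties of quasipolynomials *)

Section QuasipolynomialClosure.
Variables (K : numFieldType) (n : nat).
Implicit Types (f q : 'rV[K]_n -> K).

Lemma eq_quasipolynomial f q : f =1 q -> quasipolynomial f -> quasipolynomial q.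
Proof. by move=> fq; have -> : q = f by apply: funext => g; rewrite fq. Qed.

Lemma quasipolynomial_nat (m : nat) : quasipolynomial (fun _ : 'rV[K]_n => m%:R).
Proof.
by apply: eq_quasipolynomial (qp_const _ _ m%:R) => g /=; rewrite ratr_nat.
Qed.

Lemma quasipolynomial_sum (I : Type) (r : seq I) (F : I -> 'rV[K]_n -> K) :
  (forall i, List.In i r -> quasipolynomial (F i)) ->
  quasipolynomial (fun g => \sum_(i <- r) F i g).
Proof.
elim: r => [|i r IH] Fq.
  by apply: eq_quasipolynomial (quasipolynomial_nat 0) => g /=; rewrite big_nil.
apply: (@eq_quasipolynomial (fun g => F i g + \sum_(j <- r) F j g)).
  by move=> g; rewrite big_cons.
by apply: qp_add; [apply: Fq; left | apply: IH => j jr; apply: Fq; right].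
Qed.

Lemma quasipolynomial_prod (I : Type) (r : seq I) (F : I -> 'rV[K]_n -> K) :
  (forall i, quasipolynomial (F i)) ->
  quasipolynomial (fun g => \prod_(i <- r) F i g).
Proof.
move=> Fq; elim: r => [|i r IH].
  by apply: eq_quasipolynomial (quasipolynomial_nat 1) => g /=; rewrite big_nil.
apply: (@eq_quasipolynomial (fun g => F i g * \prod_(j <- r) F j g)).
  by move=> g; rewrite big_cons.
exact: qp_mul.
Qed.

Lemma quasipolynomial_affine (b : 'rV[rat]_n) (del : 'rV[int]_n) :
  quasipolynomial (fun g : 'rV[K]_n => dot (ratv K b) (g - intv K del)).
Proof.
apply: (@eq_quasipolynomial (fun g => \sum_(k <- enum 'I_n)
   (ratr (b 0 k) * g 0 k) + ratr (- dot b (intv rat del)))).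
  move=> g; rewrite dotBr -ratv_intv dot_ratv rmorphN; congr (_ - _).
  by rewrite big_enum; apply: eq_bigr => k _; rewrite mxE.
apply: qp_add; last exact: qp_const.
by apply: quasipolynomial_sum => k _; apply: qp_mul; [apply: qp_const|apply: qp_coord].
Qed.

Lemma quasipolynomial_binomial f m : quasipolynomial f ->
  quasipolynomial (fun g => poly_binomial (f g) m).
Proof.
move=> fq; apply: quasipolynomial_prod => l.
apply: (@eq_quasipolynomial (fun g => f g * ratr (l%:R^-1) + ratr 1)).
  by move=> g; rewrite fmorphV rmorph_nat rmorph1.
by apply: qp_add; [apply: qp_mul; [|apply: qp_const]|apply: qp_const].
Qed.

(** If the rows of A are the basis, z is in the lattice iff z A^-1 = z adj(A) / det A is
integral, which is a system of congruences modulo det A. The case n = 0 is apart since a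
quasinumber has at least one congruence. *)
Lemma quasipolynomial_lattice (T : seq (pf_factor n)) (del : 'rV[int]_n) :
  independent T -> size T = n ->
  quasipolynomial (fun g : 'rV[K]_n => lattice_indicator T (g - intv K del)).
Proof.
move=> indT sT; have [n0|n_gt0] := posnP n.
  apply: eq_quasipolynomial (quasipolynomial_nat 1) => g /=.
  rewrite /lattice_indicator; congr _%:R; case: asboolP => // -[].
  apply/(Lambda_integers sT); exists 0.
    exists (fun=> 0); rewrite big1 // => i _; rewrite mulr0z //.
  by apply/rowP => i; have := ltn_ord i; rewrite {2}n0.
pose A : 'M[int]_n := \matrix_k den_vec T k.
have detA : \det A != 0 := det_mxZ indT sT.
have latE (z : 'rV[int]_n) : in_lattice T z <->
    forall i, (`|\det A|%N %| ((z *m \adj A)%R ord0 i))%Z.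
  have sumE (c : 'I_n -> int) : \sum_(i < n) den_vec T i *~ c i = (\row_i c i) *m A.
    rewrite mulmx_sum_row; apply: eq_bigr => j _.
    by rewrite rowK mxE -scaler_int intz.
  split=> [[c ->] i|H].
    rewrite sumE -mulmxA mul_mx_adj mul_mx_scalar mxE dvdzE abszM.
    by rewrite absz_nat dvdn_mulr.
  have /choice[c cE] : forall i, exists c, (z *m \adj A) 0 i = c * \det A.
    by move=> i; apply/dvdzP; have := H i; rewrite !dvdzE absz_nat.
  exists c; rewrite sumE.
  suff e : \det A *: z = \det A *: ((\row_i c i) *m A).
    apply/rowP => j; apply: (mulfI detA).
    by have /rowP/(_ j) := e; rewrite [LHS]mxE [RHS]mxE.
  rewrite -mul_mx_scalar -mul_adj_mx mulmxA.
  have -> : z *m \adj A = \det A *: \row_i c i.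
    by apply/rowP => i; rewrite cE !mxE mulrC.
  by rewrite scalemxAl.
apply: (@eq_quasipolynomial
  (quasinumber (\adj A)^T ((\adj A)^T *m del^T) `|\det A|%N)); last first.
  by apply: qp_quasinumber; rewrite // absz_gt0.
move=> g; rewrite /quasinumber /lattice_indicator; congr _%:R; congr nat_of_bool.
apply: asbool_equiv_eq; rewrite Lambda_integers //.
have modE (z : 'rV[int]_n) :
    (forall i, (((\adj A)^T *m z^T)%R i ord0 =
      ((\adj A)^T *m del^T) i ord0 %[mod `|\det A|%N])%Z) <-> in_lattice T (z - del).
  rewrite latE; split=> H i; have := H i.
    by move/eqP; rewrite eqz_mod_dvd -!trmx_mul ![_^T _ _]mxE mulmxBl !mxE.
  by rewrite mulmxBl => dv; apply/eqP; rewrite eqz_mod_dvd -!trmx_mul; move: dv; rewrite !mxE.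
split=> [[z [-> /modE H]]|[y yT e]]; first by exists (z - del); rewrite ?intvB.
exists (y + del); rewrite intvD -e subrK; split=> //.
by apply/modE; rewrite addrK.
Qed.

End QuasipolynomialClosure.

(** * The expression produced by a decomposition, far along a ray *)

Lemma In_mem (I : eqType) (x : I) s : List.In x s <-> x \in s.
Proof.
elim: s => [|y s IH] //=; rewrite inE; split.
  by case=> [->|/IH ->]; rewrite ?eqxx ?orbT.
by case/predU1P=> [->|/IH]; [left|right].
Qed.

Definition eventually_nat (P : nat -> Prop) := exists k0, forall k, (k0 <= k)%N -> P k.

Lemma eventually_and P Q : eventually_nat P -> eventually_nat Q ->
  eventually_nat (fun k => P k /\ Q k).
Proof.
move=> [k1 H1] [k2 H2]; exists (maxn k1 k2) => k; rewrite geq_max => /andP[/H1 ? /H2 ?].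
by split.
Qed.

Lemma eventually_seq (I : Type) (s : seq I) (P : I -> nat -> Prop) :
  (forall i, List.In i s -> eventually_nat (P i)) ->
  eventually_nat (fun k => forall i, List.In i s -> P i k).
Proof.
elim: s => [|i s IH] H; first by exists 0%N.
have [|k0 h0] := eventually_and (H i (or_introl erefl)) (IH _).
  by move=> j js; apply: H; right.
by exists k0 => k /h0[Pi Ps] j [<-|/Ps].
Qed.

Lemma eventually_ge0 (a b : rat) : 0 < b -> eventually_nat (fun k => 0 <= a + b * k%:R).
Proof.
move=> b0; exists (Num.bound (- a / b)) => k kb.
have : - a / b < k%:R.
  apply: le_lt_trans (ler_norm _) _; apply: lt_le_trans (archi_boundP (normr_ge0 _)) _.
  rewrite ler_nat; apply: leq_trans kb; rewrite /Num.bound normr_id //.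
rewrite ltr_pdivrMr // mulrC; lra.
Qed.

Lemma eventually_lt0 (a b : rat) : b < 0 -> eventually_nat (fun k => a + b * k%:R < 0).
Proof.
move=> b0; have [|k0 H] := @eventually_ge0 (- a - 1) (- b); first by rewrite oppr_gt0.
by exists k0 => k /H; lra.
Qed.

Section ProducedExpression.
Variables (K : numFieldType) (n : nat).
Implicit Types (f : pfraction n) (L : seq (pfraction n)) (w : 'rV[rat]_n).

Definition covers f w : Prop := Lambda (@nonneg rat) [seq fphi t | t <- den f] w.

Definition contribution f (g : 'rV[K]_n) : K :=
  \sum_(c <- Defs.num f)
     let g' := g - intv K c.2 in
     ratr c.1 * lattice_indicator (den f) g' *
     \prod_(i < n) poly_binomial (dot (dual_vec K (den f) i) g')
                                 (fmult (nth (fac0 n) (den f) i)).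

Lemma produced_expressionE w L g :
  produced_expression w L g = \sum_(f <- L | `[< covers f w >]) contribution f g.
Proof. by []. Qed.

Lemma quasipolynomial_contribution f : independent (den f) -> size (den f) = n ->
  quasipolynomial (contribution f).
Proof.
move=> indf sf; apply: quasipolynomial_sum => c _ /=.
apply: qp_mul; last first.
  apply: quasipolynomial_prod => i; apply: quasipolynomial_binomial.
  by rewrite ratv_dual; apply: quasipolynomial_affine.
by apply: qp_mul; [apply: qp_const | apply: quasipolynomial_lattice].
Qed.

Lemma quasipolynomial_produced w L :
  (forall f, List.In f L -> covers f w -> independent (den f) /\ size (den f) = n) ->
  quasipolynomial (produced_expression w L : 'rV[K]_n -> K).
Proof.
move=> HL.
apply: (@eq_quasipolynomial _ _ (fun g => \sum_(f <- L)
    if `[< covers f w >] then contribution f g else 0)).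
  by move=> g; rewrite produced_expressionE [RHS]big_mkcond.
apply: quasipolynomial_sum => f /HL; case: asboolP => [cf /(_ cf)[]|_ _].
  exact: quasipolynomial_contribution.
by apply: eq_quasipolynomial (quasipolynomial_nat K n 0).
Qed.

Lemma contribution_nonint f g : (forall z, g <> intv K z) -> size (den f) = n ->
  contribution f g = 0.
Proof.
move=> gz sf; rewrite /contribution big1 // => c _ /=.
rewrite {1}/lattice_indicator; case: asboolP; last by rewrite mulr0 mul0r.
move/(Lambda_integers sf) => [z _ e]; case: (gz (z + c.2)).
by rewrite intvD -e subrK.
Qed.

Lemma cone_vecs (T : seq (pf_factor n)) (g : 'rV[rat]_n) :
  Lambda (@nonneg rat) (vecs T) g -> Lambda (@nonneg rat) [seq fphi t | t <- T] g.
Proof.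
apply: cone_sub => v /flattenP[s /mapP[x xT ->]] /nseqP[-> _]; rewrite /fvec intvMn.
by apply: coneZ; rewrite ?ler0n //; apply: cone_mem; apply: map_f.
Qed.

Variables (h : 'rV[int]_n) (alpha : seq 'rV[int]_n) (L : seq (pfraction n)).
Hypothesis posL : forall f, List.In f L -> positive h [seq fvec t | t <- den f].
Hypothesis expansion : forall g, (cnt h alpha g)%:R =
  \sum_(f <- L) act (Defs.num f) (fun g => (cnt h (vecs (den f)) g)%:R) g.

(** What is asked of a direction u. It is quantified over z because the simplicial
partition functions are evaluated at translates of the points of a ray. *)
Definition decisive f w (u : 'rV[int]_n) : Prop := forall z,
  (covers f w /\ eventually_nat (fun k => covers f (intv rat (z + u *+ k)))) \/
  (~ covers f w /\ eventually_nat (fun k => ~ covers f (intv rat (z + u *+ k)))).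

(** Far along u, every translate lies in the cones that cover w and outside the others,
so each term is given by [cnt_simplicial] or vanishes. Near the origin of the ray the
shifts can spoil this. *)
Lemma produced_eventually w u :
  (forall f, List.In f L -> decisive f w u) ->
  (forall f, List.In f L -> covers f w -> independent (den f) /\ size (den f) = n) ->
  forall z, eventually_nat (fun k => (cnt h alpha (z + u *+ k))%:R =
    produced_expression w L (intv K (z + u *+ k))).
Proof.
move=> dec HL z.
have positive_vecs' f : List.In f L -> positive h (vecs (den f)).
  by move=> /posL/positive_vecs.
have [k0 H] : eventually_nat (fun k => forall f, List.In f L -> forall c, List.In c (Defs.num f) ->
    covers f (intv rat (z - c.2 + u *+ k)) <-> covers f w).
  apply: eventually_seq => f fL; apply: eventually_seq => c _.
  have [[cw [k0 H]]|[cw [k0 H]]] := dec f fL (z - c.2); exists k0 => k /H.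
    by split.
  by move=> nc; split.
exists k0 => k /H {}H; rewrite -ratr_nat expansion rmorph_sum produced_expressionE.
rewrite [RHS]big_mkcond /=.
elim: (L) H HL positive_vecs' posL => [|f L' IH] H HL pv pL; first by rewrite !big_nil.
rewrite !big_cons IH; first last.
- by move=> f' ?; apply: pL; right.
- by move=> f' ?; apply: pv; right.
- by move=> f' ?; apply: HL; right.
- by move=> f' ?; apply: H; right.
congr (_ + _).
rewrite /act rmorph_sum /=; have := H f (or_introl erefl) => {}H.
have pf := pL f (or_introl erefl).
case: asboolP => cf; last first.
  elim: (Defs.num f) H => [|c l IHl] H; first by rewrite big_nil.
  rewrite big_cons IHl ?addr0; last by move=> c' ?; apply: H; right.
  have -> : cnt h (vecs (den f)) (z + u *+ k - c.2) = 0%N.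
    apply/eqP/negPn/negP => /(cnt_cone (pv f (or_introl erefl))) /cone_vecs.
    by rewrite addrAC => /(H c (or_introl erefl)).
  by rewrite mulr0 rmorph0.
have [indf sf] := HL f (or_introl erefl) cf.
rewrite /contribution; elim: (Defs.num f) H => [|c l IHl] H; first by rewrite !big_nil.
rewrite !big_cons IHl; last by move=> c' ?; apply: H; right.
congr (_ + _); rewrite rmorphM /= -mulrA; congr (_ * _).
rewrite -intvB ratr_nat; apply: cnt_simplicial => //.
by rewrite addrAC; apply/(H c (or_introl erefl)).
Qed.

End ProducedExpression.

(** * Value of an expansion step *)

(** This identity and the next two are proved over an abstract field, where
normalization cannot unfold the construction of the field of rational functions. *)
Lemma geometric_neg1 (F : fieldType) (y : F) : y != 0 ->
  -1 / y * (1 - y) = 1 - y^-1.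
Proof. by move=> y0; field. Qed.

Lemma geometric_negS (F : fieldType) (p y : F) : p != 0 -> y != 0 ->
  1 - p^-1 + -1 / (p * y) * (1 - y) = 1 - (p * y)^-1.
Proof. by move=> p0 y0; field; rewrite p0 y0. Qed.

Lemma expansion_identity (F : fieldType) (N S Gj G A B C D E rest : F) :
  A != 0 -> B != 0 -> C != 0 -> D != 0 -> E != 0 -> G != 0 ->
  N * (S * (Gj * A)) * ((G * E * (A * B))^-1 * (C^-1 * rest)) =
  N * (B^-1 * ((D * C)^-1 * rest)) / (G * E) * (S * (Gj * D)).
Proof.
by move=> A0 B0 C0 D0 E0 G0; field; rewrite A0 B0 C0 D0 E0 G0.
Qed.

Section ExpansionStep.
Variable n : nat.
Implicit Types (v : 'rV[int]_n) (T : seq (pf_factor n)) (f : pfraction n).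

Lemma geometric_val (a : int) v :
  laurent_val (Defs.geometric a v) * (1 - xpow v) = 1 - xpow v ^ a.
Proof.
have v0 := xpow_neq0 v; case: a => b.
  rewrite /Defs.geometric /laurent_val big_map; elim: b => [|b IH].
    by rewrite big_nil mul0r expr0z subrr.
  rewrite -[b.+1]addn1 iotaD big_cat mulrDl IH big_seq1 /= ratr_tofrac !rmorph1.
  by rewrite xpowMn add0n mul1r -!exprnP addn1 exprSr; ring.
rewrite /Defs.geometric /laurent_val big_map NegzE; elim: b => [|b IH].
  rewrite big_seq1 /= ratr_tofrac !rmorphN !rmorph1 mulr1n xpowN -exprnN expr1.
  exact: geometric_neg1.
rewrite -[b.+2]addn1 iotaD big_cat mulrDl IH big_seq1 /= ratr_tofrac.
rewrite !rmorphN !rmorph1 xpowN xpowMn -!exprnN add1n addn1 [_ ^+ b.+2]exprSr.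
have : xpow v ^+ b.+1 != 0 by rewrite expf_neq0.
by move/geometric_negS; apply.
Qed.

Lemma telescope_xpow (s : seq 'rV[int]_n) :
  \sum_(0 <= r < size s) xpow (\sum_(x <- take r s) x) * (1 - xpow s`_r) =
  1 - xpow (\sum_(x <- s) x).
Proof.
rewrite (@telescope_sumr_eq _ _ _ (fun r => - xpow (\sum_(x <- take r s) x))) //.
  by rewrite take_size take0 big_nil xpow0; ring.
move=> r /andP[_ rs]; rewrite (take_nth 0) // -cats1 big_cat big_seq1 /= xpowD.
by ring.
Qed.

Lemma factors_val_nth T : factors_val T =
  \prod_(i < size T) ((1 - xpow (den_vec T i)) ^+ fmult (nth (fac0 n) T i))^-1.
Proof. by rewrite /factors_val (big_nth (fac0 n)) big_mkord. Qed.

Lemma factors_val_filter T : factors_val [seq t <- T | 0 < fmult t]%N = factors_val T.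
Proof.
rewrite /factors_val big_filter big_mkcond; apply: eq_bigr => t _.
by case: (posnP (fmult t)) => [->|]; rewrite ?expr0 ?invr1.
Qed.

(** The factors after an expansion, before those of multiplicity 0 are removed, so that
their positions are still those in the original fraction. *)
Definition raw_den f (d : dependence) r : seq (pf_factor n) :=
  let T := den f in
  let j := nth (0%N, 0) (dep_terms d) r in
  mkseq (fun i => let t := nth (fac0 n) T i in
      if i == dep_pos d then (fphi t, (dep_coef d * fscale t)%N, (fmult t).+1)
      else if i == j.1 then (fphi t, fscale t, (fmult t).-1)
      else t) (size T).

Lemma den_expand f d r :
  den (expand_at f d r) = [seq t <- raw_den f d r | (0 < fmult t)%N].
Proof. by []. Qed.

Definition fraction_val f : ratfun n := laurent_val (Defs.num f) * factors_val (den f).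

Variable h : 'rV[int]_n.

(** The r-th summand is the original fraction times x^(a_1 phi_1 + ... + a_(j-1)
phi_(j-1)) (1 - x^(a_j phi_j)) / (1 - x^(a_0 phi_0)). The numerators telescope to 1 -
x^(a_1 phi_1 + ... + a_k phi_k), which is the denominator by the dependence. *)
Lemma expand_val f d :
  (forall t, t \in den f -> 0 < dot h (fvec t)) -> all (fun t => 0 < fmult t)%N (den f) ->
  is_dependence (den f) d ->
  \sum_(g <- Defs.expand f d) fraction_val g = fraction_val f.
Proof.
set T := den f => pT mT [ud ad a0 tn0 dep].
have p_den i : (i < size T)%N -> den_vec T i != 0.
  move=> iT; have := pT _ (mem_nth (fac0 n) iT).
  by apply: contraTneq => e; rewrite -/(den_vec T i) e dot0r.
have D0 i : (i < size T)%N -> 1 - xpow (den_vec T i) != 0.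
  by move=> iT; apply/xpow_neq1/p_den.
have i0T : (dep_pos d < size T)%N by case/andP: ad.
set y0 := xpow (den_vec T (dep_pos d)).
have E0 : 1 - y0 ^+ dep_coef d != 0.
  rewrite -xpowMn; apply: xpow_neq1; have := pT _ (mem_nth (fac0 n) i0T).
  apply: contraTneq => e; have : dot h (den_vec T (dep_pos d) *+ dep_coef d) = 0.
    by rewrite e dot0r.
  rewrite dotMnr => /eqP; rewrite -mulr_natr mulf_eq0 pnatr_eq0.
  by rewrite [dep_coef d == _]eqn0Ngt a0 orbF => /eqP; rewrite /den_vec => ->.
have step r : (r < size (dep_terms d))%N ->
    let j := nth (0%N, 0) (dep_terms d) r in
    fraction_val (expand_at f d r) = fraction_val f / (1 - y0 ^+ dep_coef d) *
     (xpow (\sum_(j' <- take r (dep_terms d)) den_vec T j'.1 *~ j'.2) *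
      (1 - xpow (den_vec T j.1 *~ j.2))).
  move=> rd j; have jd : j \in dep_terms d by apply: mem_nth.
  have jT : (j.1 < size T)%N.
    by case/andP: ad => _ /allP/(_ j.1); apply; apply: map_f.
  have ji0 : j.1 != dep_pos d.
    by case/andP: ud => + _; apply: contraNneq => <-; apply: map_f.
  have mj : (0 < fmult (nth (fac0 n) T j.1))%N by apply: (allP mT _ (mem_nth _ jT)).
  rewrite /fraction_val den_expand factors_val_filter.
  rewrite -[Defs.num (expand_at _ _ _)]/(lmul (Defs.num f)
    (lmul [:: (1, \sum_(j' <- take r (dep_terms d)) den_vec T j'.1 *~ j'.2)]
      (lmul (Defs.geometric j.2 (den_vec T j.1))
         (lexp (Defs.geometric (dep_coef d)%:Z (den_vec T (dep_pos d)))
               (fmult (nth (fac0 n) T (dep_pos d))))))).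
  rewrite !laurent_val_mul laurent_val_exp.
  have -> : laurent_val [:: (1, \sum_(j' <- take r (dep_terms d)) den_vec T j'.1 *~ j'.2)] =
      xpow (\sum_(j' <- take r (dep_terms d)) den_vec T j'.1 *~ j'.2).
    by rewrite /laurent_val big_seq1 /= ratr_tofrac !rmorph1 mul1r.
  rewrite !factors_val_nth size_mkseq -/T.
  pose i0' := Ordinal i0T; pose j' := Ordinal jT.
  have j'i0 : j' != i0' by [].
  have g0 := geometric_val (dep_coef d) (den_vec T (dep_pos d)).
  have gj := geometric_val j.2 (den_vec T j.1).
  rewrite -/y0 -exprnP in g0; rewrite xpowMz -gj -g0.
  have G0 : laurent_val (Defs.geometric (dep_coef d) (den_vec T (dep_pos d))) != 0.
    by apply: contraNneq E0 => e; rewrite -g0 e mul0r.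
  have X0 := D0 _ i0T; have Xj := D0 _ jT; rewrite -/y0 in X0.
  move: (laurent_val (Defs.geometric (dep_coef d) _)) G0 g0 => G G0 g0.
  move: (laurent_val (Defs.geometric j.2 _)) => Gj {gj}.
  move: (laurent_val (Defs.num f)) (xpow (\sum_(j' <- take r _) _)) => P S.
  have rawE (i : nat) : (i < size T)%N -> nth (fac0 n) (raw_den f d r) i =
      let t := nth (fac0 n) T i in
      if i == dep_pos d then (fphi t, (dep_coef d * fscale t)%N, (fmult t).+1)
      else if i == j.1 then (fphi t, fscale t, (fmult t).-1) else t.
    by move=> iT; rewrite nth_mkseq.
  have dvE i : den_vec (raw_den f d r) i = fvec (nth (fac0 n) (raw_den f d r) i) by [].
  rewrite (bigD1 i0') //= (bigD1 j') //= !dvE !rawE //= eqxx (negbTE ji0) eqxx.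
  rewrite [in RHS](bigD1 i0') //= [in RHS](bigD1 j') //=.
  set rest := (X in _ * (_ * (_ * X)) = _).
  have -> : rest = \prod_(i < size T | (i != i0') && (i != j'))
       ((1 - xpow (den_vec T i)) ^+ fmult (nth (fac0 n) T i))^-1.
    apply: eq_bigr => i /andP[ni nj]; rewrite dvE rawE //=.
    have -> : (i == dep_pos d :> nat) = false by apply/negbTE.
    by have -> : (i == j.1 :> nat) = false by apply/negbTE.
  move: (\prod_(i < _ | _) _) => {}rest.
  have -> : xpow (fvec (fphi (nth (fac0 n) T (dep_pos d)),
      (dep_coef d * fscale (nth (fac0 n) T (dep_pos d)))%N,
      (fmult (nth (fac0 n) T (dep_pos d))).+1)) = y0 ^+ dep_coef d.
    by rewrite /fvec /= mulnC mulrnA xpowMn.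
  rewrite -[xpow (fvec (_, _, _))]/(xpow (den_vec T j.1)) -/y0 -g0.
  move: (fmult (nth _ _ (dep_pos d))) => m0.
  case: (fmult (nth _ T j.1)) mj => // mj _; rewrite [mj.+1.-1]/= !exprS exprMn.
  move: (1 - y0) X0 (1 - xpow (den_vec T j.1)) Xj => E X0 D Xj.
  have A0 := expf_neq0 m0 G0; have B0 := expf_neq0 m0 X0; have C0 := expf_neq0 mj Xj.
  exact: (@expansion_identity (ratfun n) P S Gj G _ _ _ D E rest A0 B0 C0 Xj X0 G0).
rewrite /Defs.expand big_map -[X in iota 0 X]subn0 -/(index_iota 0 (size (dep_terms d))) big_seq.
under eq_bigr => r rd.
  rewrite step; last by move: rd; rewrite mem_index_iota.
  over.
rewrite -big_seq -mulr_sumr.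
pose s := [seq den_vec T j.1 *~ j.2 | j <- dep_terms d].
have := telescope_xpow s; rewrite {3}/s big_map -dep xpowMn -/y0 size_map.
rewrite (eq_big_nat _ _ (F2 := fun r => xpow (\sum_(j <- take r (dep_terms d)) den_vec T j.1 *~ j.2) *
  (1 - xpow (den_vec T (nth (0%N, 0) (dep_terms d) r).1 *~ (nth (0%N, 0) (dep_terms d) r).2)))).
  by move=> ->; rewrite divfK.
move=> r /andP[_ rd]; rewrite /s -map_take big_map; congr (_ * (1 - xpow _)).
by rewrite (nth_map (0%N, 0)).
Qed.

End ExpansionStep.

(** * Termination of the partial fraction algorithm *)

Section Termination.
Variables (n : nat) (alpha : seq 'rV[int]_n) (h : 'rV[int]_n).
Hypothesis pos_alpha : positive h alpha.
Let M := size alpha.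
Implicit Types (f : pfraction n) (L : seq (pfraction n)) (T : seq (pf_factor n)).

(** The total multiplicity is constant, because an expansion transfers one unit from
phi_j to phi_0. It bounds the number of vectors of a fraction and the number of
successive expansions along one dependence. *)
Record fraction_inv f : Prop := FractionInv {
  inv_factor : forall t, t \in den f ->
    [/\ fphi t \in alpha, (0 < fscale t)%N & (0 < fmult t)%N];
  inv_mult : (\sum_(t <- den f) fmult t = M)%N;
  inv_preferred : forall d, preferred f = Some d -> is_dependence (den f) d;
  inv_reduced : reduced f -> support_free (den f) /\ preferred f = None }.

Definition pf_inv L := (forall f, List.In f L -> fraction_inv f) /\
  \sum_(f <- L) fraction_val f = generating_function alpha.

Definition term_mult f (d : dependence) : nat :=
  (\sum_(j <- dep_terms d) fmult (nth (fac0 n) (den f) j.1))%N.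

(** A lexicographic order encoded in a number: first the number of vectors, then the
stage of the treatment. As long as the support does not shrink, each expansion lowers
the multiplicity of one of the vectors on the right-hand side of the dependence. *)
Definition potential f : nat :=
  (size (den f) * M.+2 +
   (if reduced f then 0 else if preferred f is Some d then term_mult f d else M.+1))%N.

(** An expansion yields at most M fractions, all of smaller potential. The base is at
least 2 even for M = 0, in order that labeling a fraction still decreases the weight. *)
Definition weight L : nat := (\sum_(f <- L) M.+2 ^ potential f)%N.

Lemma size_den f : fraction_inv f -> (size (den f) <= M)%N.
Proof.
move=> [fi <- _ _]; rewrite -sum1_size big_seq [X in (_ <= X)%N]big_seq.
by apply: leq_sum => t /fi[].
Qed.

Lemma dep_uniq T d : is_dependence T d -> uniq [seq j.1 | j <- dep_terms d] /\
  {subset [seq j.1 | j <- dep_terms d] <= iota 0 (size T)}.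
Proof.
case=> /= /andP[_ u] /andP[_ /allP a] _ _ _; split=> // i /a.
by rewrite mem_iota.
Qed.

Lemma sum_sub (s t : seq nat) (F : nat -> nat) : uniq s -> {subset s <= t} ->
  (\sum_(i <- s) F i <= \sum_(i <- t) F i)%N.
Proof.
elim: s t => [|i s IH] t /=; first by rewrite big_nil.
case/andP=> ns us st; have it : i \in t by apply: st; rewrite inE eqxx.
rewrite big_cons (big_rem i it) /= leq_add2l; apply: IH => // j js.
have jt : j \in t by apply: st; rewrite inE js orbT.
move: jt; rewrite (perm_mem (perm_to_rem it)) inE => /predU1P[ji|//].
by rewrite -ji js in ns.
Qed.

Lemma term_mult_le f d : fraction_inv f -> is_dependence (den f) d ->
  (term_mult f d <= M)%N.
Proof.
move=> [_ <- _ _] /dep_uniq[u s]; rewrite /term_mult (big_nth (fac0 n)).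
rewrite -(big_map fst xpredT (fun i => fmult (nth (fac0 n) (den f) i))).
by rewrite /index_iota subn0; apply: sum_sub.
Qed.

Lemma size_terms f d : fraction_inv f -> is_dependence (den f) d ->
  (size (dep_terms d) <= M)%N.
Proof.
move=> fi /dep_uniq[u s]; apply: leq_trans (size_den fi).
by rewrite -(size_map fst) -[size (den f)](size_iota 0); apply: uniq_leq_size.
Qed.

Lemma expand_inv f d r : fraction_inv f -> preferred f = Some d ->
  (r < size (dep_terms d))%N ->
  fraction_inv (expand_at f d r) /\ (potential (expand_at f d r) < potential f)%N.
Proof.
move=> fi pd rd; have dep := inv_preferred fi pd.
have nred : reduced f = false.
  by apply/negP => /(inv_reduced fi)[_]; rewrite pd.
have [ud ad a0 tn0 e] := dep; have [ut st] := dep_uniq dep.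
set j := nth (0%N, 0) (dep_terms d) r; have jd : j \in dep_terms d by apply: mem_nth.
have jT : (j.1 < size (den f))%N.
  by case/andP: ad => _ /allP/(_ j.1); apply; apply: map_f.
have i0T : (dep_pos d < size (den f))%N by case/andP: ad.
have ji0 : j.1 != dep_pos d.
  by case/andP: ud => + _; apply: contraNneq => <-; apply: map_f.
have mj : (0 < fmult (nth (fac0 n) (den f) j.1))%N.
  by case: (inv_factor fi (mem_nth (fac0 n) jT)).
have raw_nth i : (i < size (den f))%N -> nth (fac0 n) (raw_den f d r) i =
    let t := nth (fac0 n) (den f) i in
      if i == dep_pos d then (fphi t, (dep_coef d * fscale t)%N, (fmult t).+1)
      else if i == j.1 then (fphi t, fscale t, (fmult t).-1) else t.
  by move=> iT; rewrite nth_mkseq.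
have raw_size : size (raw_den f d r) = size (den f) by rewrite size_mkseq.
have raw_sum : (\sum_(t <- raw_den f d r) fmult t = M)%N.
  rewrite -(inv_mult fi) !(big_nth (fac0 n)) raw_size !big_mkord.
  pose i0' := Ordinal i0T; pose j' := Ordinal jT; have j'i0 : j' != i0' by [].
  rewrite (bigD1 i0') //= (bigD1 j') //= !raw_nth //= eqxx (negbTE ji0) eqxx.
  rewrite [RHS](bigD1 i0') //= [in RHS](bigD1 j') //= addSn -addnS -addSn prednK //.
  congr (_ + (_ + _))%N; apply: eq_bigr => i /andP[ni nj]; rewrite raw_nth //=.
  have -> : (i == dep_pos d :> nat) = false by apply/negbTE.
  by have -> : (i == j.1 :> nat) = false by apply/negbTE.
have sub_size : (size (den (expand_at f d r)) <= size (den f))%N.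
  by rewrite den_expand -raw_size size_filter count_size.
have full : size (den (expand_at f d r)) = size (den f) ->
    den (expand_at f d r) = raw_den f d r.
  rewrite den_expand -raw_size => /eqP; rewrite size_filter -all_count.
  by move/all_filterP.
have pref : preferred (expand_at f d r) =
    if size (den (expand_at f d r)) == size (den f)
    then Some (Dependence (dep_pos d) 1 (dep_terms d)) else None by [].
split.
  split=> [t|||//].
  - rewrite den_expand mem_filter => /andP[t0 tr].
    case/(nthP (fac0 n)): tr => i; rewrite raw_size => iT; rewrite raw_nth //=.
    have [pi si mi] := inv_factor fi (mem_nth (fac0 n) iT).
    case: eqP => _ te; first by rewrite -te /= muln_gt0 a0.
    by move: te t0; case: eqP => _ <-.
  - rewrite den_expand big_filter -raw_sum big_mkcond; apply: eq_bigr => t _.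
    by case: posnP.
  - move=> d'; rewrite pref; case: eqP => // /full -> [<-].
    split=> //=; first by rewrite raw_size.
    have -> : den_vec (raw_den f d r) (dep_pos d) = den_vec (den f) (dep_pos d) *+ dep_coef d.
      by rewrite /den_vec raw_nth //= eqxx /fvec /= -mulrnA mulnC.
    rewrite mulr1n e; rewrite [LHS]big_seq [RHS]big_seq; apply: eq_bigr => i id.
    have ii : i.1 \in [seq j.1 | j <- dep_terms d] by apply: map_f.
    have iT : (i.1 < size (den f))%N by have := st _ ii; rewrite mem_iota.
    rewrite /den_vec raw_nth //=.
    have -> : (i.1 == dep_pos d) = false.
      by apply/negbTE; case/andP: ud => + _; apply: contraNneq => <-.
    by case: eqP => [->|].
have redF : reduced (expand_at f d r) = false by [].
rewrite /potential nred pd redF pref; move: sub_size; rewrite leq_eqVlt => /orP[/eqP se|lt].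
  rewrite se eqxx ltn_add2l /term_mult full //=.
  rewrite !(big_rem j jd) /= raw_nth //= (negbTE ji0) eqxx.
  rewrite -[X in (_ < X + _)%N]prednK // addSn ltnS leq_add2l.
  rewrite big_seq [X in (_ <= X)%N]big_seq; apply: leq_sum => i ir.
  have id : i \in dep_terms d by apply: mem_rem ir.
  have ii : i.1 \in [seq j.1 | j <- dep_terms d] by apply: map_f.
  have iT : (i.1 < size (den f))%N by have := st _ ii; rewrite mem_iota.
  rewrite raw_nth //=.
  have -> : (i.1 == dep_pos d) = false.
    by apply/negbTE; case/andP: ud => + _; apply: contraNneq => <-.
  by case: eqP => //= _; apply: leq_pred.
have -> : (size (den (expand_at f d r)) == size (den f)) = false.
  by rewrite ltn_eqF.
by have := leq_mul lt (leqnn M.+2); lia.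
Qed.

Lemma weight_cat L1 L2 : weight (L1 ++ L2) = (weight L1 + weight L2)%N.
Proof. exact: big_cat. Qed.

Lemma weight_expand f d : fraction_inv f -> preferred f = Some d ->
  (weight (Defs.expand f d) < M.+2 ^ potential f)%N.
Proof.
move=> fi pd; have dep := inv_preferred fi pd.
have mf : (0 < potential f)%N.
  have [_ ad _ _ _] := dep; rewrite /potential addn_gt0 muln_gt0 /=.
  by case/andP: ad; case: (size (den f)).
rewrite -(prednK mf) expnS /weight big_map.
apply: (@leq_ltn_trans (\sum_(r <- iota 0 (size (dep_terms d))) M.+2 ^ (potential f).-1)).
  rewrite big_seq [X in (_ <= X)%N]big_seq; apply: leq_sum => r.
  rewrite mem_iota add0n => /(expand_inv fi pd)[_ lt].
  by apply: leq_pexp2l => //; lia.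
rewrite big_const_seq count_predT size_iota iter_addn_0 mulnC ltn_pmul2r ?expn_gt0 //.
by rewrite ltnS leqW // (size_terms fi dep).
Qed.

Lemma In_cat (T : Type) (x : T) s t : List.In x (s ++ t) <-> List.In x s \/ List.In x t.
Proof. exact: List.in_app_iff. Qed.

Lemma weight_cons f L : weight (f :: L) = (M.+2 ^ potential f + weight L)%N.
Proof. exact: big_cons. Qed.

Lemma pf_step_inv L L' : pf_inv L -> pf_step L L' -> pf_inv L' /\ (weight L' < weight L)%N.
Proof.
move=> [fi v] st; case: st fi v => {L L'} [L1 f L2 d pd|L1 f L2 d np nr dep|L1 f L2 np nr sf] fi v.
- have ff : fraction_inv f by apply: fi; apply/In_cat; right; left.
  have dep := inv_preferred ff pd.
  split; last first.
    rewrite !weight_cat weight_cons ltn_add2l ltn_add2r; exact: weight_expand.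
  split; last first.
    rewrite -v !big_cat big_cons /=; congr (_ + (_ + _)).
    apply: (@expand_val _ h) => //.
      move=> t /(inv_factor ff)[/pos_alpha p s0 _].
      by rewrite /fvec dotMnr pmulrn_rgt0.
    by apply/allP => t /(inv_factor ff)[].
  move=> g /In_cat[gL|/In_cat[|gL]]; [by apply: fi; apply/In_cat; left| |
    by apply: fi; apply/In_cat; right; right].
  rewrite /Defs.expand => /List.in_map_iff[r [<- /In_mem]].
  by rewrite mem_iota add0n => /(expand_inv ff pd)[].
- have ff : fraction_inv f by apply: fi; apply/In_cat; right; left.
  have [fa fs fp fr] := ff.
  have pf : preferred f = None.
    have : ~~ isSome (preferred f) by move: np; rewrite /no_preferred all_cat /= => /and3P[].
    by case: (preferred f).
  split; last first.
    rewrite !weight_cat !weight_cons ltn_add2l ltn_add2r ltn_exp2l //.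
    rewrite /potential /= (negbTE nr) pf ltn_add2l ltnS.
    exact: (term_mult_le ff dep).
  split; last by rewrite -v !big_cat !big_cons.
  move=> g /In_cat[gL|[<-|gL]]; [by apply: fi; apply/In_cat; left| |
    by apply: fi; apply/In_cat; right; right].
  split=> //=; first by move=> d' [<-].
  by move=> rf; rewrite rf in nr.
- have ff : fraction_inv f by apply: fi; apply/In_cat; right; left.
  have [fa fs fp fr] := ff.
  have pf : preferred f = None.
    have : ~~ isSome (preferred f) by move: np; rewrite /no_preferred all_cat /= => /and3P[].
    by case: (preferred f).
  split; last first.
    rewrite !weight_cat !weight_cons ltn_add2l ltn_add2r.
    by rewrite ltn_exp2l // /potential /= (negbTE nr) pf ltn_add2l.
  split; last by rewrite -v !big_cat !big_cons.
  move=> g /In_cat[gL|[<-|gL]]; [by apply: fi; apply/In_cat; left| |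
    by apply: fi; apply/In_cat; right; right].
  by split.
Qed.

(** Clearing denominators in a linear relation between the directions gives an integral
relation between their multiples; up to a change of sign some coefficient is positive,
and it becomes a_0. *)
Lemma dependence_exists T : (forall t, t \in T -> 0 < fscale t)%N ->
  ~~ support_free T -> exists d, is_dependence T d.
Proof.
move=> sT nfree.
have sz : size [seq intv rat (fphi t) | t <- T] == size T by rewrite size_map.
have [k [k0 [i ki]]] : exists k : 'I_(size T) -> rat,
    \sum_i k i *: intv rat (fphi (nth (fac0 n) T i)) = 0 /\ exists i, k i != 0.
  apply: contrapT => H; move/negP: nfree; apply.
  apply/(@freeP _ _ _ (Tuple sz)) => k k0 i; apply: contrapT => ki; apply: H.
  exists k; split; last by exists i; apply/eqP.
  by rewrite -[RHS]k0; apply: eq_bigr => l _; rewrite (nth_map (fac0 n)).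
pose s i := (fscale (nth (fac0 n) T i))%:R : rat.
have s0 (l : 'I_(size T)) : s l != 0.
  by rewrite pnatr_eq0 -lt0n; apply/sT/mem_nth.
have [e e0 [m me]] := common_denominator_int (fun l : 'I_(size T) => k l / s l).
have msum : \sum_(l < size T) den_vec T l *~ m l = 0.
  apply: (@intv_inj rat); rewrite intv0 intv_sum -[RHS](scaler0 _ e%:R) -[in RHS]k0.
  rewrite scaler_sumr; apply: eq_bigr => l _; rewrite intvMz -me /den_vec intvMn !scalerA.
  by congr (_ *: _); rewrite -/(s l) mulrAC divfK // mulrC.
have mi : m i != 0.
  rewrite -(intr_eq0 rat) -me !mulf_neq0 ?invr_eq0 // pnatr_eq0 -lt0n //.
clear k k0 ki me.
wlog mi0 : m msum mi / 0 < m i.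
  move=> W; case: (ltrgtP (m i) 0) mi => // mi _; last by apply: (W m); rewrite // gt_eqF.
  apply: (W (fun l => - m l)); rewrite ?oppr_gt0 ?oppr_eq0 ?lt_eqF //.
  by under eq_bigr do rewrite mulrNz; rewrite sumrN msum oppr0.
exists (Dependence i `|m i|%N [seq (nat_of_ord l, - m l) | l <- enum 'I_(size T) & (l != i) && (m l != 0)]).
have terms1 : [seq j.1 | j <- [seq (nat_of_ord l, - m l) | l <- enum 'I_(size T) & (l != i) && (m l != 0)]]
    = [seq nat_of_ord l | l <- enum 'I_(size T) & (l != i) && (m l != 0)].
  by rewrite -map_comp.
split=> /=; rewrite ?terms1.
- apply/andP; split; last first.
    by rewrite map_inj_uniq; [apply/filter_uniq/enum_uniq | exact: val_inj].
  by apply/mapP => -[l]; rewrite mem_filter => /andP[/andP[li _] _] /val_inj il; rewrite il eqxx in li.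
- apply/andP; split; first exact: ltn_ord.
  by apply/allP => _ /mapP[l _ ->]; apply: ltn_ord.
- by rewrite absz_gt0 gt_eqF.
- by apply/allP => _ /mapP[l + ->]; rewrite mem_filter /= oppr_eq0 => /andP[/andP[]].
- rewrite big_map big_filter big_enum_cond /=.
  have -> : den_vec T i *+ `|m i| = den_vec T i *~ m i.
    by rewrite pmulrn gez0_abs // ltW.
  move/eqP: msum; rewrite (bigD1 i) //= addr_eq0 => /eqP ->; rewrite -sumrN.
  rewrite [RHS]big_mkcond [LHS]big_mkcond; apply: eq_bigr => l _ /=.
  case: (eqVneq (m l) 0) => [->|_]; rewrite ?andbF ?andbT ?mulr0z ?oppr0.
    by case: ifP.
  by case: ifP; rewrite ?mulrNz.
Qed.

Lemma pf_progress L : pf_inv L -> ~~ pf_terminal L -> exists L', pf_step L L'.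
Proof.
move=> [fi _] nt; have [np|] := boolP (no_preferred L).
  have [L1 [f [L2 [LE nr]]]] : exists L1 f L2, L = L1 ++ f :: L2 /\ ~~ reduced f.
    elim: L nt {fi np} => [|f L IH] //=; rewrite negb_and => /orP[nr|/IH].
      by exists [::], f, L.
    by case=> L1 [g [L2 [-> nr]]]; exists (f :: L1), g, L2.
  subst L; have ff : fraction_inv f by apply: fi; apply/In_cat; right; left.
  have [sf|nsf] := boolP (support_free (den f)).
    by eexists; apply: pf_label.
  have [|d dep] := dependence_exists _ nsf; first by move=> t /(inv_factor ff)[].
  by eexists; apply: pf_choose dep.
move=> pr.
have [L1 [f [L2 [LE nr]]]] : exists L1 f L2, L = L1 ++ f :: L2 /\ isSome (preferred f).
  elim: L pr {fi nt} => [|f L IH] //=; rewrite negb_and negbK => /orP[nr|/IH].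
    by exists [::], f, L.
  by case=> L1 [g [L2 [-> nr]]]; exists (f :: L1), g, L2.
case pd : (preferred f) nr => [d|] // _; subst L.
by eexists; apply: (pf_expand _ _ pd).
Qed.

Lemma pf_inv_start : pf_inv (pf_start alpha).
Proof.
split; last first.
  rewrite /pf_start big_seq1 /fraction_val /=.
  rewrite {1}/laurent_val big_seq1 /= ratr_tofrac !rmorph1 mul1r xpow0 mul1r.
  rewrite /factors_val big_map /generating_function.
  rewrite -[RHS]big_undup_iterop_count /=; apply: eq_bigr => v _.
  by rewrite /fvec /= mulr1n -exprVn.
move=> f [<-|] //; split=> //=.
- move=> t /mapP[v]; rewrite mem_undup => va ->; split=> //.
  by rewrite /fmult /= -has_count has_pred1.
- rewrite big_map /= /M -(perm_size (perm_count_undup alpha)) size_flatten /shape.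
  by rewrite sumnE -map_comp big_map; apply: eq_bigr => v _; rewrite /= size_nseq.
Qed.

Lemma pf_terminates (Q : seq (pfraction n) -> Prop) L :
  (forall L, pf_inv L -> pf_terminal L -> Q L) -> pf_inv L -> pf_produces Q L.
Proof.
move=> HQ; have [m] := ubnP (weight L); elim: m L => // m IH L Lm Li.
have [t|nt] := boolP (pf_terminal L); first by apply: pf_stop => //; apply: HQ.
apply: pf_continue => //; first exact: pf_progress.
move=> L' /(pf_step_inv Li)[Li' lt]; apply: IH => //.
exact: leq_trans lt _.
Qed.

End Termination.

(** * Correctness of the cone subdivision *)

Section Subdivision.
Variables (K : numFieldType) (n : nat) (alpha : seq 'rV[int]_n) (h : 'rV[int]_n).
Hypothesis pos_alpha : positive h alpha.
Implicit Types (L : seq (list_cone K n)).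

Lemma intv_decide (g : 'rV[rat]_n) :
  (exists z, g = intv rat z) \/ (forall z, ratv K g <> intv K z).
Proof.
have [[z ->]|nz] := pselect (exists z, g = intv rat z); first by left; exists z.
by right=> z /ratv_int_exists gz; apply: nz; exists z.
Qed.

Lemma partition_function_recursion k (g : 'rV[rat]_n) : (k < size alpha)%N ->
  partition_function (take k.+1 alpha) (ratv K g) =
  \sum_(t \in [set: nat]%classic)
     partition_function (take k alpha) (ratv K (ray g (intv rat alpha`_k) t%:R)).
Proof.
move=> ka; have ray_int z (t : nat) :
    ray (intv rat z) (intv rat alpha`_k) t%:R = intv rat (z - alpha`_k *+ t).
  by rewrite /ray intvB intvMn.
have p : positive h (take k.+1 alpha) by move=> v /mem_take /pos_alpha.
have p' : positive h (take k alpha) by move=> v /mem_take /pos_alpha.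
have [[z ->]|ng] := intv_decide g; last first.
  rewrite partition_function_nonint // fsbig1 // => t _.
  rewrite partition_function_nonint // => z e; apply: (ng (z + alpha`_k *+ t)).
  have := ratv_int_exists e; rewrite /ray => /(canRL (subrK _)) ->.
  by rewrite -intvMn -intvD ratv_intv.
set B := `|dot h z|.+1; have zB : dot h z < B%:Z by rewrite /B; lia.
rewrite -[RHS](@fsbig_widen _ _ _ _ `I_B)%classic //=; last first.
  move=> t [_ /= /negP]; rewrite -leqNgt => Bt; rewrite ray_int ratv_intv.
  rewrite (partition_functionE K _ p') cnt_lt0 //.
  rewrite dotBr dotMnr; have a0 : 0 < dot h alpha`_k by apply/pos_alpha/mem_nth.
  have := ler_mulz_nat t a0; have : B%:Z <= t%:Z by rewrite lez_nat.
  by move: zB; lia.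
rewrite -fsbig_ord ratv_intv (partition_functionE K _ p) (take_nth 0 ka).
rewrite (@cnt_rcons _ _ B) // -?take_nth // natr_sum; apply: eq_bigr => t _.
by rewrite ray_int ratv_intv (partition_functionE K _ p').
Qed.

Definition cone_inv k (e : list_cone K n) : Prop :=
  [/\ quasipolynomial (old_qp e),
      agree_on (cone_of (ineqs e)) (partition_function (take k alpha)) (old_qp e) &
      forall q, new_qp e = Some q -> quasipolynomial q /\
        agree_on (cone_of (ineqs e)) (partition_function (take k.+1 alpha)) q].

(** By the invariant, the auxiliary function F is everywhere the partition function of
the first k vectors: on the cones of the list by induction, elsewhere by definition. *)
Lemma computed_agree L k hs q : (k < size alpha)%N ->
  (forall e, List.In e L -> cone_inv k e) -> computed alpha L k hs q ->
  quasipolynomial q /\ agree_on (cone_of hs) (partition_function (take k.+1 alpha)) q.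
Proof.
move=> ka inv [qq [F [Fold Fout Fsum]]]; split=> // g ghs.
rewrite partition_function_recursion // Fsum //; apply: eq_fsbigr => t _.
set g' := ray _ _ _.
have [[e [eL eg]]|ne] := pselect (exists e, List.In e L /\ cone_of (ineqs e) g').
  by rewrite (Fold e) //; have [_ ag _] := inv e eL; apply: ag.
by rewrite Fout // => e eL eg; apply: ne; exists e.
Qed.

Lemma subdivision_inv k L : subdivision_state alpha k L ->
  forall e, List.In e L -> cone_inv k e.
Proof.
elim=> {k L} [hs q sn fr hsE qq ag e [<-|] //|k L1 e L2 news L v st IH ka el _ sub comp|k L st IH ka allnew].
- move=> e' /List.in_app_iff[eL|/List.in_app_iff[|eL]].
  + by apply: IH; apply/List.in_app_iff; left.
  + move=> /List.in_map_iff[c [<- cn]].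
    have [qo ago _] : cone_inv k e by apply: IH; apply/List.in_app_iff; right; left.
    have sub_e g : cone_of c.1 g -> cone_of (ineqs e) g.
      move=> cg; have [_ cov _ _] := sub; apply/cov; exists c.1 => //.
      apply/In_mem/List.in_map_iff; by exists c.
    split=> //= [g /sub_e/ago //|q [<-]].
    exact: computed_agree ka IH (comp c cn).
  + by apply: IH; apply/List.in_app_iff; right; right.
- move=> e /List.in_map_iff[e' [<- eL]]; have [qo ago new] := IH e' eL.
  have := allnew e' eL; case E : (new_qp e') => [q|] //= _.
  by have [qq agq] := new q E; split=> //=; rewrite ?E.
Qed.

Lemma subdivision_cone_agree hs : subdivision_cone K alpha hs ->
  exists2 q, quasipolynomial q & agree_on (cone_of hs) (partition_function (K := K) alpha) q.
Proof.
case=> L st /In_mem/List.in_map_iff[e [<- eL]].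
have [qo ago _] := subdivision_inv st eL; exists (old_qp e) => //.
by rewrite take_size in ago.
Qed.

End Subdivision.

(** * Agreement on a chamber of the subdivision *)

Lemma rational_multiple n (w : 'rV[rat]_n) :
  exists2 c, (0 < c)%N & exists u : 'rV[int]_n, intv rat u = c%:R *: w.
Proof.
have [c c0 [m mE]] := common_denominator_int (fun k : 'I_n => w 0 k).
exists c => //; exists (\row_k m k); apply/rowP => k.
by rewrite !mxE -mE mulrC.
Qed.

Section Directions.
Variables (n : nat) (f : pfraction n) (w : 'rV[rat]_n) (u : 'rV[int]_n) (c : nat).
Hypotheses (c0 : (0 < c)%N) (uw : intv rat u = c%:R *: w).

Lemma dot_ray (b : 'rV[rat]_n) z k : dot b (intv rat (z + u *+ k)) =
  dot b (intv rat z) + (c%:R * dot b w) * k%:R.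
Proof.
by rewrite intvD intvMn uw dotDr !dotZr; congr (_ + _); rewrite mulrC.
Qed.

(** A facet functional that is negative at w tends to minus infinity along u. *)
Lemma decisive_outside : ~ covers f w -> decisive f w u.
Proof.
move=> nw z; right; split=> //; have [hs H] := cone_facets [seq fphi t | t <- den f].
have [b bh bw] : exists2 b, b \in hs & dot b w < 0.
  apply: contrapT => nb; apply: nw; apply/H => b bh; rewrite ratv_id leNgt.
  by apply/negP => bw; apply: nb; exists b.
have [|k0 Hk] := @eventually_lt0 (dot b (intv rat z)) (c%:R * dot b w).
  by rewrite pmulr_rlt0 // ltr0n.
exists k0 => k /Hk; rewrite -dot_ray => lt /H/(_ b bh); rewrite ratv_id.
by rewrite leNgt lt.
Qed.

Hypotheses (indf : independent (den f)) (sf : size (den f) = n).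

(** The coordinates with respect to the vectors of f tend to infinity along u. *)
Lemma decisive_inside : (forall i, 0 < dot (dual_vec rat (den f) i) w) ->
  decisive f w u.
Proof.
move=> dw z; left; split; first by apply/cone_dual => // i; apply: ltW.
have : eventually_nat (fun k => forall i, List.In i (enum 'I_n) ->
    0 <= dot (dual_vec rat (den f) i) (intv rat (z + u *+ k))).
  apply: eventually_seq => i _.
  have [|k0 Hk] := @eventually_ge0 (dot (dual_vec rat (den f) i) (intv rat z))
    (c%:R * dot (dual_vec rat (den f) i) w).
    by rewrite mulr_gt0 // ltr0n.
  by exists k0 => k /Hk; rewrite -dot_ray.
case=> k0 Hk; exists k0 => k /Hk H; apply/cone_dual => // i; apply: H.
by apply/In_mem; rewrite mem_enum.
Qed.

End Directions.

Section GeneralPosition.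
Variables (n : nat) (alpha : seq 'rV[int]_n) (hs : seq 'rV[rat]_n) (w : 'rV[rat]_n).
Hypothesis iv : indicator_vector alpha hs w.
Variable f : pfraction n.
Hypotheses (fa : forall t, t \in den f -> fphi t \in alpha) (indf : independent (den f)).
Hypothesis cw : covers f w.

Lemma dim_rV : \dim {: 'rV[rat]_n} = n.
Proof. by rewrite dimvf /dim /= mul1n. Qed.

(** Otherwise w would belong to a proper subspace spanned by vectors of alpha. *)
Lemma covers_size : size (den f) = n.
Proof.
pose s := [seq fphi t | t <- den f].
have sa : {subset s <= alpha} by move=> v /mapP[t /fa + ->].
have [_ _ gp] := iv; have := gp s sa.
have fr : free [seq intv rat v | v <- s] by rewrite -map_comp; apply: indf.1.
have := fr; rewrite /free => /eqP ->; rewrite !size_map.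
have wV : w \in <<[seq intv rat v | v <- s]>>%VS.
  have [c [_ ->]] := cw; apply: memv_suml => i _; apply: memvZ.
  by apply: memv_span; apply: map_f; apply: mem_nth.
move=> /contraTN/(_ wV); rewrite -leqNgt => le; apply/eqP; rewrite eqn_leq le andbT.
have := fr; rewrite /free !size_map => /eqP <-; rewrite -[X in (_ <= X)%N]dim_rV.
exact/dimvS/subvf.
Qed.

(** If a coordinate vanished, w would be a combination of n - 1 vectors of alpha. *)
Lemma covers_interior i : 0 < dot (dual_vec rat (den f) i) w.
Proof.
have sf := covers_size.
rewrite lt_neqAle eq_sym (cone_dual indf sf _).1 // andbT; apply/negP => /eqP d0.
pose s := [seq fphi (nth (fac0 n) (den f) (nat_of_ord j)) | j <- [seq j <- enum 'I_n | j != i]].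
have sa : {subset s <= alpha}.
  by move=> v /mapP[j _ ->]; apply: fa; apply: mem_nth; rewrite sf.
have [_ _ gp] := iv; have := gp s sa.
have n0 : (0 < n)%N by apply: leq_ltn_trans (ltn_ord i).
have lt : (\dim <<[seq intv rat v | v <- s]>>%VS < n)%N.
  apply: leq_ltn_trans (dim_span _) _; rewrite !size_map size_filter.
  rewrite -[X in (_ < X)%N](size_enum_ord n) -(count_predC (pred1 i)).
  by rewrite -[X in (X < _)%N]add0n ltn_add2r -has_count has_pred1 mem_enum.
move=> /(_ lt)/negP; apply; rewrite [w](dual_expansion indf sf).
rewrite (bigD1 i) //= d0 scale0r add0r; apply: memv_suml => j ji; apply: memvZ.
rewrite den_vec_phi; apply/memvZ/memv_span; apply: map_f.
apply: (map_f (fun j : 'I_n => fphi (nth (fac0 n) (den f) j))).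
by rewrite mem_filter ji mem_enum.
Qed.

End GeneralPosition.

Section ChamberAgreement.
Variables (K : numFieldType) (n : nat) (alpha : seq 'rV[int]_n) (h : 'rV[int]_n).
Hypothesis pos_alpha : positive h alpha.

(** Expand, in the half-space h > 0, the difference of the two sides of the
decomposition. *)
Lemma value_expansion (L : seq (pfraction n)) :
  (forall f, List.In f L -> positive h [seq fvec t | t <- den f]) ->
  \sum_(f <- L) fraction_val f = generating_function alpha ->
  forall g, (cnt h alpha g)%:R =
     \sum_(f <- L) act (Defs.num f) (fun g => (cnt h (vecs (den f)) g)%:R) g.
Proof.
move=> pf v g; apply/eqP; rewrite eq_sym -subr_eq0; apply/eqP.
(* the coefficient -1 moves the generating function of alpha to the other side *)
pose S := ([:: (-1, 0)], alpha) :: [seq (Defs.num f, vecs (den f)) | f <- L].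
have S0 : series h S g = 0.
  apply: series_val0 => [t|]; rewrite /S.
    rewrite inE => /predU1P[-> //|/In_mem/List.in_map_iff[f [<- fL]]].
    exact/positive_vecs/pf.
  rewrite /value big_cons big_map /= /laurent_val big_seq1 /= ratr_tofrac !rmorphN.
  rewrite !rmorph1 xpow0 mulr1 mulN1r; apply/eqP; rewrite addrC subr_eq0.
  rewrite -/(generating_function alpha) -v; apply/eqP; apply: eq_bigr => f _.
  rewrite /fraction_val; congr (_ * _); rewrite /vecs big_flatten big_map.
  by apply: eq_bigr => t _; rewrite big_nseq -exprVn -GRing.Theory.iter_mulr_1.
by rewrite -[RHS]S0 /series /S big_cons big_map /= {2}/act big_seq1 /= subr0 mulN1r [RHS]addrC.
Qed.

Lemma terminal_expansion L : pf_inv alpha L -> pf_terminal L ->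
  [/\ forall f, List.In f L -> positive h [seq fvec t | t <- den f],
      forall f, List.In f L -> independent (den f),
      forall f, List.In f L -> forall t, t \in den f -> fphi t \in alpha &
      forall g, (cnt h alpha g)%:R =
        \sum_(f <- L) act (Defs.num f) (fun g => (cnt h (vecs (den f)) g)%:R) g].
Proof.
move=> [fi v] tL; have pf f : List.In f L -> positive h [seq fvec t | t <- den f].
  move=> fL w /mapP[t /(inv_factor (fi f fL))[/pos_alpha p s0 _] ->].
  by rewrite /fvec dotMnr pmulrn_rgt0.
split=> //.
- move=> f fL; have [fa fs fp fr] := fi f fL.
  have red : reduced f.
    elim: L tL fL {fi v pf} => [|g L IH] //= /andP[rg rL] [<-|/(IH rL)] //.
  by split; [apply: (fr red).1 | apply/allP => t /fa[_ -> ->]].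
- by move=> f fL t /(inv_factor (fi f fL))[].
- exact: value_expansion.
Qed.

End ChamberAgreement.

Section Chamber.
Variables (K : numFieldType) (n : nat) (alpha : seq 'rV[int]_n) (h : 'rV[int]_n).
Hypothesis pos_alpha : positive h alpha.

Lemma produced_nonint (L : seq (pfraction n)) w (g : 'rV[K]_n) :
  (forall f, List.In f L -> covers f w -> independent (den f) /\ size (den f) = n) ->
  (forall z, g <> intv K z) -> produced_expression w L g = 0.
Proof.
move=> HL gz; rewrite produced_expressionE.
elim: L HL => [|f L IH] HL; first by rewrite big_nil.
rewrite big_cons IH ?addr0; last by move=> f' ?; apply: HL; right.
case: asboolP => // cf; have [_ sf] := HL f (or_introl erefl) cf.
by rewrite contribution_nonint.
Qed.

Lemma cone_of_shift (hs : seq 'rV[rat]_n) (g w : 'rV[rat]_n) (k : nat) :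
  cone_of hs g -> cone_of hs w -> cone_of hs (g + k%:R *: w).
Proof.
by move=> gh wh b bh; rewrite dotDr dotZr addr_ge0 ?mulr_ge0 ?ler0n ?gh ?wh.
Qed.

(** The chamber is a convex cone containing w, so it contains all the points z + k u,
with u a multiple of w. Along them the quasipolynomial q given by the subdivision equals
P for all k, and the produced expression equals P for large k. *)
Lemma chamber_agree hs w L :
  subdivision_cone K alpha hs -> indicator_vector alpha hs w ->
  pf_inv alpha L -> pf_terminal L ->
  quasipolynomial (produced_expression w L : 'rV[K]_n -> K) /\
  agree_on (cone_of hs) (partition_function (K := K) alpha) (produced_expression w L).
Proof.
move=> sub iv invL tL.
have [posL indL faL expL] := terminal_expansion pos_alpha invL tL.
have HL f : List.In f L -> covers f w -> independent (den f) /\ size (den f) = n.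
  move=> fL cf; split; first exact: indL.
  exact: (covers_size iv (faL f fL) (indL f fL) cf).
have qE := @quasipolynomial_produced K n w L HL; split=> // g gh.
have [[z gz]|ng] := intv_decide K g; last first.
  by rewrite partition_function_nonint // produced_nonint.
have [q qq ag] := subdivision_cone_agree pos_alpha sub.
have [c c0 [u uw]] := rational_multiple w.
have [wh _ _] := iv.
have dec f : List.In f L -> decisive f w u.
  move=> fL; have [cf|ncf] := pselect (covers f w); last exact: decisive_outside c0 uw ncf.
  have [indf sf] := HL f fL cf.
  apply: (decisive_inside c0 uw) => // i.
  exact: (covers_interior iv (faL f fL)).
have [d1 d10 k1] := quasipolynomial_ray qq.
have [d2 d20 k2] := quasipolynomial_ray qE.
have [m1 kill1] := k1 z (u *+ d2); have [m2 kill2] := k2 z (u *+ d1).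
pose v k := z + u *+ (k * (d1 * d2)).
have in_hs k : cone_of hs (intv rat (v k)).
  rewrite /v intvD intvMn uw scalerA -natrM -gz.
  exact: cone_of_shift.
have Pq k : (cnt h alpha (v k))%:R = q (intv K (v k)).
  by rewrite -(partition_functionE K _ pos_alpha) -ratv_intv; apply: ag.
have [k0 Hk0] := produced_eventually K posL expL dec HL z.
have kq : killed m1 (fun k => q (intv K (v k))).
  apply: eq_killed kill1 => k; rewrite /v -mulrnA.
  by congr (q (intv K (z + u *+ _))); lia.
have kE : killed m2 (fun k => produced_expression w L (intv K (v k))).
  apply: eq_killed kill2 => k; rewrite /v -mulrnA.
  by congr (produced_expression w L (intv K (z + u *+ _))); lia.
have ev k : (k0 <= k)%N -> q (intv K (v k)) = produced_expression w L (intv K (v k)).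
  move=> k0k; rewrite -Pq; apply: Hk0.
  by apply: leq_trans k0k _; rewrite leq_pmulr // muln_gt0 d10.
have v0 : v 0%N = z by rewrite /v mul0n mulr0n addr0.
rewrite gz ratv_intv -v0 -(killed_eventually_eq kq kE ev) -Pq.
by rewrite -(partition_functionE K _ pos_alpha).
Qed.

End Chamber.

(** * Components and boundaries in real space *)

Section Topology.
Local Open Scope classical_set_scope.
Variables (R : realType) (n : nat).
Implicit Types (y x g : 'rV[R]_n) (A B : set 'rV[R]_n).

Lemma dot_continuous (b : 'rV[R]_n) : continuous (dot b : 'rV[R]_n -> R).
Proof.
move=> y; have FF : Filter (nbhs y) := nbhs_filter (y : 'rV[R]_n).
rewrite /dot; have : forall r : seq 'I_n,
    (fun x => \sum_(k <- r) b 0 k * x 0 k) @ y --> (\sum_(k <- r) b 0 k * y 0 k).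
  elim=> [|k r IH].
    have -> : (fun x : 'rV[R]_n => \sum_(k <- [::]) b 0 k * x 0 k) = fun=> 0.
      by apply/funext => x; rewrite big_nil.
    by rewrite big_nil; apply: cvg_cst.
  have -> : (fun x : 'rV[R]_n => \sum_(j <- k :: r) b 0 j * x 0 j) =
      fun x => b 0 k * x 0 k + \sum_(j <- r) b 0 j * x 0 j.
    by apply/funext => x; rewrite big_cons.
  rewrite big_cons; apply: cvgD => //.
  by apply: cvgM; [exact: cvg_cst | exact: coord_continuous].
move=> /(_ (index_enum 'I_n)); exact.
Qed.

Lemma open_halfspaces (s : seq 'rV[rat]_n) (P : 'rV[rat]_n -> Prop) :
  open [set y | forall b, b \in s -> P b -> 0 < dot (ratv R b) y].
Proof.
elim: s => [|b s IH].
  rewrite (_ : [set _ | _] = setT); first exact: openT.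
  by apply/seteqP; split=> // y _ b; rewrite in_nil.
have [Pb|nPb] := pselect (P b); last first.
  rewrite (_ : [set _ | _] = [set y | forall b, b \in s -> P b -> 0 < dot (ratv R b) y]) //.
  apply/seteqP; split=> y /= H c cs Pc; apply: H => //; first by rewrite inE cs orbT.
  by move: cs Pc; rewrite inE => /predU1P[->|//].
rewrite (_ : [set _ | _] = [set y | forall b, b \in s -> P b -> 0 < dot (ratv R b) y]
   `&` dot (ratv R b) @^-1` [set x | 0 < x]).
  apply: openI => //; apply: open_comp; last exact: open_gt.
  by move=> y _; apply: dot_continuous.
apply/seteqP; split=> y /=.
  by move=> H; split=> [c cs Pc|]; apply: H; rewrite ?inE ?eqxx // cs orbT.
by case=> H Hb c; rewrite inE => /predU1P[->|/H].
Qed.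

Lemma closed_cone (s : seq 'rV[int]_n) : closed (Lambda (@nonneg R) s).
Proof.
have [hs H] := cone_facets s.
have -> : Lambda (@nonneg R) s = [set y | forall b, b \in hs -> 0 <= dot (ratv R b) y].
  by apply/seteqP; split=> y; rewrite H.
elim: hs {H} => [|b hs IH].
  rewrite (_ : [set _ | _] = setT); first exact: closedT.
  by apply/seteqP; split=> // y _ b; rewrite in_nil.
rewrite (_ : [set _ | _] = [set y | forall b, b \in hs -> 0 <= dot (ratv R b) y]
   `&` dot (ratv R b) @^-1` [set x | 0 <= x]).
  apply: closedI => //; apply: preimage_closed; last exact: closed_ge.
  by move=> y _; apply: dot_continuous.
apply/seteqP; split=> y /=.
  by move=> H; split=> [c cs|]; apply: H; rewrite ?inE ?eqxx // cs orbT.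
by case=> H Hb c; rewrite inE => /predU1P[->|/H].
Qed.

Lemma ball_move y g (e : R) : 0 < e ->
  exists2 e0, 0 < e0 & forall t, `|t| < e0 -> ball y e (y + t *: g).
Proof.
move=> e_gt0; pose M := 1 + \sum_k `|g 0 k|.
have M0 : 0 < M by rewrite ltr_pwDl // sumr_ge0.
exists (e / M); first exact: divr_gt0.
move=> t te; split=> // i k; rewrite /ball /= !mxE ord1 opprD addrA subrr sub0r normrN normrM.
apply: le_lt_trans (_ : `|t| * M < _); last by rewrite -ltr_pdivlMr.
rewrite ler_wpM2l // /M (bigD1 k) //= addrCA lerDl addr_ge0 // sumr_ge0 //.
Qed.

Lemma interior_move A y g : interior A y ->
  exists2 e0 : R, 0 < e0 & forall t, `|t| < e0 -> A (y + t *: g).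
Proof.
move=> /nbhs_ballP[e /= e0 sub]; have [d d0 H] := ball_move y g e0.
by exists d => // t /H/sub.
Qed.

(** Off the boundary of A, the interior and the closure of A coincide; so A cuts B in a
set that is both open and closed in B. *)
Lemma connected_boundary A B : connected B -> B `&` boundary A = set0 ->
  B `<=` interior A \/ B `&` A = set0.
Proof.
move=> cB BA.
have [e|/eqP/set0P ne] := pselect (B `&` interior A = set0).
  right; apply/seteqP; split=> // y [By Ay].
  have : (B `&` boundary A) y.
    split=> //; split; first exact: subset_closure.
    by move=> iy; have : (B `&` interior A) y by []; rewrite e => -[].
  by rewrite BA => -[].
left; have <- : B `&` interior A = B; last by move=> y [].
apply: cB => //; first by exists (interior A); first exact: open_interior.
exists (closure A); first exact: closed_closure.
apply/seteqP; split=> y [By Ay]; split=> //.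
  by apply: subset_closure; apply: interior_subset.
apply: contrapT => niy; have : (B `&` boundary A) y by [].
by rewrite BA => -[].
Qed.

(** The segment from the centre of a ball to one of its points stays in the ball. *)
Lemma ball_connected_component A x y : open A -> connected_component A x y ->
  exists2 e : R, 0 < e & ball y e `<=` connected_component A x.
Proof.
move=> oA xy; have Ay := connected_component_sub xy.
have /nbhs_ballP[e /= e0 sub] := open_nbhs_nbhs (conj oA Ay).
exists e => // y' yy'; apply: connected_component_trans xy _.
pose gam (t : R) := y + t *: (y' - y).
apply: (@connected_component_max _ A (gam @` `[0, 1]) y).
- by exists 0; rewrite /= ?in_itv /= ?lexx ?ler01 // /gam scale0r addr0.
- move=> _ [t /= t01 <-]; apply: sub; split=> // i k.
  have [_ /(_ i k)] := yy'; rewrite /ball /= !mxE opprD addrA subrr sub0r normrN normrM.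
  move: t01; rewrite in_itv /= => /andP[t0 t1]; rewrite distrC; apply: le_lt_trans.
  by rewrite ger0_norm // ler_piMl.
- apply: connected_continuous_connected; first exact: segment_connected.
  apply: continuous_subspaceT => t; apply/cvg_ballP => eps eps0.
  have [d d0 H] := ball_move (gam t) (y' - y) eps0.
  apply/nbhs_ballP; exists d => //= s; rewrite /ball /= => ts.
  have -> : gam s = gam t + (s - t) *: (y' - y).
    by apply/rowP => k; rewrite !mxE; ring.
  by apply: H; rewrite distrC.
- by exists 1; rewrite /= ?in_itv /= ?lexx ?ler01 // /gam scale1r addrC subrK.
Qed.

Lemma open_connected_component A x : open A -> open (connected_component A x).
Proof.
move=> oA; rewrite openE => y xy; apply/nbhs_ballP.
by have [e e0 sub] := ball_connected_component oA xy; exists e.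
Qed.

Lemma rational_dense A y : open A -> A y -> exists g : 'rV[rat]_n, A (ratv R g).
Proof.
move=> oA Ay; have /nbhs_ballP[e /= e0 sub] := open_nbhs_nbhs (conj oA Ay).
have /choice[q qP] : forall k, exists q : rat, ratr q \in `](y 0 k - e), (y 0 k + e)[%R.
  by move=> k; apply: rat_in_itvoo; lra.
exists (\row_k q k); apply: sub; split=> // i k; rewrite /ball /= !mxE ord1.
by have := qP k; rewrite in_itv /= => /andP[h1 h2]; rewrite ltr_norml; lra.
Qed.

End Topology.

(** * Quasipolynomiality on the closure of a component *)

Lemma subfamily_setT n N (alpha : N.-tuple 'rV[int]_n) :
  subfamily (tnth alpha) [set: 'I_N]%SET = alpha.
Proof. by rewrite /subfamily enum_setT -enumT; apply: map_tnth_enum. Qed.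

Section InteriorDirection.
Variables (R : realType) (n : nat) (f : pfraction n).
Hypothesis indf : independent (den f).
Variable u : 'rV[rat]_n.
Hypothesis iu : interior (Lambda (@nonneg R) [seq fphi t | t <- den f]) (ratv R u).

Lemma interior_rational (g : 'rV[rat]_n) : exists2 e : rat, 0 < e & covers f (u + e *: g).
Proof.
have [e0 e00 H] := interior_move (ratv R g) iu.
have [e] := rat_in_itvoo e00; rewrite in_itv /= => /andP[e1 e2].
exists e; first by rewrite ltr0q in e1.
apply/(cone_ratv R).
have -> : ratv R (u + e *: g) = ratv R u + ratr e *: ratv R g.
  by apply/rowP => k; rewrite !mxE rmorphD rmorphM.
by apply: H; rewrite ger0_norm // ltW.
Qed.

(** A cone with an interior point spans the whole space. *)
Lemma interior_size : size (den f) = n.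
Proof.
have fr := indf.1; move/eqP: (fr); rewrite size_map => ds.
have cov_span g : covers f g -> g \in <<[seq intv rat (fphi t) | t <- den f]>>%VS.
  case=> c [_ ->]; apply: memv_suml => i _; apply: memvZ; apply: memv_span.
  by rewrite (map_comp (@intv rat n)); apply: map_f; apply: mem_nth.
rewrite -ds; apply/eqP; rewrite eqn_leq -[X in (_ <= X)%N]dim_rV dimvS ?subvf //=.
rewrite -[X in (X <= _)%N]dim_rV dimvS //.
apply/subvP => g _; have [e e0 /cov_span eg] := interior_rational g.
have /cov_span uS : covers f u.
  by apply/(cone_ratv R); apply: interior_subset iu.
have -> : g = e^-1 *: ((u + e *: g) - u).
  by rewrite addrAC subrr add0r scalerA mulVf ?scale1r // gt_eqF.
by rewrite memvZ // memvB.
Qed.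

(** From an interior point one can move a little in the direction opposite to a basis
vector. *)
Lemma interior_dual i : 0 < dot (dual_vec rat (den f) i) u.
Proof.
have sf := interior_size.
have [e e0] := interior_rational (- intv rat (den_vec (den f) i)).
move=> /(cone_dual indf sf)/(_ i).
rewrite dotDr dotZr dotNr dual_vec_den // eqxx mulrN1 subr_ge0.
exact: lt_le_trans.
Qed.

End InteriorDirection.

Section Core.
Local Open Scope classical_set_scope.
Variables (R : realType) (K : numFieldType) (n N : nat) (alpha : N.-tuple 'rV[int]_n).
Variable h : 'rV[int]_n.
Hypothesis pos_alpha : positive h alpha.
Variable L : seq (pfraction n).
Hypothesis posL : forall f, List.In f L -> positive h [seq fvec t | t <- den f].
Hypothesis indL : forall f, List.In f L -> independent (den f).
Hypothesis expL : forall g, (cnt h alpha g)%:R =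
  \sum_(f <- L) act (Defs.num f) (fun g => (cnt h (vecs (den f)) g)%:R) g.
Variables (Comp : set 'rV[R]_n) (x : 'rV[R]_n).
Hypotheses (Cx : Comp x) (oC : open Comp) (cC : connected Comp).
Hypothesis subC : Comp `<=` Lambda (@nonneg R) alpha.
Hypothesis bdC : forall f, List.In f L ->
  Comp `&` boundary (Lambda (@nonneg R) [seq fphi t | t <- den f]) = set0.

Lemma pos_tnth i : 0 < dot h (tnth alpha i).
Proof. by apply: pos_alpha; apply: mem_tnth. Qed.

Lemma covers_const f (u w : 'rV[rat]_n) : List.In f L ->
  Comp (ratv R u) -> Comp (ratv R w) -> covers f u <-> covers f w.
Proof.
move=> fL Cu Cw; have [sub|dis] := connected_boundary cC (bdC fL).
  by split=> _; apply/(cone_ratv R); apply: interior_subset; apply: sub.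
have no v : Comp (ratv R v) -> ~ covers f v.
  move=> Cv /(cone_ratv R) cv.
  by have : (Comp `&` Lambda (@nonneg R) [seq fphi t | t <- den f]) (ratv R v) by [];
    rewrite dis => -[].
by split=> [/(no u Cu)|/(no w Cw)].
Qed.

Lemma covers_in f (u : 'rV[rat]_n) : List.In f L -> Comp (ratv R u) -> covers f u ->
  interior (Lambda (@nonneg R) [seq fphi t | t <- den f]) (ratv R u).
Proof.
move=> fL Cu cu; have [sub|dis] := connected_boundary cC (bdC fL); first exact: sub.
move/(cone_ratv R) in cu.
by have : (Comp `&` Lambda (@nonneg R) [seq fphi t | t <- den f]) (ratv R u) by [];
  rewrite dis => -[].
Qed.

(** Take u so close to z that the facet functionals of all the cones that are positive
at z are positive at u. If u violates some facet of a cone, then the functional of this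
facet is not positive at z, hence negative at z + s u. *)
Lemma good_direction (z : 'rV[int]_n) : closure Comp (ratv R (intv rat z)) ->
  exists2 u : 'rV[rat]_n, Comp (ratv R u) &
    forall A : {set 'I_N},
      Lambda (@nonneg rat) (subfamily (tnth alpha) A) u \/
      (forall s : rat, 0 < s ->
        ~ Lambda (@nonneg rat) (subfamily (tnth alpha) A) (intv rat z + s *: u)).
Proof.
move=> zC.
have /choice[hs H] : forall A : {set 'I_N}, exists hs : seq 'rV[rat]_n,
    forall (F : realFieldType) (g : 'rV[F]_n),
    Lambda (@nonneg F) (subfamily (tnth alpha) A) g <->
    forall b, b \in hs -> 0 <= dot (ratv F b) g by move=> A; apply: cone_facets.
pose hall := flatten [seq hs A | A : {set 'I_N}].
pose W := [set y : 'rV[R]_n | forall b, b \in hall -> 0 < dot b (intv rat z) ->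
    0 < dot (ratv R b) y].
have oW : open W by apply: open_halfspaces.
have Wz : W (ratv R (intv rat z)) by move=> b _; rewrite dot_ratv ltr0q.
have [y [Cy Wy]] := zC W (open_nbhs_nbhs (conj oW Wz)).
have [u [Cu Wu]] := rational_dense (openI oC oW) (conj Cy Wy).
exists u => // A.
have [|nA] := pselect (Lambda (@nonneg rat) (subfamily (tnth alpha) A) u); first by left.
right=> s s0 /H zs; apply: nA; apply/H => b bA; rewrite ratv_id leNgt; apply/negP => bu.
have := zs b bA; rewrite ratv_id dotDr dotZr leNgt => /negP; apply.
rewrite -ltrBDr; apply: le_lt_trans (_ : 0 < _); last first.
  by rewrite sub0r oppr_gt0 pmulr_rlt0.
rewrite leNgt; apply/negP => bz.
have bh : b \in hall.
  by apply/flattenP; exists (hs A) => //; apply: map_f; rewrite mem_enum.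
by have := Wu b bh bz; rewrite dot_ratv ltr0q ltNge ltW.
Qed.

(** The cones to keep are selected by one point w of the component. The direction u
depends on z, but by [covers_const] it selects the same cones. *)
Lemma closure_quasipolynomial :
  quasipolynomial_over [set g | closure Comp (ratv R g)]
    (partition_function (K := K) alpha).
Proof.
have [w Cw] := rational_dense oC Cx.
have HL f : List.In f L -> covers f w -> independent (den f) /\ size (den f) = n.
  move=> fL cf; split; first exact: indL.
  exact: (interior_size (indL fL) (covers_in fL Cw cf)).
have qE := @quasipolynomial_produced K n w L HL.
exists (produced_expression w L) => // g gC.
have [[z gz]|ng] := intv_decide K g; last first.
  by rewrite partition_function_nonint // produced_nonint.
rewrite gz in gC *; have [u0 Cu0 dich0] := good_direction gC.
have [c c0 [u uu0]] := rational_multiple u0.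
have cQ : 0 < c%:R :> rat by rewrite ltr0n.
have dec f : List.In f L -> decisive f w u.
  move=> fL; have [cf|ncf] := pselect (covers f u0).
    have iu := covers_in fL Cu0 cf.
    have := decisive_inside c0 uu0 (indL fL) (interior_size (indL fL) iu)
      (interior_dual (indL fL) iu).
    by move=> D y; case: (D y) => -[H H']; [left|right];
      split=> //; move: H; rewrite (covers_const fL Cu0 Cw).
  move=> y; case: (decisive_outside c0 uu0 ncf y) => -[H H']; [left|right];
      split=> //; move: H; by rewrite (covers_const fL Cu0 Cw).
have [d1 d10 k1] := quasipolynomial_ray qE.
have dich A : Lambda (@nonneg rat) (subfamily (tnth alpha) A) (intv rat (u *+ d1)) \/
   (forall s : rat, 0 < s -> ~ Lambda (@nonneg rat) (subfamily (tnth alpha) A)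
      (intv rat z + s *: intv rat (u *+ d1))).
  rewrite intvMn uu0 !scalerA; case: (dich0 A) => [H|H]; [left|right=> s s0].
    by apply: coneZ => //; rewrite mulr_ge0 ?ler0n.
  by rewrite !scalerA; apply: H; rewrite !mulr_gt0 // ltr0n.
have uT : Lambda (@nonneg rat) (subfamily (tnth alpha) [set: 'I_N]%SET) (intv rat (u *+ d1)).
  rewrite subfamily_setT intvMn uu0 scalerA; apply: coneZ.
    by rewrite mulr_ge0 ?ler0n.
  by apply/(cone_ratv R); apply: subC.
have [d0 d00 kP] := ray_killed K pos_tnth dich uT.
rewrite subfamily_setT in kP.
have [m kE] := k1 z (u *+ d0).
pose v k := z + u *+ (k * (d0 * d1)).
have kP' : killed N.+1 (fun k => (cnt h alpha (v k))%:R : K).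
  apply: eq_killed kP => k; rewrite /v -mulrnA.
  by congr ((cnt h alpha (z + u *+ _))%:R); lia.
have kE' : killed m (fun k => produced_expression w L (intv K (v k))).
  apply: eq_killed kE => k; rewrite /v -mulrnA.
  by congr (produced_expression w L (intv K (z + u *+ _))); lia.
have [k0 Hk0] := produced_eventually K posL expL dec HL z.
have ev k : (k0 <= k)%N ->
    (cnt h alpha (v k))%:R = produced_expression w L (intv K (v k)).
  move=> k0k; apply: Hk0.
  by apply: leq_trans k0k _; rewrite leq_pmulr // muln_gt0 d10 d00.
have v0 : v 0%N = z by rewrite /v mul0n mulr0n addr0.
rewrite ratv_intv -v0 -(killed_eventually_eq kP' kE' ev).
by rewrite (partition_functionE K _ pos_alpha).
Qed.

End Core.

Section SplitCone.
Local Open Scope classical_set_scope.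
Variables (R : realType) (K : numFieldType) (n N : nat) (alpha : N.-tuple 'rV[int]_n).
Variable h : 'rV[int]_n.
Hypothesis pos_alpha : positive h alpha.
Variable L : seq (pfraction n).
Hypothesis posL : forall f, List.In f L -> positive h [seq fvec t | t <- den f].
Hypothesis indL : forall f, List.In f L -> independent (den f).
Hypothesis valL : \sum_(f <- L) fraction_val f = generating_function alpha.

Lemma split_cone_quasipolynomial (Ds : set (seq 'rV[int]_n)) (C : set 'rV[rat]_n) :
  finite_set Ds ->
  (forall f, List.In f L -> boundary (Lambda (@nonneg R) [seq fphi t | t <- den f])
     `<=` \bigcup_(D in Ds) boundary (Lambda (@nonneg R) D)) ->
  split_cone R alpha Ds C ->
  quasipolynomial_over C (partition_function (K := K) alpha).
Proof.
move=> finD bdL [x Ux ->]; set U := (X in connected_component X x) in Ux *.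
have oU : open U.
  rewrite /U setDE; apply: openI; first exact: open_interior.
  apply/closed_openC; apply: closed_bigcup => // D _; rewrite /boundary setDE.
  by apply: closedI; [exact: closed_closure | apply/open_closedC/open_interior].
apply: (closure_quasipolynomial K pos_alpha posL indL
  (value_expansion pos_alpha posL valL) (x := x)).
- exact: connected_component_refl.
- exact: open_connected_component.
- exact: component_connected.
- by move=> y /connected_component_sub[iy _]; apply: interior_subset.
- move=> f fL; apply/seteqP; split=> // y [/connected_component_sub[_ nb] yb].
  exact: nb (bdL f fL y yb).
Qed.

End SplitCone.

Lemma free_remove_nth n (s : seq 'rV[int]_n) m : (m < size s)%N ->
  free [seq intv rat v | v <- s] ->
  free [seq intv rat v | v <- take m s ++ drop m.+1 s].
Proof.
move=> ms; rewrite -{1}(cat_take_drop m s) (drop_nth 0 ms).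
have p : perm_eq (take m s ++ s`_m :: drop m.+1 s) (s`_m :: take m s ++ drop m.+1 s).
  by rewrite -cat1s perm_catCA.
by rewrite (perm_free (perm_map _ p)) /= free_cons => /andP[].
Qed.

(** * Boundaries of simplicial cones *)

Section CorankOne.
Local Open Scope classical_set_scope.
Variables (R : realType) (n N : nat) (alpha : N.-tuple 'rV[int]_n).
Hypothesis alpha_span : <<[seq intv rat v | v <- alpha]>>%VS = fullv.
Implicit Types (A : {set 'I_N}).

Let ratfam A := [seq intv rat v | v <- subfamily (tnth alpha) A].

Lemma subfamily_extend A : free (ratfam A) -> (#|A| < n)%N ->
  exists B : {set 'I_N}, [/\ A \subset B, free (ratfam B) & #|B| = n.-1].
Proof.
move E : (n.-1 - #|A|)%N => m; elim: m A E => [|m IH] A E fA An.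
  by exists A; split=> //; move/eqP: E; rewrite subn_eq0 => h1; lia.
have dA : \dim <<ratfam A>>%VS = #|A|.
  by move/eqP: fA => ->; rewrite !size_map cardE.
have [i iA] : exists i, intv rat (tnth alpha i) \notin <<ratfam A>>%VS.
  apply: contrapT => ni; move: An; rewrite -dA ltnNge => /negP; apply.
  rewrite -[X in (X <= _)%N]dim_rV -alpha_span dimvS //; apply/span_subvP => v.
  case/mapP => a /tnthP[i ->] ->; apply: contrapT => /negP na; apply: ni.
  by exists i.
have iNA : i \notin A.
  apply: contra iA => iA; apply: memv_span; apply: map_f.
  by apply: map_f; rewrite mem_enum.
have p : perm_eq (ratfam (i |: A)) (intv rat (tnth alpha i) :: ratfam A).
  rewrite /ratfam /subfamily -!map_comp.
  rewrite -[_ :: _]/(map (intv rat (n:=n) \o tnth alpha) (i :: enum A)); apply: perm_map.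
  apply: uniq_perm; rewrite ?enum_uniq //= ?mem_enum ?iNA ?enum_uniq //.
  by move=> j; rewrite inE !mem_enum !inE.
have [|||B [AB fB cB]] := IH (i |: A).
- by rewrite cardsU1 iNA; lia.
- by rewrite (perm_free p) free_cons iA.
- by rewrite cardsU1 iNA; lia.
exists B; split=> //; apply/fintype.subsetP => j jA.
by apply: (fintype.subsetP AB); rewrite in_setU1 jA orbT.
Qed.

Lemma interior_small_cone (s : seq 'rV[int]_n) : (size s < n)%N ->
  interior (Lambda (@nonneg R) s) = set0.
Proof.
move=> sn; apply/seteqP; split=> // y iy; move: sn; rewrite ltnNge => /negP; apply.
pose M : 'M[R]_(size s, n) := \matrix_i intv R s`_i.
have cM g : Lambda (@nonneg R) s g -> (g <= M)%MS.
  case=> c [_ ->]; apply: summx_sub => i _; apply: scalemx_sub.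
  by rewrite -[intv _ _](rowK (fun i : 'I_(size s) => intv R s`_i)) row_sub.
suff : row_full M by rewrite -col_leq_rank => /leq_trans; apply; apply: rank_leq_row.
rewrite -sub1mx; apply/row_subP => k.
have [e e0 H] := interior_move (row k 1%:M) iy.
have := H (e / 2); rewrite gtr0_norm; last by lra.
have e2 : e / 2 != 0 by rewrite gt_eqF //; lra.
move=> /(_ _)/cM H2; have yM := cM y (interior_subset iy).
have -> : row k 1%:M = (e / 2)^-1 *: ((y + (e / 2) *: row k 1%:M) - y).
  by rewrite addrAC subrr add0r scalerA mulVf ?scale1r.
by apply: scalemx_sub; apply: addmx_sub; [apply: H2; lra | rewrite eqmx_opp].
Qed.

(** Complete A to n - 1 independent vectors: the interior of their cone is empty, so
that this cone is its own boundary. *)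
Lemma small_cone_boundary A (y : 'rV[R]_n) : free (ratfam A) -> (#|A| < n)%N ->
  Lambda (@nonneg R) (subfamily (tnth alpha) A) y ->
  (\bigcup_(D in corank1_subsets alpha) boundary (Lambda (@nonneg R) D)) y.
Proof.
move=> fA An yA; have [B [AB fB cB]] := subfamily_extend fA An.
exists (subfamily (tnth alpha) B).
  exists B; split=> //; move/eqP: fB => ->; by rewrite !size_map -cardE.
split.
  apply: subset_closure; apply: cone_sub yA => v /mapP[i iA ->]; apply: cone_mem.
  by apply: map_f; move: iA; rewrite !mem_enum => /(fintype.subsetP AB).
by rewrite interior_small_cone // size_map -cardE cB; lia.
Qed.

Lemma subfamily_of (s : seq 'rV[int]_n) : {subset s <= alpha} -> uniq s ->
  exists A : {set 'I_N}, perm_eq (subfamily (tnth alpha) A) s.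
Proof.
move=> sa us.
pose A := [set i : 'I_N | (tnth alpha i \in s) && (index (tnth alpha i) alpha == i :> nat)]%SET.
exists A; apply: uniq_perm => //.
  rewrite map_inj_in_uniq ?enum_uniq // => i j; rewrite !mem_enum !inE.
  move=> /andP[_ /eqP ii] /andP[_ /eqP ji] e; apply: val_inj.
  by rewrite /= -ii -ji e.
move=> v; apply/mapP/idP => [[i iA ->]|vs].
  by move: iA; rewrite mem_enum inE => /andP[].
have iN : (index v alpha < N)%N by rewrite -[X in (_ < X)%N](size_tuple alpha) index_mem sa.
have e : tnth alpha (Ordinal iN) = v by rewrite (tnth_nth 0) nth_index ?sa.
by exists (Ordinal iN); rewrite // mem_enum inE e vs /=.
Qed.

Lemma perm_subfamily_free A (s : seq 'rV[int]_n) : perm_eq (subfamily (tnth alpha) A) s ->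
  free [seq intv rat v | v <- s] -> free (ratfam A) /\ #|A| = size s.
Proof.
move=> p fs; split; first by rewrite /ratfam (perm_free (perm_map _ p)).
by rewrite -(perm_size p) size_map -cardE.
Qed.

(** A point of the boundary lies in the cone of fewer than n of the vectors of f: a
combination of n independent vectors with positive coefficients is an interior point. *)
Lemma simplicial_boundary (f : pfraction n) : independent (den f) ->
  (forall t, t \in den f -> fphi t \in alpha) ->
  boundary (Lambda (@nonneg R) [seq fphi t | t <- den f])
  `<=` \bigcup_(D in corank1_subsets alpha) boundary (Lambda (@nonneg R) D).
Proof.
move=> indf fa y [cy niy].
have fr : free [seq intv rat v | v <- [seq fphi t | t <- den f]].
  by rewrite -map_comp; apply: indf.1.
have yc : Lambda (@nonneg R) [seq fphi t | t <- den f] y.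
  by move: cy; rewrite -(closure_id _).1 //; apply: closed_cone.
suff [s [ss fs sn ys]] : exists s : seq 'rV[int]_n,
    [/\ {subset s <= alpha}, free [seq intv rat v | v <- s], (size s < n)%N &
        Lambda (@nonneg R) s y].
  have us : uniq s by apply: (@map_uniq _ _ (intv rat (n := n))); apply: free_uniq.
  have [A p] := subfamily_of ss us; have [fA cA] := perm_subfamily_free p fs.
  apply: small_cone_boundary fA _ _; first by rewrite cA.
  by apply: cone_sub ys => v vs; apply: cone_mem; rewrite (perm_mem p).
have sn : (size (den f) <= n)%N.
  move/eqP: fr; rewrite !size_map => <-.
  by rewrite -[X in (_ <= X)%N]dim_rV dimvS ?subvf.
have sub : {subset [seq fphi t | t <- den f] <= alpha} by move=> v /mapP[t /fa + ->].
move: sn; rewrite leq_eqVlt => /orP[/eqP sn|sn]; last first.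
  by exists [seq fphi t | t <- den f]; split=> //; rewrite size_map.
set s := [seq fphi t | t <- den f] in fr sub yc niy cy *.
have [c [c0 yE]] := (Lambda_nat _ _ (lexx 0 : nonneg (0 : R))).1 yc.
have [[i ci]|allpos] := pselect (exists i : 'I_(size s), c i = 0).
  exists (take i s ++ drop i.+1 s); split.
  - by move=> v; rewrite mem_cat => /orP[/mem_take|/mem_drop] vs; apply: sub.
  - exact: free_remove_nth.
  - have : (size s = n)%N by rewrite size_map.
    by rewrite size_cat size_take size_drop ltn_ord; have := ltn_ord i; lia.
  rewrite yE (bigD1 i) //= ci scale0r add0r.
  apply: (big_ind (Lambda (@nonneg R) (take i s ++ drop i.+1 s))).
  - exact: cone0.
  - by move=> a b; apply: coneD.
  - move=> j ji; apply: coneZ; first exact: c0.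
    apply: cone_mem; rewrite mem_cat.
    case: (ltngtP (val j) (val i)) => [lt|lt|e].
    + apply/orP; left; rewrite -(nth_take 0 lt); apply: mem_nth.
      by rewrite size_take ltn_ord.
    + apply/orP; right; rewrite -(subnKC lt) -nth_drop; apply: mem_nth.
      by rewrite size_drop; have := ltn_ord j; move: lt => /=; lia.
    + by case/eqP: ji; apply: val_inj.
case: niy; have [hs H] := cone_facets s.
have cpos (i : 'I_(size s)) : 0 < c i.
  rewrite lt_neqAle [0 <= _]c0 andbT eq_sym; apply/eqP => ci; apply: allpos.
  by exists i.
have oW := @open_halfspaces R n hs (fun b => b != 0).
have sub_int : [set y : 'rV[R]_n | forall b, b \in hs -> b != 0 -> 0 < dot (ratv R b) y]
    `<=` Lambda (@nonneg R) s.
  move=> y' /= Hy; apply/H => b bh; have [->|b0] := eqVneq b 0; last by rewrite ltW ?Hy.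
  by rewrite /ratv raddf0 dotC dot0r.
move: sub_int; rewrite open_subsetE // => sub_int; apply: sub_int => b bh b0 /=.
rewrite lt_neqAle (H _ _).1 // andbT eq_sym; apply/negP => /eqP bz; move/eqP: b0; apply.
have bphi (i : 'I_(size s)) : dot b (intv rat s`_i) = 0.
  have nn (j : 'I_(size s)) : 0 <= dot (ratv R b) (intv R s`_j).
    by apply: (H R _).1 => //; apply/cone_mem/mem_nth.
  move: bz; rewrite yE dot_sumr => /eqP; rewrite psumr_eq0; last first.
    by move=> j _; rewrite dotZr mulr_ge0 // ltW.
  move=> /allP/(_ i (mem_index_enum i)); rewrite dotZr mulf_eq0 gt_eqF //=.
  by rewrite -ratv_intv dot_ratv fmorph_eq0 => /eqP.
apply/rowP => k; rewrite [RHS]mxE.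
have := dual_expansion indf sn (delta_mx 0 k); move/(congr1 (dot b)).
rewrite dot_sumr big1 => [|i _].
  rewrite /dot (bigD1 k) //= mxE !eqxx mulr1 big1 ?addr0 // => j jk.
  by rewrite mxE (negbTE jk) andbF mulr0.
have is_ : (i < size s)%N by rewrite size_map sn.
have := bphi (Ordinal is_); rewrite /= (nth_map (fac0 n)) ?sn // => e.
by rewrite dotZr den_vec_phi dotZr e !mulr0.
Qed.

End CorankOne.

(** * Conclusion *)

Lemma pf_produces_exists n (Q : seq (pfraction n) -> Prop) L : pf_produces Q L ->
  exists2 L', pf_terminal L' & Q L'.
Proof.
elim=> {L} [L tL QL|L _ [L' st] _ IH]; first by exists L.
exact: IH st.
Qed.

Lemma dot_ones_gt0 n (v : 'rV[int]_n) : v <> 0 -> (forall k, 0 <= v 0 k) ->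
  0 < dot (const_mx 1) v.
Proof.
move=> v0 vk; have dotE : dot (const_mx 1) v = \sum_k v 0 k.
  by apply: eq_bigr => k _; rewrite mxE mul1r.
rewrite dotE lt_neqAle sumr_ge0 // andbT eq_sym psumr_eq0 //; apply/allP => H.
by apply: v0; apply/rowP => k; rewrite mxE; apply/eqP/(H k); rewrite mem_index_enum.
Qed.

Theorem corollary4p3 (R : realType) (n N : nat) (alpha : N.-tuple 'rV[int]_n)
  (alpha_neq0 : forall i : 'I_N, tnth alpha i <> 0)
  (alpha_ge0 : forall (i : 'I_N) (k : 'I_n), 0 <= tnth alpha i 0 k)
  (alpha_span : <<[seq intv rat v | v <- alpha]>>%VS = fullv) :
  (forall (hs : seq 'rV[rat]_n) (w : 'rV[rat]_n),
     subdivision_cone R[i] alpha hs ->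
     indicator_vector alpha hs w ->
     pf_produces
       (fun L =>
          quasipolynomial (produced_expression (K := R[i]) w L) /\
          agree_on (cone_of hs) (partition_function (K := R[i]) alpha)
                   (produced_expression (K := R[i]) w L))
       (pf_start alpha)) /\
  (forall C : set 'rV[rat]_n,
     split_cone R alpha (corank1_subsets alpha) C ->
     quasipolynomial_over C (partition_function (K := R[i]) alpha)) /\
  (forall (I : seq (seq (pf_factor n))) (p : seq (pf_factor n) -> laurent n),
     partial_fraction_decomposition (generating_function alpha) I p ->
     common_half_space alpha I ->
     forall C : set 'rV[rat]_n,
       split_cone R alpha (cone_support I) C ->
       quasipolynomial_over C (partition_function (K := R[i]) alpha)).
Proof.
have pos1 : positive (const_mx 1) alpha.
  by move=> v /tnthP[i ->]; apply: dot_ones_gt0.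
split; last split.
- move=> hs w sub iv; apply: (pf_terminates pos1); last exact: pf_inv_start.
  by move=> L invL tL; apply: (chamber_agree pos1).
- move=> C sC.
  have [L tL invL] := pf_produces_exists
    (pf_terminates pos1 (fun L invL _ => invL) (pf_inv_start alpha)).
  have [posL indL faL expL] := terminal_expansion pos1 invL tL.
  apply: (split_cone_quasipolynomial _ pos1 posL indL (proj2 invL) _ _ sC).
    apply: (@sub_finite_set _ _
      ((fun A : {set 'I_N} => [seq tnth alpha i | i <- enum A]) @` setT)%classic).
      by move=> s [A [_ -> _]]; exists A.
    exact/finite_image/finite_finset.
  by move=> f fL; apply: simplicial_boundary (indL f fL) (faL f fL).
move=> I p [uI okI val] [h [ha hphi]] C sC.
pose L := [seq PFraction (p T) T false None | T <- I].
have inL f : List.In f L -> exists2 T, T \in I & f = PFraction (p T) T false None.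
  by move=> /List.in_map_iff[T [<- /In_mem TI]]; exists T.
have indL f : List.In f L -> independent (den f).
  by move=> /inL[T /okI[_ fr sm] ->].
have posL f : List.In f L -> positive h [seq fvec t | t <- den f].
  move=> /inL[T TI ->] v /mapP[t tT ->]; rewrite /fvec dotMnr pmulrn_rgt0 ?(hphi T) //.
  by have [_ _ /allP/(_ t tT)/andP[]] := okI T TI.
have valL : \sum_(f <- L) fraction_val f = generating_function alpha.
  by rewrite val big_map.
apply: (split_cone_quasipolynomial _ ha posL indL valL _ _ sC).
  apply: (@sub_finite_set _ _ [set` [seq [seq fphi t | t <- T] | T <- I]]%classic).
    by move=> s [T TI ->] /=; apply: map_f.
  exact: finite_seq.
move=> f /inL[T TI ->] y yb; exists [seq fphi t | t <- T] => //.
by exists T.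
Qed.
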